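(* Two Lorentz-Finsler metrics $L_1,L_2:\bar A\to[0,+\infty)$ on a manifold $M$ are anisotropically equivalent if and only if their associated cone structures are equal. Moreover, in such a case the smooth extension to any $v\in\mathcal C$ of the factor of anisotropy $\mu=L_2/L_1$ on $A$ can be computed as $$\mu(v)=\frac{g^2_v(v,w)}{g^1_v(v,w)},$$ where $g^1$ and $g^2$ are the fundamental tensors of $L_1$ and $L_2$, respectively, and $w$ is any vector in $T_{\pi(v)}M$ such that $g^1_v(v,w)\ne0$ (and, thus, $g^2_v(v,w)\neq0$).
   Context: $M$ is a real manifold of finite dimension $n\ge2$, $\pi:TM\to M$ is the natural projection and $\mathbf 0$ is the zero section of $TM$. ''Smooth'' means $C^2$ when hypotheses of minimal regularity are considered (and, consistently, $C^1$, $C^0$ for first and second derivatives), and ''as differentiable as possible'' (including eventually $C^\infty$), consistently with the regularity of the ambient, in results of smoothability. For a smooth positively 2-homogeneous function $L$ ($L(\lambda v)=\lambda^2L(v)$ for $\lambda>0$) on a conic subset of $TM$, its fundamental tensor at $v\in T_pM$ is $g_v(u,w)=\frac12\frac{\partial^2}{\partial r\partial s}L(v+ru+sw)|_{r=s=0}$, $u,w\in T_pM$. Lorentz-Finsler metric: let $A\subset TM\setminus\mathbf 0$ be open with each $A_p=A\cap T_pM$ nonempty, connected and conic (invariant under multiplication by $\lambda>0$), such that the closure $\bar A$ of $A$ in $TM\setminus\mathbf 0$ is an embedded smooth manifold with boundary $\mathcal C$. A smooth positively 2-homogeneous function $L:A\to(0,\infty)$ which can be smoothly extended as zero to $\mathcal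 C$ (the extension being denoted $L:\bar A\to[0,+\infty)$) is a Lorentz-Finsler metric if for each $p$ the boundary of $A_p$ in $T_pM\setminus\{0\}$ is smooth (the closure $\bar A_p$ of $A_p$ in $T_pM\setminus\{0\}$ is a smooth manifold with boundary) and the fundamental tensor of the extension of $L|_{A_p}$ is non-degenerate on $\bar A_p$ with index $n-1$. Then $\mathcal C$ is called the cone structure and $A$ the cone domain associated with $L$. Two Lorentz-Finsler metrics $L_1,L_2:\bar A\to[0,+\infty)$ are anisotropically equivalent if there is a smooth positive function $\mu:\bar A\to(0,\infty)$ (the anisotropic factor) such that $L_2=\mu L_1$. *)

(* Defs.v *)
From HB Require Import structures.
From mathcomp Require Import all_boot all_order all_algebra.
From mathcomp Require Import all_classical all_reals all_analysis.

Set Implicit Arguments.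
Unset Strict Implicit.
Unset Printing Implicit Defensive.

Import Order.TTheory GRing.Theory Num.Theory numFieldNormedType.Exports.

Local Open Scope classical_set_scope.
Local Open Scope ring_scope.

(* A regularity class is an [option nat]: [Some k] is C^k, [None] is C^oo. *)

Definition reg_ge2 (k : option nat) : bool :=
  if k is Some j then (2 <= j)%N else true.

Fixpoint Cn (R : realType) (V W : normedModType R) (k : nat)
    (U : set V) (f : V -> W) : Prop :=
  if k is j.+1 then
    (forall x, U x -> differentiable f x) /\ (forall v, Cn j U ('D_v f))
  else forall x, U x -> {for x, continuous f}.

(* Meant for open [U] and finite-dimensional [V], where continuity of all
   directional derivatives is continuity of the differential. *)
Definition Ck (R : realType) (V W : normedModType R) (k : option nat)
    (U : set V) (f : V -> W) : Prop :=
  if k is Some j then Cn j U f else forall j, Cn j U f.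

(* Every point comes with a preferred chart [chart_at p] around it, used only
   to identify T_pM with R^n. *)
Record manifold (R : realType) (n : nat) (k : option nat) := Manifold {
  point :> topologicalType ;
  chart : Type ;
  dom : chart -> set point ;
  coord : chart -> point -> 'rV[R]_n ;
  param : chart -> 'rV[R]_n -> point ;
  chart_at : point -> chart ;
  dom_open : forall c, open (dom c) ;
  coord_dom_open : forall c, open (coord c @` dom c) ;
  coordK : forall c, {in dom c, cancel (coord c) (param c)} ;
  coord_continuous : forall c p, dom c p -> {for p, continuous (coord c)} ;
  param_continuous : forall c x, (coord c @` dom c) x ->
    {for x, continuous (param c)} ;
  transition_Ck : forall c d,
    Ck k (coord c @` (dom c `&` dom d)) (coord d \o param c) ;
  dom_chart_at : forall p, dom (chart_at p) p ;
  point_hausdorff : hausdorff_space point ;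
  point_second_countable : @second_countable point
}.

(* The pair [(p, v)] is the tangent vector at [p] whose coordinates in the
   chart [chart_at p] are [v]; thus T_pM is ['rV[R]_n] as a vector space. The
   topology is not the product topology, see [tangent_open]. *)
Definition tangent (R : realType) (n : nat) (k : option nat)
  (M : manifold R n k) : Type := (point M * 'rV[R]_n)%type.

HB.instance Definition _ (R : realType) (n : nat) (k : option nat)
  (M : manifold R n k) := Choice.on (tangent M).

Section TangentBundle.
Variables (R : realType) (n : nat) (k : option nat) (M : manifold R n k).
Local Notation E := ('rV[R]_n * 'rV[R]_n)%type.

Definition tcod (c : chart M) : set E := [set z | (coord c @` dom c) z.1].

(* Inverse of the natural chart of TM induced by the chart c. *)
Definition tparam (c : chart M) (z : E) : tangent M :=
  let p := param c z.1 in
  (p, 'd (coord (chart_at p) \o param c) (z.1) z.2).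

(* The sets whose representation in all natural coordinates is open; this is
   the manifold topology of TM when k >= 1. *)
Definition tangent_open (W : set (tangent M)) : Prop :=
  forall c, open (tcod c `&` tparam c @^-1` W).

Lemma tcod_open c : open (tcod c).
Proof.
have -> : tcod c = (fst : E -> 'rV[R]_n) @^-1` (coord c @` dom c) by [].
apply: open_comp; last exact: coord_dom_open.
by move=> z _; exact: cvg_fst.
Qed.

Lemma tangent_openT : tangent_open setT.
Proof. by move=> c; rewrite preimage_setT setIT; exact: tcod_open. Qed.

Lemma tangent_openI : setI_closed tangent_open.
Proof.
move=> W1 W2 o1 o2 c; rewrite preimage_setI -[tcod c]setIid setIACA.
exact: openI.
Qed.

Lemma tangent_open_bigU (I : Type) (F : I -> set (tangent M)) :
  (forall i, tangent_open (F i)) -> tangent_open (\bigcup_i F i).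
Proof.
move=> oF c; rewrite preimage_bigcup setI_bigcupr.
by apply: bigcup_open => i _; exact: oF.
Qed.

HB.instance Definition _ := isOpenTopological.Build (tangent M)
  tangent_openT tangent_openI tangent_open_bigU.

End TangentBundle.

Section LorentzFinsler.
Variables (R : realType) (n : nat) (r : option nat) (M : manifold R n r).
Implicit Types (A S : set (tangent M)) (L mu : tangent M -> R).

(* As usual for subsets that need not be open, smoothness on [S] is existence
   of local smooth extensions. *)
Definition smooth_on (k : option nat) S (f : tangent M -> R) : Prop :=
  forall c z, tcod c z -> S (tparam c z) ->
  exists (U : set ('rV[R]_n * 'rV[R]_n)) (F : 'rV[R]_n * 'rV[R]_n -> R),
    [/\ open U, U z, Ck k U F
      & forall y, U y -> tcod c y -> S (tparam c y) -> F y = f (tparam c y)].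

(* [S] is an embedded C^k submanifold with boundary [dS], of codimension 0, of
   the m-dimensional space V: around each point there is a C^k diffeomorphism
   Phi, with inverse Psi, onto an open subset of R^m straightening (S, dS) to
   ({x_i >= 0}, {x_i = 0}). *)
Definition submanifold_with_boundary (k : option nat) (m : nat)
    (V : normedModType R) (S dS : set V) : Prop :=
  forall z, S z ->
  exists (U : set V) (Phi : V -> 'rV[R]_m) (Psi : 'rV[R]_m -> V) (i : 'I_m),
    [/\ open U /\ U z,
        open (Phi @` U) /\ {in U, cancel Phi Psi},
        Ck k U Phi /\ Ck k (Phi @` U) Psi
      & forall x, U x ->
          (S x <-> 0 <= Phi x 0 i) /\ (dS x <-> Phi x 0 i = 0)].

Definition tsubmanifold_with_boundary (k : option nat) S dS : Prop :=
  forall c : chart M, @submanifold_with_boundary k (n + n)%N _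
    (tcod c `&` tparam c @^-1` S) (tcod c `&` tparam c @^-1` dS).

Definition zero_section : set (tangent M) := [set v | v.2 = 0].

Definition tclosure A : set (tangent M) := closure A `\` zero_section.

Definition cone_structure A : set (tangent M) := tclosure A `\` A.

Definition fiber A (p : M) : set 'rV[R]_n := [set v | A (p, v)].

Definition fiber_closure A (p : M) : set 'rV[R]_n :=
  closure (fiber A p) `\ (0 : 'rV[R]_n).

Record cone_domain (k : option nat) A : Prop := {
  cone_open : open A ;
  cone_neq0 : A `&` zero_section = set0 ;
  cone_nonempty : forall p, fiber A p !=set0 ;
  cone_connected : forall p, connected (fiber A p) ;
  cone_conic : forall p v (t : R), 0 < t -> fiber A p v -> fiber A p (t *: v) ;
  cone_boundary : tsubmanifold_with_boundary k (tclosure A) (cone_structure A)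
}.

(* d^2/dr ds of f (v + r u + s w) at r = s = 0, halved *)
Definition fundamental_tensor (f : 'rV[R]_n -> R) (v u w : 'rV[R]_n) : R :=
  'D_u ('D_w f) v / 2.

(* The fundamental tensor at v of the extension of L|_{A_p} to the closure of
   A_p. On the boundary v + r u + s w may leave the domain of L; the second
   derivatives of the extension are there the limits of those on A_p. *)
Definition metric_tensor A L (v : tangent M) (u w : 'rV[R]_n) : R :=
  lim ((fun x => fundamental_tensor (fun y => L (v.1, y)) x u w)
         @ within (fiber A v.1) (nbhs v.2)).

Definition nondegenerate_form (b : 'rV[R]_n -> 'rV[R]_n -> R) : Prop :=
  forall u, (forall w, b u w = 0) -> u = 0.

Definition negative_definite_on (b : 'rV[R]_n -> 'rV[R]_n -> R)
  (W : {vspace 'rV[R]_n}) : Prop := forall u, u \in W -> u != 0 -> b u u < 0.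

(* The index is the largest dimension of a negative definite subspace. *)
Definition has_index (b : 'rV[R]_n -> 'rV[R]_n -> R) (m : nat) : Prop :=
  (exists2 W, negative_definite_on b W & \dim W = m) /\
  (forall W, negative_definite_on b W -> (\dim W <= m)%N).

(* Only the values of L on [tclosure A] are relevant. *)
Record Lorentz_Finsler (k : option nat) A L : Prop := {
  LF_domain : cone_domain k A ;
  LF_smooth : smooth_on k (tclosure A) L ;
  LF_gt0 : forall v, A v -> 0 < L v ;
  LF_homogeneous : forall p v (t : R), 0 < t -> A (p, v) ->
    L (p, t *: v) = t ^+ 2 * L (p, v) ;
  LF_eq0 : forall v, cone_structure A v -> L v = 0 ;
  LF_fiber_boundary : forall p, submanifold_with_boundary k n
    (fiber_closure A p) (fiber_closure A p `\` fiber A p) ;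
  LF_nondegenerate : forall p v, fiber_closure A p v ->
    nondegenerate_form (metric_tensor A L (p, v)) ;
  LF_index : forall p v, fiber_closure A p v ->
    has_index (metric_tensor A L (p, v)) n.-1
}.

(* For metrics of finite class C^k, the factor is of class C^{k-1} up to the
   boundary: L1 vanishes there, and dividing by it costs one derivative. *)
Definition anisotropic_factor (k : option nat) A1 L1 A2 L2 mu : Prop :=
  [/\ tclosure A1 = tclosure A2,
      smooth_on (omap predn k) (tclosure A1) mu,
      forall v, tclosure A1 v -> 0 < mu v
    & forall v, tclosure A1 v -> L2 v = mu v * L1 v].

Definition anisotropically_equivalent (k : option nat) A1 L1 A2 L2 : Prop :=
  exists mu, anisotropic_factor k A1 L1 A2 L2 mu.

End LorentzFinsler.

(* Main.v *)
(* The cone structure determines the cone domain. By non-degeneracy of the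
   fundamental tensor the cone structure is transverse to the fibres, so the
   closure of A restricts in T_pM to the closure of A_p: vectors of A accumulating
   at T_pM away from A_p would disconnect the fibres near p. This reduces the
   question to a single fibre. If two cone domains with the same boundary differ,
   their fibres at some p are disjoint and lie on both sides of the boundary. If
   the boundary has a non-radial tangent vector u at q, then, the index being n-1,
   the second derivative of both metrics along u is negative while the first one
   vanishes, so that q + t u is in neither closure, which is absurd. Otherwise
   n = 2 and both fibres are sectors of angle less than pi, since the square root
   of a Lorentz-Finsler metric is positive and strictly concave along a line
   contained in its domain; such sectors do not have the same boundary.

   Given the same cone domain, let x be a defining function of the cone structure
   in straightened coordinates. Both metrics vanish on the boundary with positive
   derivative across it, hence L_i = x H_i with H_i > 0 of class C^(k-1), and
   H_2 / H_1 extends L_2 / L_1. At a boundary point g^i_v(v, w) is half the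
   derivative of L_i along w, hence proportional to H_i with a factor depending
   only on w. *)

Require Import Defs.
From HB Require Import structures.
From mathcomp Require Import all_boot all_order all_algebra.
From mathcomp Require Import ring lra.
From mathcomp Require Import all_classical all_reals all_analysis.

Set Implicit Arguments.
Unset Strict Implicit.
Unset Printing Implicit Defensive.

Import Order.TTheory GRing.Theory Num.Theory numFieldNormedType.Exports.

Local Open Scope classical_set_scope.
Local Open Scope ring_scope.

Local Notation coord := Defs.coord.

(** * Calculus of C^k functions *)

(** Smoothness up to the boundary only provides local extensions, about which nothing is known off
    the closure of [A]. Euler's identities are therefore proved on [A_p], where an extension
    coincides with the metric, and reach the boundary by continuity of the derivatives of order at
    most 2. In this way the limit in [metric_tensor] becomes a second derivative of any extension,
    and [g_v(v, w)] a first derivative. The obstacle is a mismatch of closures. Smoothness and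
    straightenings concern the closure of [A] in TM, whereas non-degeneracy, hence transversality,
    is given only on the closure of each [A_p]. Transversality thus cannot be applied to an
    arbitrary vector of the first closure; it shows that, in T_pM, the second closure is relatively
    open in the first, so that the remaining unit vectors form a compact set. Division by a defining
    function must lose exactly one derivative, for finite classes and for C^oo alike. The quotient
    is an integral over [0, 1] that carries a weight, because differentiating it produces a term
    whose weight is multiplied by [s - 1]. *)

Section Entry.
Variables (R : realType) (m : nat) (i : 'I_m).

Definition entry (w : 'rV[R]_m) : R := w 0 i.

Fact entry_is_linear : linear entry.
Proof. by move=> a u w; rewrite /entry !mxE. Qed.

HB.instance Definition _ := GRing.isLinear.Build _ _ _ _ entry entry_is_linear.

Lemma entry_continuous : continuous entry. Proof. exact: coord_continuous. Qed.

End Entry.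

Section Cn_calculus.
Variable R : realType.
Implicit Types V W X : normedModType R.

(** An explicit error bound in place of the little-o notation, for differentials that are built by
    hand, such as that of an integral depending on a parameter. *)
Lemma differentiable_approx V W (f : V -> W) (df : {linear V -> W}) (x : V) :
  continuous df ->
  (forall e, 0 < e -> \forall h \near (0 : V), `|f (h + x) - f x - df h| <= e * `|h|) ->
  differentiable f x /\ 'd f x = df :> (V -> W).
Proof.
move=> cdf fo.
have E : f \o shift x = cst (f x) + df +o_ 0 id.
  apply/eqaddoP => e e0 /=; near=> h.
  have -> : (f \o shift x - (cst (f x) + df)) h = f (h + x) - f x - df h.
    by rewrite !fctE opprD addrA.
  by near: h; exact: fo.
have D : 'd f x = df :> (V -> W) by exact: diff_unique.
split=> //; apply/diff_locallyP; split; last by rewrite D.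
by move=> y; rewrite D; exact: cdf.
Unshelve. all: by end_near. Qed.

Lemma near_eq_differentiable V W (f g : V -> W) (x : V) :
  {near x, f =1 g} -> differentiable f x -> differentiable g x.
Proof.
move=> fg /[dup] df /diff_locally E.
apply: (@differentiable_approx _ _ _ ('d f x) _ _ _).1.
  exact: diff_continuous.
move=> e e0; move/eqaddoP : E => /(_ e e0) /= E.
have fg0 : \forall h \near (0 : V), f (h + x) = g (h + x).
  have := fg; rewrite (near_shift 0) /=; apply: filterS => h /=.
  by rewrite subr0.
near=> h.
rewrite -(near fg0 h) // -(nbhs_singleton fg).
have -> : f (h + x) - f x - 'd f x h = (f \o shift x - (cst (f x) + 'd f x)) h.
  by rewrite !fctE opprD addrA.
by near: h; exact: E.
Unshelve. all: by end_near. Qed.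

Lemma derivef_near V W (f g : V -> W) (U : set V) v :
  open U -> {in U, f =1 g} -> {in U, 'D_v f =1 'D_v g}.
Proof.
move=> oU fg x xU; apply: near_eq_derive.
have : nbhs x U by apply: open_nbhs_nbhs; split => //; exact: set_mem.
by apply: filterS => y yU; apply: fg; exact: mem_set.
Qed.

Lemma Cn_eq V W k (U : set V) (f g : V -> W) :
  open U -> {in U, f =1 g} -> Cn k U f -> Cn k U g.
Proof.
move=> oU; elim: k f g => [|k IH] f g fg /=.
  move=> cf x Ux.
  have nfg : {near x, f =1 g}.
    have : nbhs x U by apply: open_nbhs_nbhs.
    by apply: filterS => y yU; apply: fg; exact: mem_set.
  change (g @ x --> g x); rewrite -(nbhs_singleton nfg).
  by apply: cvg_trans (cf x Ux); exact: near_eq_cvg.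
case=> df Df; split => [x Ux|v].
  apply: near_eq_differentiable (df _ Ux).
  have : nbhs x U by apply: open_nbhs_nbhs.
  by apply: filterS => y yU; apply: fg; exact: mem_set.
by apply: IH (Df v); exact: derivef_near.
Qed.

Lemma Cn_sub V W k (U U' : set V) (f : V -> W) :
  U' `<=` U -> Cn k U f -> Cn k U' f.
Proof.
move=> UU; elim: k f => [|k IH] f /=; first by move=> cf x /UU /cf.
by case=> df Df; split => [x /UU /df|v]//; exact: IH.
Qed.

Lemma Cn_pred V W k (U : set V) (f : V -> W) : Cn k.+1 U f -> Cn k U f.
Proof.
elim: k f => [|k IH] f [df Df]; first by move=> x /df /differentiable_continuous.
by split => // v; apply: IH; exact: Df.
Qed.

Lemma Cn_le V W k l (U : set V) (f : V -> W) :
  (k <= l)%N -> Cn l U f -> Cn k U f.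
Proof.
move=> kl; rewrite -(subnK kl); elim: (l - k)%N => // m IH.
by rewrite addSn => /Cn_pred.
Qed.

Definition reg_le (j : nat) (k : option nat) : bool :=
  if k is Some l then (j <= l)%N else true.

Lemma Ck_Cn V W (k : option nat) j (U : set V) (f : V -> W) :
  reg_le j k -> Ck k U f -> Cn j U f.
Proof. by case: k => [l|] //=; exact: Cn_le. Qed.

Lemma Cn_continuous V W k (U : set V) (f : V -> W) x :
  Cn k U f -> U x -> {for x, continuous f}.
Proof. by move=> /(Cn_le (leq0n k)) /=; exact. Qed.

Lemma Cn_diff V W k (U : set V) (f : V -> W) x :
  Cn k.+1 U f -> U x -> differentiable f x.
Proof. by case=> + _; exact. Qed.

Lemma Cn_derive V W k (U : set V) (f : V -> W) v :
  Cn k.+1 U f -> Cn k U ('D_v f).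
Proof. by move=> [_ H]; exact: H. Qed.

Lemma Cn_cst V W k (U : set V) (a : W) : Cn k U (cst a : V -> W).
Proof.
elim: k a => [|k IH] a; first by move=> x _; exact: cst_continuous.
split => [x _|v]; first exact: differentiable_cst.
have -> : 'D_v (cst a : V -> W) = cst 0 by apply/funext => x; rewrite derive_cst.
exact: IH.
Qed.

Lemma CnD V W k (U : set V) (f g : V -> W) :
  open U -> Cn k U f -> Cn k U g -> Cn k U (f + g).
Proof.
move=> oU; elim: k f g => [|k IH] f g.
  by move=> cf cg x Ux; apply: cvgD; [exact: cf|exact: cg].
move=> [df Df] [dg Dg]; split => [x Ux|v].
  by apply: differentiableD; [exact: df|exact: dg].
apply: Cn_eq (IH _ _ (Df v) (Dg v)) => // x /set_mem Ux.
by rewrite deriveD //; apply: diff_derivable; [exact: df|exact: dg].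
Qed.

Lemma Cn_sum V W k (U : set V) m (f : 'I_m -> V -> W) :
  open U -> (forall i, Cn k U (f i)) -> Cn k U (\sum_i f i).
Proof.
move=> oU cf; elim/big_ind : _ => [||i _]; last exact: cf.
  exact: Cn_cst.
by move=> *; exact: CnD.
Qed.

Lemma CnM V k (U : set V) (f g : V -> R) :
  open U -> Cn k U f -> Cn k U g -> Cn k U (f * g).
Proof.
move=> oU; elim: k f g => [|k IH] f g.
  by move=> cf cg x Ux; apply: cvgM; [exact: cf|exact: cg].
move=> /[dup] cf [df Df] /[dup] cg [dg Dg]; split => [x Ux|v].
  by apply: differentiableM; [exact: df|exact: dg].
have H1 := IH _ _ (Cn_pred cf) (Dg v).
have H2 := IH _ _ (Cn_pred cg) (Df v).
have H3 := CnD oU H1 H2.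
apply: (Cn_eq oU _ H3).
move=> x /set_mem Ux.
by rewrite deriveM //; apply: diff_derivable; [exact: df|exact: dg].
Qed.

Lemma CnV V k (U : set V) (f : V -> R) :
  open U -> (forall x, U x -> f x != 0) -> Cn k U f -> Cn k U (fun x => (f x)^-1).
Proof.
move=> oU f0; elim: k => [|k IH].
  by move=> cf x Ux; apply: cvgV; [exact: f0|exact: cf].
move=> /[dup] cf [df Df]; split => [x Ux|v].
  by apply: differentiableV; [exact: df|exact: f0].
have cV := IH (Cn_pred cf).
have H := CnM oU (@Cn_cst _ _ k U (-1 : R)) (CnM oU (CnM oU cV cV) (Df v)).
apply: (Cn_eq oU _ H).
move=> x /set_mem Ux.
rewrite deriveV; [|exact: f0|by apply: diff_derivable; exact: df].
by rewrite /= !fctE mulN1r -invfM -expr2 -exprVn /GRing.scale /= mulNr exprVn.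
Qed.

Lemma Cn_lin V W X k (U : set V) (f : V -> W) (l : {linear W -> X}) :
  open U -> continuous l -> Cn k U f -> Cn k U (l \o f).
Proof.
move=> oU cl; elim: k f => [|k IH] f.
  by move=> cf x Ux; apply: continuous_comp; [exact: cf|exact: cl].
move=> [df Df]; split => [x Ux|v].
  by apply: differentiable_comp; [exact: df|exact: linear_differentiable].
apply: Cn_eq (IH _ (Df v)) => // x /set_mem Ux /=.
have dl : differentiable l (f x) by exact: linear_differentiable.
have dfx := df _ Ux; have dlf := differentiable_comp dfx dl.
rewrite (deriveE v dlf) (deriveE v dfx) (diff_comp dfx dl) /=.
by rewrite (diff_lin _ cl).
Qed.

Lemma differentiable_affine V W (a : W) (l : {linear V -> W}) x :
  continuous l -> differentiable (fun x => a + l x) x.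
Proof.
move=> cl.
by apply: differentiableD; [exact: differentiable_cst|exact: linear_differentiable].
Qed.

Lemma derive_affine V W (a : W) (l : {linear V -> W}) x v :
  continuous l -> 'D_v (fun x => a + l x) x = l v.
Proof.
move=> cl; rewrite (deriveE v (differentiable_affine a x cl)).
rewrite (@diffD _ _ _ (cst a) l) ?diff_cst ?diff_lin //=; first by rewrite add0r.
exact: linear_differentiable.
Qed.

Lemma Cn_affine V W k (U : set V) (a : W) (l : {linear V -> W}) :
  continuous l -> Cn k U (fun x => a + l x).
Proof.
move=> cl.
have d x := differentiable_affine a x cl.
case: k => [|k]; first by move=> x _; exact: differentiable_continuous.
split=> [x _|v]; first exact: d.
have -> : 'D_v (fun x => a + l x) = cst (l v).
  by apply/funext => x; rewrite derive_affine.
exact: Cn_cst.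
Qed.

(** A finite generating family with continuous coordinate functionals. This is all that the chain
    rule for directional derivatives needs, and it passes to products, so that pairs of row vectors
    need no identification with a space of row vectors. *)
Definition frame W m (e : 'I_m -> W) (l : 'I_m -> {linear W -> R}) :=
  (forall i, continuous (l i)) /\ forall w, w = \sum_i l i w *: e i.

Lemma frame_rowvec m : @frame 'rV[R]_m m (fun i => 'e_i) (@entry R m).
Proof. by split => [i|w]; [exact: coord_continuous|rewrite {1}(row_sum_delta w)]. Qed.

Lemma frame_pair V W m n e e' l l' : @frame V m e l -> @frame W n e' l' ->
  exists f t, @frame (V * W)%type (m + n)%N f t.
Proof.
move=> [cl hl] [cl' hl'].
pose f i : V * W := match fintype.split i with inl i => (e i, 0) | inr i => (0, e' i) end.
pose t0 i (z : V * W) : R := match fintype.split i with inl i => l i z.1 | inr i => l' i z.2 end.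
have lin i : linear (t0 i).
  by move=> a u w; rewrite /t0; case: (fintype.split i) => j; rewrite linearP.
pose t i : {linear (V * W)%type -> R} :=
  HB.pack (t0 i) (GRing.isLinear.Build _ _ _ _ _ (lin i)).
exists f, t; split => [i|[v w]] /=.
  rewrite /t0; case: (fintype.split i) => j z.
    by apply: continuous_comp; [exact: cvg_fst|exact: cl].
  by apply: continuous_comp; [exact: cvg_snd|exact: cl'].
have E1 i : t0 (lshift n i) (v, w) *: f (lshift n i) = (l i v *: e i, 0).
  by rewrite /t0 /f -[lshift n i]/(unsplit (inl i)) unsplitK /=
    -[RHS]/(_, _); congr pair; rewrite /= scaler0.
have E2 i : t0 (rshift m i) (v, w) *: f (rshift m i) = (0, l' i w *: e' i).
  by rewrite /t0 /f -[rshift m i]/(unsplit (inr i)) unsplitK /=; congr pair; rewrite /= scaler0.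
rewrite big_split_ord /= (eq_bigr _ (fun i _ => E1 i)) (eq_bigr _ (fun i _ => E2 i)).
have F1 I (r : seq I) (F : I -> V * W) : (\sum_(i <- r) F i).1 = \sum_(i <- r) (F i).1.
  by elim/big_rec2: _ => // i x y _ <-.
have F2 I (r : seq I) (F : I -> V * W) : (\sum_(i <- r) F i).2 = \sum_(i <- r) (F i).2.
  by elim/big_rec2: _ => // i x y _ <-.
apply: injective_projections; rewrite /= ?F1 ?F2 /= big1_eq ?addr0 ?add0r.
  exact: hl.
exact: hl'.
Qed.

(** Since [Cn] speaks of directional derivatives only, the chain rule is expanded in the frame:
    [D_v (g o f)] is the sum of the [(D_(e i) g o f) * (l i o D_v f)], to which the induction
    hypothesis applies. *)
Lemma Cn_comp V W m e l k (U : set V) (U' : set W) (f : V -> W) (g : W -> R) :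
  @frame W m e l -> open U -> (forall x, U x -> U' (f x)) ->
  Cn k U f -> Cn k U' g -> Cn k U (g \o f).
Proof.
move=> [cl hl] oU fU; elim: k f g fU => [|k IH] f g fU.
  by move=> cf cg x Ux; apply: continuous_comp; [exact: cf|apply: cg; exact: fU].
move=> /[dup] cf [df Df] /[dup] cg [dg Dg]; split => [x Ux|v].
  by apply: differentiable_comp; [exact: df|apply: dg; exact: fU].
have H : Cn k U (\sum_i (('D_(e i) g \o f) * (l i \o 'D_v f))).
  apply: Cn_sum => // i; apply: CnM => //.
    by apply: IH (Dg _) => //; exact: Cn_pred.
  exact: Cn_lin (Df v).
apply: (Cn_eq oU _ H) => x /set_mem Ux.
have dfx := df _ Ux; have dgf := dg _ (fU _ Ux).
rewrite (deriveE v (differentiable_comp dfx dgf)) (diff_comp dfx dgf) /=.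
rewrite fct_sumE [RHS](congr1 ('d g (f x)) (hl _)) linear_sum.
apply: eq_bigr => i _.
by rewrite /= !fctE /= linearZ (deriveE _ dfx) (deriveE _ dgf) /GRing.scale /= mulrC.
Qed.

Lemma continuous_gt_near (T : topologicalType) (f : T -> R) x a :
  {for x, continuous f} -> a < f x -> \forall y \near x, a < f y.
Proof.
by move=> cf; have FF : Filter (nbhs x) := nbhs_filter x; exact: cvgr_gt cf _.
Qed.

Lemma continuous_sum (T : topologicalType) V m (f : 'I_m -> T -> V) x :
  (forall i, {for x, continuous (f i)}) ->
  {for x, continuous (fun y => \sum_i f i y)}.
Proof.
move=> cf; have FF : Filter (nbhs x) by exact: nbhs_filter.
by apply: cvg_big => [|i _]; [exact: add_continuous|exact: cf].
Qed.

(** [Cn 1] gives continuity for each fixed direction; joint continuity in point and direction,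
    needed for tangent maps and for radial derivatives ['D_x f x], follows by expanding the
    direction in the frame. *)
Lemma derive_pair_continuous W n (f : 'rV[R]_n -> W) (D : set 'rV[R]_n)
    (z : 'rV[R]_n * 'rV[R]_n) :
  open D -> Cn 1 D f -> D z.1 -> {for z, continuous (fun y => 'D_(y.2) f y.1)}.
Proof.
move=> oD [df Df] Dz; have [cl hl] := @frame_rowvec n; set l := @entry R n in cl hl.
pose F (y : 'rV[R]_n * 'rV[R]_n) : W := 'D_(y.2) f y.1.
pose G (y : 'rV[R]_n * 'rV[R]_n) : W := \sum_i l i y.2 *: 'D_('e_i) f y.1.
have GF : {near z, G =1 F}.
  have : nbhs z ((fst : ('rV[R]_n * 'rV[R]_n)%type -> _) @^-1` D).
    by apply: cvg_fst; apply: open_nbhs_nbhs.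
  apply: filterS => y Dy; rewrite /F (deriveE _ (df _ Dy)).
  rewrite [RHS](congr1 ('d f (y.1)) (hl _)) linear_sum.
  by apply: eq_bigr => i _; rewrite linearZ /= (deriveE _ (df _ Dy)).
have cG : G @ z --> G z.
  apply: continuous_sum => i; apply: cvgZ.
    by apply: continuous_comp; [exact: cvg_snd|exact: cl].
  apply: (@continuous_comp _ _ _ fst ('D_('e_i) f)); first exact: cvg_fst.
  exact: (Df 'e_i _ Dz).
change (F @ z --> F z); rewrite -(nbhs_singleton GF).
by apply: cvg_trans cG; exact: near_eq_cvg.
Qed.

Lemma eq_closure (T : topologicalType) V (A : set T) (f g : T -> V) x :
  closure A x -> (forall y, A y -> f y = g y) ->
  {for x, continuous f} -> {for x, continuous g} -> f x = g x.
Proof.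
move=> Ax fg cf cg; have PF : ProperFilter (within A (nbhs x)) by exact: within_nbhs_proper.
apply: (@cvg_unique V (@norm_hausdorff _ V) (f @ within A (nbhs x))).
  move=> N /cf Nx; change (nbhs x (fun y => A y -> N (f y))).
  have {}Nx : nbhs x (f @^-1` N) := Nx.
  by apply: filterS Nx => y Ny _.
move=> N /cg Nx; change (nbhs x (fun y => A y -> N (f y))).
have {}Nx : nbhs x (g @^-1` N) := Nx.
by apply: filterS Nx => y Ny Ay; rewrite fg.
Qed.

End Cn_calculus.

(** * Natural charts of the tangent bundle *)

Section TangentCharts.
Variables (R : realType) (n : nat) (k : option nat) (M : manifold R n (omap S k)).
Local Notation E := ('rV[R]_n * 'rV[R]_n)%type.
Implicit Types (c d a : chart M) (A W : set (tangent M)).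

Definition transition c d : 'rV[R]_n -> 'rV[R]_n := coord d \o param c.

Definition transition_dom c d : set 'rV[R]_n := coord c @` (dom c `&` dom d).

Lemma coord_paramK c x : (coord c @` dom c) x ->
  dom c (param c x) /\ coord c (param c x) = x.
Proof. by case=> p dp <-; rewrite coordK ?inE. Qed.

Lemma transition_domE c d x :
  transition_dom c d x <-> (coord c @` dom c) x /\ dom d (param c x).
Proof.
split=> [[p [cp dp] <-]|[/coord_paramK[cx E] dx]].
  by rewrite coordK ?inE //; split => //; exists p.
by exists (param c x).
Qed.

Lemma transition_dom_open c d : open (transition_dom c d).
Proof.
rewrite openE => x /transition_domE[cx dx].
have N1 : nbhs x (coord c @` dom c).
  by apply: open_nbhs_nbhs; split => //; exact: coord_dom_open.
have N2 : nbhs x (param c @^-1` dom d).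
  apply: (param_continuous cx); apply: open_nbhs_nbhs; split => //.
  exact: dom_open.
by apply: filterS2 N1 N2 => y cy dy; apply/transition_domE.
Qed.

Lemma transition_Cn1 c d : Cn 1 (transition_dom c d) (transition c d).
Proof.
by apply: Ck_Cn (transition_Ck c d); case: (k).
Qed.

Lemma transition_differentiable c d x :
  transition_dom c d x -> differentiable (transition c d) x.
Proof. by move=> cdx; exact: (transition_Cn1 c d).1. Qed.

Lemma near_eq_diff (V V' : normedModType R) (f g : V -> V') (x v : V) :
  {near x, f =1 g} -> differentiable f x -> 'd f x v = 'd g x v.
Proof.
move=> fg df; rewrite -(deriveE v df) (near_eq_derive _ fg).
by rewrite deriveE //; exact: near_eq_differentiable df.
Qed.

Lemma diff_transition c d a x v :
  transition_dom c d x -> dom a (param c x) ->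
  'd (transition c a) x v =
  'd (transition d a) (transition c d x) ('d (transition c d) x v).
Proof.
move=> /[dup] cdx /transition_domE[cx dx] ax.
have [px Ex] := coord_paramK cx.
have K : param d (transition c d x) = param c x by rewrite /transition /= coordK ?inE.
have d1 := transition_differentiable cdx.
have d2 : differentiable (transition d a) (transition c d x).
  apply: transition_differentiable; apply/transition_domE; rewrite K; split => //.
  by exists (param c x).
have DC : 'd (transition d a \o transition c d) x v =
    'd (transition d a) (transition c d x) ('d (transition c d) x v).
  have := diff_comp d1 d2.
  by move/(congr1 (fun h : _ -> _ => h v)).
apply: (etrans _ DC).
apply: near_eq_diff; last first.
  by apply: transition_differentiable; apply/transition_domE.
have : nbhs x (transition_dom c d).
  by apply: open_nbhs_nbhs; split => //; exact: transition_dom_open.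
by apply: filterS => y /transition_domE[cy dy]; rewrite /transition /= coordK ?inE.
Qed.

Lemma diff_transition_id c x v : (coord c @` dom c) x -> 'd (transition c c) x v = v.
Proof.
move=> cx; rewrite (@near_eq_diff _ _ _ id).
- by rewrite diff_val.
- have : nbhs x (coord c @` dom c).
    by apply: open_nbhs_nbhs; split => //; exact: coord_dom_open.
  by apply: filterS => y /coord_paramK[].
- by apply: transition_differentiable; apply/transition_domE; case: (coord_paramK cx).
Qed.

Lemma diff_transitionK c d x v : transition_dom c d x ->
  'd (transition d c) (transition c d x) ('d (transition c d) x v) = v.
Proof.
move=> /[dup] cdx /transition_domE[cx dx]; have [px Ex] := coord_paramK cx.
by rewrite -diff_transition // diff_transition_id.
Qed.

(** The change of natural coordinates on TM, that is, the tangent map of the transition map. *)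
Definition change c d (z : E) : E :=
  (transition c d z.1, 'd (transition c d) (z.1 : 'rV[R]_n) z.2).

Lemma tparam_change c d z : transition_dom c d z.1 ->
  tparam d (change c d z) = tparam c z.
Proof.
move=> /[dup] cdz /transition_domE[cz dz]; rewrite /tparam /change /=.
have K : param d (transition c d z.1) = param c z.1.
  by rewrite /transition /= coordK ?inE.
rewrite K; congr pair.
by rewrite -[LHS]diff_transition //; exact: dom_chart_at.
Qed.

Lemma transition_dom_chart_at c x : (coord c @` dom c) x ->
  transition_dom c (chart_at (param c x)) x.
Proof. by move=> cx; apply/transition_domE; split => //; exact: dom_chart_at. Qed.

Lemma tparam_inj c z z' : tcod c z -> tcod c z' -> tparam c z = tparam c z' -> z = z'.
Proof.
move=> cz cz' [Ep]; have [pz Ez] := coord_paramK cz; have [pz' Ez'] := coord_paramK cz'.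
have E1 : z.1 = z'.1 by rewrite -Ez Ep Ez'.
move: Ep; clear pz Ez pz' Ez'; case: z z' cz cz' E1 => [x v] [y w] /= cz cz' E1.
subst y; move=> _ E2; congr pair.
have cx := transition_dom_chart_at cz.
apply: etrans (diff_transitionK w cx).
by apply: etrans (esym (diff_transitionK v cx)) (congr1 _ E2).
Qed.

Lemma change_continuous c d z : transition_dom c d z.1 ->
  {for z, continuous (change c d)}.
Proof.
move=> cdz.
have C1 : {for z, continuous (transition c d \o (fst : E -> _))}.
  apply: (@continuous_comp _ _ _ (fst : E -> _) (transition c d)); first exact: cvg_fst.
  exact/differentiable_continuous/transition_differentiable.
have C2 := derive_pair_continuous (@transition_dom_open c d) (@transition_Cn1 c d) cdz.
pose h (y : E) : E := (transition c d y.1, 'D_(y.2) (transition c d) y.1).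
have hE : {near z, h =1 change c d}.
  have : nbhs z ((fst : E -> _) @^-1` transition_dom c d).
    by apply: cvg_fst; apply: open_nbhs_nbhs; split => //; exact: transition_dom_open.
  by apply: filterS => y dy; rewrite /h (deriveE _ (transition_differentiable dy)).
rewrite /prop_for /continuous_at -(nbhs_singleton hE).
by apply: cvg_trans (cvg_pair C1 C2); exact: near_eq_cvg.
Qed.

(** Openness in TM is tested in every natural chart [d]; there the image of [U] is locally the
    preimage of [U] under [change d c]. *)
Lemma tparam_open c (U : set E) : open U -> U `<=` tcod c -> open (tparam c @` U).
Proof.
move=> oU Uc; rewrite -[open _]/(tangent_open _) => d; rewrite openE => z [dz [z' Uz' Et]].
have cz' := Uc _ Uz'; have [pz' Ez'] := coord_paramK cz'.
have dcz : transition_dom d c z.1.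
  by apply/transition_domE; split => //; case: Et => <- _.
have cE : change d c z = z'.
  apply: (@tparam_inj c) => //; last by rewrite tparam_change.
  by exists (param d z.1) => //; have /transition_domE[] := dcz.
have N1 : nbhs z ((fst : E -> _) @^-1` transition_dom d c).
  by apply: cvg_fst; apply: open_nbhs_nbhs; split => //; exact: transition_dom_open.
have N2 : nbhs z (change d c @^-1` U).
  by apply: change_continuous => //; rewrite cE; apply: open_nbhs_nbhs.
apply: filterS2 N1 N2 => y dcy Uy; split; first by have /transition_domE[] := dcy.
by exists (change d c y) => //; rewrite tparam_change.
Qed.

Lemma tparam_nbhs c z (N : set E) : tcod c z -> nbhs z N ->
  nbhs (tparam c z) (tparam c @` (tcod c `&` N)).
Proof.
move=> cz; rewrite nbhsE => -[U [oU Uz] UN].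
apply: (@filterS _ _ _ (tparam c @` (U `&` tcod c))).
  by move=> _ [y [Uy cy] <-]; exists y => //; split => //; exact: UN.
apply: open_nbhs_nbhs; split; last by exists z.
by apply: tparam_open => [|y []//]; apply: openI => //; exact: tcod_open.
Qed.

Lemma tparam_continuous c z : tcod c z -> {for z, continuous (tparam c)}.
Proof.
move=> cz N; rewrite nbhsE => -[W [oW Wz] WN].
have /= := oW : tangent_open W => /(_ c) oc.
have : nbhs z (tcod c `&` tparam c @^-1` W) by apply: open_nbhs_nbhs.
by apply: filterS => y [_ /WN].
Qed.

Lemma closure_tparam c z A : tcod c z ->
  closure A (tparam c z) <-> closure (tcod c `&` tparam c @^-1` A) z.
Proof.
move=> cz; split=> [cA N /(tparam_nbhs cz) /cA [q [Aq [y [cy Ny] Ey]]]|cA N].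
  by exists y; rewrite /= Ey.
move=> /(tparam_continuous cz) /cA [y [[_ Ay] Ny]].
by exists (tparam c y).
Qed.

Lemma tparam_chart_at (p : M) v : tparam (chart_at p) (coord (chart_at p) p, v) = (p, v).
Proof.
have dp := dom_chart_at p; rewrite /tparam /= coordK ?inE //; congr pair.
by apply: diff_transition_id; exists p.
Qed.

Lemma tcod_chart_at (p : M) v : tcod (chart_at p) (coord (chart_at p) p, v).
Proof. by exists p => //; exact: dom_chart_at. Qed.

End TangentCharts.

(** * Euler's theorem up to the boundary *)

Section Homogeneous.
Variables (R : realType) (n : nat).
Local Notation V := 'rV[R]_n.

Lemma nbhs_line (W : normedModType R) (x v : W) (N : set W) :
  nbhs x N -> \forall h \near (0 : R), N (h *: v + x).
Proof.
move=> Nx; have C : (fun h : R => h *: v + x) @ (0 : R) --> (0 : R) *: v + x.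
  by apply: cvgD; [apply: cvgZr_tmp; exact: cvg_id|exact: cvg_cst].
by move: C; rewrite scale0r add0r => /(_ N Nx).
Qed.

Lemma derive_quotient (W W' : normedModType R) (f : W -> W') (x v : W) (q : R -> W') l :
  (\forall h \near (0 : R), h != 0 -> h^-1 *: (f (h *: v + x) - f x) = q h) ->
  q @ (0 : R)^' --> l -> 'D_v f x = l.
Proof.
move=> E ql; apply/cvg_lim => //; apply: cvg_trans ql.
apply: near_eq_cvg.
have N0 : \forall h \near (0 : R)^', h != 0 by exact: nbhs_dnbhs_neq.
by apply: filterS2 (nbhs_dnbhs E) N0 => h Eh h0; exact/esym/Eh.
Qed.

Lemma derive_gt0_near (W : normedModType R) (f : W -> R) (x w : W) :
  differentiable f x -> 0 < 'D_w f x ->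
  \forall t \near (0 : R), 0 < t -> f x < f (t *: w + x).
Proof.
move=> df D0; have cq : derivable f x w by exact: diff_derivable.
pose q (t : R) : R := t^-1 *: ((f \o shift x) (t *: w) - f x).
have : \forall t \near (0 : R)^', 0 < q t by apply: (cvgr_gt ('D_w f x)).
rewrite near_withinE; apply: filterS => t Ht t0.
have := Ht (lt0r_neq0 t0); rewrite /= pmulr_rgt0 ?invr_gt0 // subr_gt0.
exact.
Qed.

Lemma derive_scale (f : V -> R) (x v : V) (t : R) : differentiable f (t *: x) ->
  'D_v (fun y => f (t *: y)) x = t * 'D_v f (t *: x).
Proof.
move=> df.
have ds : differentiable ( *:%R t : V -> V) x by exact: ex_diff.
rewrite (deriveE v (differentiable_comp ds df)) (diff_comp ds df) /=.
by rewrite (deriveE v df) diff_val linearZ.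
Qed.

Variables (D U : set V) (g f : V -> R).
Hypothesis (oD : open D).
Hypotheses (oU : open U) (cf : Cn 2 U f).
Hypothesis (fg : forall x, D x -> U x -> f x = g x).
Hypothesis (hg : forall x (t : R), 0 < t -> D x -> g (t *: x) = t ^+ 2 * g x).

Let O := D `&` U.

Let oO : open O. Proof. exact: openI. Qed.

Let fO : {in O, f =1 g}. Proof. by move=> x /set_mem[Dx Ux]; exact: fg. Qed.

Let cg : Cn 2 O g.
Proof. by apply: Cn_eq oO fO _; apply: Cn_sub cf => x []. Qed.

Let dg x : O x -> differentiable g x. Proof. exact: cg.1. Qed.

Let O_line x v : O x -> \forall h \near (0 : R), O (h *: v + x).
Proof. by move=> Ox; apply: nbhs_line; exact: open_nbhs_nbhs. Qed.

Let near_gtN1 : \forall h \near (0 : R), 0 < h + 1.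
Proof.
have : \forall h \near (0 : R), `|h| < 1 by exact: nbhs0_lt.
by apply: filterS => h; rewrite ltr_norml => /andP[? _]; rewrite -ltrBlDr sub0r.
Qed.

Lemma Euler1 x : O x -> 'D_x g x = 2 * g x.
Proof.
move=> [Dx Ux]; apply: (@derive_quotient _ _ _ _ _ (fun h => (2 + h) * g x)).
  apply: filterS near_gtN1 => h h1 h0.
  rewrite -{2}(scale1r x) -scalerDl hg // -{2}(mul1r (g x)) -mulrBl.
  by rewrite /GRing.scale /=; field.
apply: (cvg_trans (cvg_app _ (@nbhs_dnbhs _ _))).
have cq : (fun h : R => (2 + h) * g x) @ (0 : R) --> (2 + 0) * g x.
  by apply: cvgM; [apply: cvgD; [exact: cvg_cst|exact: cvg_id]|exact: cvg_cst].
by rewrite addr0 in cq.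
Qed.

Lemma derive_homogeneous x w t : 0 < t -> D x -> O (t *: x) ->
  differentiable g x -> 'D_w g (t *: x) = t * 'D_w g x.
Proof.
move=> t0 Dx Otx dgx.
have E : \near x, (t ^+ 2 *: g) x = g (t *: x).
  have : nbhs x D by exact: open_nbhs_nbhs.
  by apply: filterS => y Dy; rewrite hg.
have := near_eq_derive w E; rewrite derive_scale; last exact: dg.
rewrite deriveZ; last exact: diff_derivable.
move=> H; apply: (mulfI (lt0r_neq0 t0)); rewrite -H mulrA -expr2.
by [].
Qed.

(** ['D_w g] is positively homogeneous of degree 1, hence equal to its own radial derivative. *)
Lemma Euler2l x w : O x -> 'D_x ('D_w g) x = 'D_w g x.
Proof.
move=> Ox; apply: (@derive_quotient _ _ _ _ _ (fun h => 'D_w g x)); last exact: cvg_cst.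
apply: filterS2 near_gtN1 (O_line x Ox) => h h1 Oh h0.
have E : h *: x + x = (h + 1) *: x by rewrite scalerDl scale1r.
rewrite E in Oh *; rewrite derive_homogeneous //; last exact: dg.
  by rewrite mulrDl mul1r addrK /GRing.scale /= mulrA mulVf // mul1r.
by case: Ox.
Qed.

Lemma deriveDv v w x a : differentiable g x ->
  'D_(a *: v + w) g x = a * 'D_v g x + 'D_w g x.
Proof. by move=> dgx; rewrite !(deriveE _ dgx) linearP. Qed.

(** Obtained without exchanging the derivatives: Euler's identity at [x + h w], with the direction
    split as [x] plus [h w], gives ['D_x g (x + h w) = 2 g (x + h w) - h 'D_w g (x + h w)], whose
    difference quotient tends to [2 'D_w g x - 'D_w g x]. *)
Lemma Euler2r x w : O x -> 'D_w ('D_x g) x = 'D_w g x.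
Proof.
move=> Ox.
have dgx := dg Ox.
apply: (@derive_quotient _ _ _ _ _
  (fun h => 2 * (h^-1 *: (g (h *: w + x) - g x)) - 'D_w g (h *: w + x))).
  apply: filterS (O_line w Ox) => h Oh h0.
  have E1 := Euler1 Oh; rewrite (deriveDv _ _ _ (dg Oh)) in E1.
  have -> : 'D_x g (h *: w + x) = 2 * g (h *: w + x) - h * 'D_w g (h *: w + x).
    by rewrite -E1 addrAC subrr add0r.
  by rewrite Euler1 // /GRing.scale /=; field.
have -> : 'D_w g x = 2 * 'D_w g x - 'D_w g x by ring.
apply: cvgB.
  apply: cvgM; first exact: cvg_cst.
  have cd : derivable g x w by exact: diff_derivable.
  exact: cd.
apply: (cvg_trans (cvg_app _ (@nbhs_dnbhs _ _))).
have cw : {for x, continuous ('D_w g)} by exact: Cn_continuous (Cn_derive w cg) Ox.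
move=> N /cw Nx; exact: (@nbhs_line V x w _ Nx).
Qed.

Lemma derive2_linr u u' w a x : U x ->
  'D_w ('D_(a *: u + u') f) x = a * 'D_w ('D_u f) x + 'D_w ('D_u' f) x.
Proof.
move=> Ux.
have df y : U y -> differentiable f y by exact: Cn_diff cf.
have du v : derivable ('D_v f) x w.
  by apply: diff_derivable; exact: Cn_diff (Cn_derive v cf) Ux.
have E : \near x, 'D_(a *: u + u') f x = (a *: 'D_u f + 'D_u' f) x.
  have : nbhs x U by exact: open_nbhs_nbhs.
  apply: filterS => y Uy; transitivity (a *: 'D_u f y + 'D_u' f y) => //.
  by rewrite !(deriveE _ (df _ Uy)) linearP.
by rewrite (near_eq_derive _ E) deriveD ?deriveZ //; exact: derivableZ.
Qed.

Lemma derive2_linl u u' w a x : U x ->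
  'D_(a *: u + u') ('D_w f) x = a * 'D_u ('D_w f) x + 'D_u' ('D_w f) x.
Proof. by move=> Ux; have d := Cn_diff (Cn_derive w cf) Ux; rewrite !(deriveE _ d) linearP. Qed.

(** In a passage to the limit in [x] the inner direction moves too; this form is a finite sum of
    products of functions continuous in [x]. *)
Lemma derive2_suml x w : U x ->
  'D_w ('D_x f) x = \sum_i x 0 i * 'D_w ('D_('e_i) f) x.
Proof.
move=> Ux; rewrite {1}(row_sum_delta x).
elim/big_ind2 : _ => [|a v b v' Ea Eb|i _].
- have := derive2_linr 0 0 w 1 Ux; rewrite scale1r addr0 mul1r => /eqP.
  by rewrite -subr_eq subrr => /eqP <-.
- by have := derive2_linr v v' w 1 Ux; rewrite scale1r mul1r Ea Eb.
have := derive2_linr 0 0 w 1 Ux; rewrite scale1r addr0 mul1r => /eqP.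
rewrite -subr_eq subrr => /eqP E0.
by have := derive2_linr 'e_i 0 w (x 0 i) Ux; rewrite addr0 -E0 addr0.
Qed.

Let Df_eq w x : O x -> 'D_w f x = 'D_w g x.
Proof. by move=> Ox; exact: (derivef_near _ oO fO (mem_set Ox)). Qed.

Let DDf_eq u w x : O x -> 'D_u ('D_w f) x = 'D_u ('D_w g) x.
Proof.
move=> Ox; apply: (derivef_near _ oO _ (mem_set Ox)) => y /set_mem Oy.
exact: Df_eq.
Qed.

Variable (v : V).
Hypotheses (Uv : U v) (Dv : closure D v).

Let Ov : closure O v.
Proof.
move=> N Nv; have [y [Dy [Uy Ny]]] := Dv (filterI (open_nbhs_nbhs (conj oU Uv)) Nv).
by exists y.
Qed.

Let diag_continuous W (h : V * V -> W :> normedModType R) :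
  {for (v, v), continuous h} -> {for v, continuous (fun x => h (x, x))}.
Proof.
move=> ch; apply: (@continuous_comp _ _ _ (fun x : V => (x, x)) h _ _ ch).
have ci : (fun x : V => x) @ v --> v by exact: cvg_id.
exact: (cvg_pair ci ci).
Qed.

Lemma Euler1_closure : 'D_v f v = 2 * f v.
Proof.
apply: (@eq_closure R V _ O (fun x => 'D_x f x) (fun x => 2 * f x)) => //.
- by move=> x /[dup] Ox [Dx Ux]; rewrite Df_eq // Euler1 // fg.
- apply: (@diag_continuous _ (fun y => 'D_(y.2) f y.1)).
  exact: (@derive_pair_continuous R _ _ f U (v, v) oU (Cn_pred cf) Uv).
- have c2 : (fun _ : V => 2 : R) @ v --> (2 : R) by exact: (@cst_continuous _ _ (2 : R)).
  exact: (cvgM c2 (Cn_continuous cf Uv)).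
Qed.

Lemma Euler2l_closure w : 'D_v ('D_w f) v = 'D_w f v.
Proof.
apply: (@eq_closure R V _ O (fun x => 'D_x ('D_w f) x) ('D_w f)) => //.
- by move=> x Ox; rewrite DDf_eq // Df_eq // Euler2l.
- apply: (@diag_continuous _ (fun y => 'D_(y.2) ('D_w f) y.1)).
  exact: (@derive_pair_continuous R _ _ ('D_w f) U (v, v) oU (Cn_derive w cf) Uv).
- exact: (Cn_continuous (Cn_derive w cf) Uv).
Qed.

Lemma Euler2r_closure w : 'D_w ('D_v f) v = 'D_w f v.
Proof.
rewrite derive2_suml //.
apply: (@eq_closure R V _ O (fun x => \sum_i x 0 i * 'D_w ('D_('e_i) f) x) ('D_w f)) => //.
- by move=> x /[dup] Ox [_ Ux]; rewrite -derive2_suml // DDf_eq // Df_eq // Euler2r.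
- apply: (@continuous_sum R V R n
    (fun i (x : V) => x 0 i * 'D_w ('D_('e_i) f) x)) => i.
  have c0 : (fun x : V => x 0 i : R) @ v --> (v 0 i : R) by exact: coord_continuous.
  exact: (cvgM c0 (Cn_continuous (Cn_derive w (Cn_derive 'e_i cf)) Uv)).
- exact: (Cn_continuous (Cn_derive w cf) Uv).
Qed.

(** Identifies the limit in [metric_tensor] with half the second derivative of an arbitrary C^2
    extension, so that the choice of extension is immaterial. *)
Lemma lim_fundamental_tensor u w :
  lim ((fun x => fundamental_tensor g x u w) @ within D (nbhs v)) =
  'D_u ('D_w f) v / 2.
Proof.
apply/cvg_lim => // N.
have c2 : {for v, continuous (fun x => 'D_u ('D_w f) x / 2)}.
  have c2 : (fun _ : V => 2^-1 : R) @ v --> (2^-1 : R) by exact: (@cst_continuous _ _ (2^-1 : R)).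
  exact: (cvgM (Cn_continuous (Cn_derive u (Cn_derive w cf)) Uv) c2).
move=> /c2 Nx.
have {}Nx : nbhs v ((fun x => 'D_u ('D_w f) x / 2) @^-1` N) := Nx.
change (nbhs v (fun y => D y -> N (fundamental_tensor g y u w))).
have NU : nbhs v U by exact: open_nbhs_nbhs.
by apply: filterS2 Nx NU => y Ny Uy Dy; rewrite /fundamental_tensor -DDf_eq.
Qed.

End Homogeneous.

(** * Extensions of the metric in a fibre *)

Section LinearChart.
Variables (R : realType) (n : nat) (k : option nat) (M : manifold R n (omap S k)).
Local Notation E := ('rV[R]_n * 'rV[R]_n)%type.
Variable c : chart M.

(* The chart [c] induces on T_pM the coordinates [vchartV], whereas elements of
   the type [tangent M] use those of [chart_at p]. *)
Definition vchart x : {linear 'rV[R]_n -> 'rV[R]_n} :=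
  'd (transition c (chart_at (param c x))) x.

Definition vchartV x : {linear 'rV[R]_n -> 'rV[R]_n} :=
  'd (transition (chart_at (param c x)) c) (transition c (chart_at (param c x)) x).

Lemma tparamE z : tparam c z = (param c z.1, vchart z.1 z.2).
Proof. by []. Qed.

Variable x : 'rV[R]_n.
Hypothesis (cx : (coord c @` dom c) x).

Lemma vchartK : cancel (vchart x) (vchartV x).
Proof. by move=> v; exact: (diff_transitionK v (transition_dom_chart_at cx)). Qed.

Let a := chart_at (param c x).

Let dom_ac : transition_dom a c (transition c a x).
Proof.
have [px Ex] := coord_paramK cx.
by exists (param c x); [split => //; exact: dom_chart_at|].
Qed.

Let trans_ac : transition a c (transition c a x) = x.
Proof.
have [px Ex] := coord_paramK cx.
rewrite /transition /= [param a _](_ : _ = param c x) //.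
by rewrite coordK ?inE //; exact: dom_chart_at.
Qed.

Lemma vchartVK : cancel (vchartV x) (vchart x).
Proof. by move=> v; have := diff_transitionK v dom_ac; rewrite trans_ac; exact. Qed.

Lemma vchartV_continuous : continuous (vchartV x).
Proof. exact/diff_continuous/transition_differentiable/dom_ac. Qed.

End LinearChart.

(** * Fibres of a cone domain and their closures *)

Section Fibers.
Variables (R : realType) (n : nat) (k : option nat) (M : manifold R n (omap S k)).
Local Notation E := ('rV[R]_n * 'rV[R]_n)%type.
Variables (A : set (tangent M)).
Hypothesis (cA : cone_domain k A).
Implicit Types (c : chart M) (p : M) (z : E).

Lemma sub_tclosure q : A q -> tclosure A q.
Proof.
move=> Aq; split; first exact: subset_closure.
by move=> zq; have : (A `&` @zero_section R n _ M) q by []; rewrite (cone_neq0 cA).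
Qed.

Lemma tclosureE q : tclosure A q -> ~ cone_structure A q -> A q.
Proof. by move=> cq nq; apply: contrapT => nA; apply: nq. Qed.

Definition pair_right (x : 'rV[R]_n) : 'rV[R]_n -> E := fun v => (x, v).

Lemma pair_right_continuous x : continuous (pair_right x).
Proof.
move=> v; have c1 : (fun _ : 'rV[R]_n => x) @ v --> x by exact: cst_continuous.
have c2 : (fun y : 'rV[R]_n => y) @ v --> v by exact: cvg_id.
exact: (cvg_pair c1 c2).
Qed.

Lemma fiber_inclusion_continuous p : continuous ((fun v => (p, v)) : 'rV[R]_n -> tangent M).
Proof.
move=> v; have -> : (fun v => (p, v) : tangent M) =
    tparam (chart_at p) \o pair_right (coord (chart_at p) p).
  by apply/funext => w; rewrite /= tparam_chart_at.
apply: continuous_comp; first exact: pair_right_continuous.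
exact/tparam_continuous/tcod_chart_at.
Qed.

Lemma fiber_open p : open (fiber A p).
Proof.
have -> : fiber A p = ((fun v => (p, v)) : 'rV[R]_n -> tangent M) @^-1` A by [].
by apply: open_comp (cone_open cA) => v _; exact: fiber_inclusion_continuous.
Qed.

Lemma closure_fiber p v : closure (fiber A p) v -> closure A (p, v).
Proof.
move=> cv N /fiber_inclusion_continuous /cv [w [Aw Nw]].
by exists (p, w).
Qed.

Lemma fiber_closure_tclosure p v : fiber_closure A p v -> tclosure A (p, v).
Proof. by move=> [/closure_fiber cv v0]; split => // -[]. Qed.

Lemma tclosure_conic p v (t : R) : 0 < t -> tclosure A (p, v) -> tclosure A (p, t *: v).
Proof.
move=> t0 [cv v0]; have tn0 := lt0r_neq0 t0; split; last first.
  by move=> /eqP; rewrite scaler_eq0 (negbTE tn0) => /eqP.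
have cz := tcod_chart_at p; move: cv.
rewrite -!tparam_chart_at => /(closure_tparam _ (cz v)) cv.
apply/(closure_tparam _ (cz (t *: v))) => N Nv.
pose s (y : E) : E := (y.1, t *: y.2).
have cs : {for (coord (chart_at p) p, v), continuous s}.
  have c1 : (fun y : E => y.1) @ (coord (chart_at p) p, v) --> coord (chart_at p) p.
    exact: cvg_fst.
  have c2 : {for (coord (chart_at p) p, v),
      continuous ((fun w : 'rV[R]_n => t *: w) \o (snd : E -> _))}.
    by apply: continuous_comp; [exact: cvg_snd|exact: scaler_continuous].
  exact: (cvg_pair c1 c2).
have [y [[ty Ay] Ny]] := cv _ (cs _ Nv).
exists (s y); split => //; split => //.
move: Ay; rewrite /= !tparamE /= linearZ => Ay.
exact: (cone_conic cA t0).
Qed.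

Lemma fiber_closure_conic p v (t : R) :
  0 < t -> fiber_closure A p v -> fiber_closure A p (t *: v).
Proof.
move=> t0 [cv v0]; have tn0 := lt0r_neq0 t0; split; last first.
  by move=> /eqP; rewrite scaler_eq0 (negbTE tn0) => /eqP.
have ct : {for v, continuous (fun w : 'rV[R]_n => t *: w)}.
  exact: scaler_continuous.
move=> N /ct Nv; have [y [Ay Ny]] := cv _ Nv.
by exists (t *: y); split => //; exact: (cone_conic cA t0).
Qed.

End Fibers.

(** * The metric tensor through local extensions *)

Section Metric.
Variables (R : realType) (n : nat) (k : option nat) (M : manifold R n (omap S k)).
Local Notation E := ('rV[R]_n * 'rV[R]_n)%type.
Variables (A : set (tangent M)) (L : tangent M -> R).
Hypotheses (hk : reg_ge2 k) (hL : Lorentz_Finsler k A L).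
Implicit Types (c : chart M) (p : M) (z : E).
Let cA := LF_domain hL.

(** The regularity of [F] is kept apart: C^2 suffices for the metric tensor, while the division by a
    defining function uses the full class. *)
Definition chart_extension c z (U : set E) (F : E -> R) : Prop :=
  [/\ open U, U z & forall y, U y -> tcod c y -> tclosure A (tparam c y) ->
    F y = L (tparam c y)].

Lemma LF_chart_extension c z : tcod c z -> tclosure A (tparam c z) ->
  exists U F, chart_extension c z U F /\ Ck k U F.
Proof.
by move=> cz Az; have [U [F [oU Uz cF FL]]] := LF_smooth hL cz Az; exists U, F.
Qed.

Lemma Ck2 (V : normedModType R) (U : set V) (F : V -> R) : Ck k U F -> Cn 2 U F.
Proof. by apply: Ck_Cn; move: hk; case: k. Qed.

Definition fiber_extension p v (U : set 'rV[R]_n) (f : 'rV[R]_n -> R) : Prop :=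
  [/\ open U, U v, Cn 2 U f &
    forall y, U y -> tclosure A (p, y) -> f y = L (p, y)].

(** An extension lives in the natural coordinates of [c], the metric tensor in those of
    [chart_at p]. Composition with the affine map [y |-> (z.1, vchartV c z.1 y)] passes from the
    former to the latter; the second clause translates derivatives along the fibre. *)
Lemma restrict_fiber_extension c z U F : tcod c z -> chart_extension c z U F ->
  Cn 2 U F ->
  exists U' f, fiber_extension (tparam c z).1 (tparam c z).2 U' f /\
    forall y w, U' y -> 'D_w f y = 'D_(0, vchartV c z.1 w) F (z.1, vchartV c z.1 y).
Proof.
move=> cz [oU Uz FL] cF; have S_cont := vchartV_continuous cz.
set S := vchartV c z.1 in S_cont *.
have lin0 : linear (fun y => (0, S y) : E).
  move=> a u w; apply: injective_projections; rewrite /= ?linearP //.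
  by rewrite scaler0 addr0.
pose l : {linear 'rV[R]_n -> E} :=
  HB.pack (fun y => (0, S y) : E) (GRing.isLinear.Build _ _ _ _ _ lin0).
have lc : continuous l.
  move=> y; have c1 : (fun _ : 'rV[R]_n => 0 : 'rV[R]_n) @ y --> (0 : 'rV[R]_n).
    exact: cst_continuous.
  exact: (cvg_pair c1 (S_cont y)).
pose h y : E := (z.1, 0) + l y.
have hE y : h y = (z.1, S y) by rewrite /h /l /=; congr pair; rewrite ?addr0 ?add0r.
pose U' := h @^-1` U.
have ch : continuous h.
  move=> y; exact: (@Cn_continuous _ _ _ 0 setT h y (Cn_affine 0 setT (z.1, 0) lc) I).
have oU' : open U' by apply: open_comp oU => y _; exact: ch.
have [e2 [l2 hl2]] := frame_pair (@frame_rowvec R n) (@frame_rowvec R n).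
exists U', (F \o h); split => [|y w U'y].
  split => //.
  - by rewrite /U' /= hE /S vchartK // -surjective_pairing.
  - by apply: (Cn_comp hl2 oU' _ _ cF) => //; exact: Cn_affine.
  - move=> y Uy Ay; rewrite /= hE.
    have E1 : tparam c (z.1, S y) = ((tparam c z).1, y) by rewrite tparamE /= vchartVK.
    rewrite -E1; apply: FL => //; last by rewrite E1.
    by rewrite -hE.
have dh : differentiable h y := Cn_diff (Cn_affine 1 setT (z.1, 0) lc) I.
have dF := Cn_diff cF U'y.
rewrite -hE (deriveE _ (differentiable_comp dh dF)) (deriveE _ dF).
have Eh : 'd h y w = (0, S w) by rewrite -(deriveE _ dh) derive_affine.
by rewrite (diff_comp dh dF) -Eh.
Qed.

Lemma LF_fiber_extension p v : tclosure A (p, v) ->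
  exists U f, fiber_extension p v U f.
Proof.
move=> Av; have cz := tcod_chart_at p v; have Ez := tparam_chart_at p v.
rewrite -Ez in Av; have [U [F [hU /Ck2 cF]]] := LF_chart_extension cz Av.
have [U' [f [+ _]]] := restrict_fiber_extension cz hU cF.
by rewrite Ez; exists U', f.
Qed.

Lemma L_ge0 q : tclosure A q -> 0 <= L q.
Proof.
move=> Aq; have [Cq|nC] := pselect (cone_structure A q).
  by rewrite (LF_eq0 hL).
by apply/ltW/(LF_gt0 hL)/(tclosureE Aq).
Qed.

Section AtClosurePoint.
Variables (p : M) (v : 'rV[R]_n) (U : set 'rV[R]_n) (f : 'rV[R]_n -> R).
Hypotheses (Av : closure (fiber A p) v) (fe : fiber_extension p v U f).

Let f_eq x : fiber A p x -> U x -> f x = L (p, x).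
Proof. by case: fe => _ _ _ fL Ax Ux; apply: fL => //; exact: sub_tclosure cA _ _. Qed.

Let homog x (t : R) : 0 < t -> fiber A p x -> L (p, t *: x) = t ^+ 2 * L (p, x).
Proof. exact: (LF_homogeneous hL). Qed.

Lemma metric_tensorE u w : metric_tensor A L (p, v) u w = 'D_u ('D_w f) v / 2.
Proof.
case: fe => oU Uv cf _; rewrite /metric_tensor /=.
exact: (@lim_fundamental_tensor R n (fiber A p) U (fun y => L (p, y)) f
  (@fiber_open _ _ _ _ _ cA p) oU cf f_eq v Uv Av).
Qed.

Lemma fiber_Euler1 : 'D_v f v = 2 * f v.
Proof.
case: fe => oU Uv cf _.
exact: (@Euler1_closure R n (fiber A p) U (fun y => L (p, y)) f
  (@fiber_open _ _ _ _ _ cA p) oU cf f_eq homog v Uv Av).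
Qed.

Lemma fiber_Euler2l w : 'D_v ('D_w f) v = 'D_w f v.
Proof.
case: fe => oU Uv cf _.
exact: (@Euler2l_closure R n (fiber A p) U (fun y => L (p, y)) f
  (@fiber_open _ _ _ _ _ cA p) oU cf f_eq homog v Uv Av).
Qed.

Lemma fiber_Euler2r w : 'D_w ('D_v f) v = 'D_w f v.
Proof.
case: fe => oU Uv cf _.
exact: (@Euler2r_closure R n (fiber A p) U (fun y => L (p, y)) f
  (@fiber_open _ _ _ _ _ cA p) oU cf f_eq homog v Uv Av).
Qed.

Lemma metric_tensor_radial w : metric_tensor A L (p, v) v w = 'D_w f v / 2.
Proof. by rewrite metric_tensorE fiber_Euler2l. Qed.

(** If the differential of [f] vanished at [v], then [g_v(v, w) = 0] for all [w], against
    non-degeneracy. *)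
Lemma fiber_regular : v != 0 -> exists w, 'D_w f v != 0.
Proof.
move=> v0; apply: contrapT => nw; move: v0; apply/negP; rewrite negbK; apply/eqP.
have [->//|vn0] := eqVneq v 0.
apply: (@LF_nondegenerate _ _ _ _ _ _ _ hL p v) => [|w].
  by split => //; exact/eqP.
rewrite metric_tensor_radial; have [->|nz] := eqVneq ('D_w f v) 0; first by rewrite mul0r.
by case: nw; exists w.
Qed.

End AtClosurePoint.

(* Transversality: the cone structure is not tangent to the fibre at a point of
   the closure of the fibre. *)
Lemma chart_extension_regular c z U F : tcod c z -> chart_extension c z U F ->
  Cn 2 U F -> fiber_closure A (tparam c z).1 (tparam c z).2 ->
  exists w, 'D_(0, w) F z != 0.
Proof.
move=> cz hF cF [Av v0]; have [U' [f [fe Df]]] := restrict_fiber_extension cz hF cF.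
have [|w] := fiber_regular Av fe; first exact/eqP.
case: (fe) => oU' U'v _ _; rewrite Df // => Dw.
exists (vchartV c z.1 w); move: Dw.
by rewrite [X in (_, vchartV _ _ X)](_ : _ = vchart c z.1 z.2) // vchartK // -surjective_pairing.
Qed.

End Metric.

(** * Boundaries straightened by a chart *)

Section Straightening.
Variables (R : realType) (V : normedModType R) (m : nat) (S dS : set V).
Variables (U : set V) (Phi : V -> 'rV[R]_m) (Psi : 'rV[R]_m -> V) (i : 'I_m).

(** A single straightening chart, detached from the point around which it was chosen, because it is
    also applied at neighbouring points. *)
Definition straightening k : Prop :=
  [/\ open U, open (Phi @` U) /\ {in U, cancel Phi Psi},
      Ck k U Phi /\ Ck k (Phi @` U) Psi
    & forall x, U x -> (S x <-> 0 <= Phi x 0 i) /\ (dS x <-> Phi x 0 i = 0)].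

Variables (k : option nat) (z : V).
Hypotheses (hk : reg_ge2 k) (hs : straightening k) (Uz : U z).

Let oU : open U. Proof. by case: hs. Qed.
Let oPU : open (Phi @` U). Proof. by case: hs => _ []. Qed.
Let PhiK : {in U, cancel Phi Psi}. Proof. by case: hs => _ []. Qed.
Let cPhi : Cn 1 U Phi.
Proof. by case: hs => _ _ [+ _] _; apply: Ck_Cn; case: (k) hk => [[|j]|]. Qed.
Let cPsi : Cn 1 (Phi @` U) Psi.
Proof. by case: hs => _ _ [_ +] _; apply: Ck_Cn; case: (k) hk => [[|j]|]. Qed.

Let dPhi : differentiable Phi z. Proof. exact: Cn_diff cPhi Uz. Qed.
Let PUz : (Phi @` U) (Phi z). Proof. by exists z. Qed.
Let dPsi : differentiable Psi (Phi z). Proof. exact: Cn_diff cPsi PUz. Qed.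

Lemma PsiP y : (Phi @` U) y -> U (Psi y) /\ Phi (Psi y) = y.
Proof. by case=> x Ux <-; rewrite PhiK ?inE. Qed.

Let dPsiK u : 'd Psi (Phi z) ('d Phi z u) = u.
Proof.
have E : 'd (Psi \o Phi) z u = 'd Psi (Phi z) ('d Phi z u).
  by have := diff_comp dPhi dPsi; move/(congr1 (fun h : _ -> _ => h u)).
rewrite -E -(deriveE u (differentiable_comp dPhi dPsi)).
have Eid : \near z, (Psi \o Phi) z = id z.
  have : nbhs z U by exact: open_nbhs_nbhs.
  by apply: filterS => y Uy; rewrite /= PhiK ?inE.
by rewrite (near_eq_derive _ Eid) derive_id.
Qed.

Let dPhiK u : 'd Phi z ('d Psi (Phi z) u) = u.
Proof.
have Ez : Psi (Phi z) = z by rewrite PhiK ?inE.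
have dPhi' : differentiable Phi (Psi (Phi z)) by rewrite Ez.
have E : 'd (Phi \o Psi) (Phi z) u = 'd Phi z ('d Psi (Phi z) u).
  have := diff_comp dPsi dPhi'; move/(congr1 (fun h : _ -> _ => h u)).
  by rewrite /= Ez.
rewrite -E -(deriveE u (differentiable_comp dPsi dPhi')).
have Eid : {near Phi z, Phi \o Psi =1 id}.
  have : nbhs (Phi z) (Phi @` U) by exact: open_nbhs_nbhs.
  by apply: filterS => y /PsiP[_].
by rewrite (near_eq_derive _ Eid) derive_id.
Qed.

Definition defining x : R := Phi x 0 i.

Lemma defining_Cn1 : Cn 1 U defining.
Proof.
exact: (Cn_lin oU (@entry_continuous R m i) cPhi).
Qed.

Lemma derive_defining u : 'D_u defining z = 'd Phi z u 0 i.
Proof.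
pose l := @entry R m i; have cl : continuous l by exact: entry_continuous.
have dl : differentiable l (Phi z) by exact: linear_differentiable.
rewrite -[defining]/(l \o Phi) (deriveE u (differentiable_comp dPhi dl)).
by rewrite (diff_comp dPhi dl) /= (diff_lin _ cl).
Qed.

(** The vector at [z] that [Phi] sends to the i-th coordinate vector: transverse to the boundary and
    normalised by the defining function. It depends on the chart, and no scalar product is
    involved. *)
Definition inner_normal : V := 'D_('e_i) Psi (Phi z).

Lemma derive_inner_normal : 'D_inner_normal defining z = 1.
Proof. by rewrite derive_defining /inner_normal (deriveE _ dPsi) dPhiK mxE !eqxx. Qed.

(** The differential of a function that vanishes on the boundary kills the tangent vectors of the
    boundary, hence is a multiple of the differential of the defining function; the derivative along
    the inner normal gives the multiple. *)
Lemma boundary_derive (f : V -> R) (N : set V) u :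
  dS z -> differentiable f z -> nbhs z N -> (forall x, N x -> dS x -> f x = 0) ->
  'D_u f z = 'D_inner_normal f z * 'D_u defining z.
Proof.
move=> dz df Nz f0; have [_ _ _ hS] := hs.
have Pz : defining z = 0 by apply/(hS _ Uz).2.
have Ez : Psi (Phi z) = z by rewrite PhiK ?inE.
have df' : differentiable f (Psi (Phi z)) by rewrite Ez.
have dg := differentiable_comp dPsi df'.
have E v : 'd f z ('d Psi (Phi z) v) = 'd (f \o Psi) (Phi z) v.
  have := diff_comp dPsi df'; move/(congr1 (fun h : _ -> _ => h v)).
  by rewrite /= Ez.
rewrite derive_defining /inner_normal (deriveE _ dPsi) !(deriveE _ df) E.
rewrite -{1}(dPsiK u) E; set a := 'd Phi z u.
pose a' := a - a 0 i *: 'e_i.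
have Ea : a = a 0 i *: 'e_i + a' by rewrite addrC subrK.
have a'i : a' 0 i = 0 by rewrite !mxE !eqxx mulr1 subrr.
(* Moving along [a'] leaves the i-th coordinate equal to 0, so the line stays in the boundary, where
   [f] vanishes. *)
have Za : 'd (f \o Psi) (Phi z) a' = 0.
  apply: etrans (esym (deriveE _ dg)) _.
  apply: (@derive_quotient _ _ _ _ _ _ (fun h => 0)); last exact: cvg_cst.
  have N1 := @nbhs_line R _ (Phi z) a' _ (open_nbhs_nbhs (conj oPU PUz)).
  have cPz : nbhs (Phi z) (Psi @^-1` N).
    by apply: (differentiable_continuous dPsi); rewrite Ez.
  have N2 := @nbhs_line R _ (Phi z) a' _ cPz.
  apply: filterS2 N1 N2 => h /PsiP[U1 P1] Nh h0.
  have dPz : dS (Psi (h *: a' + Phi z)).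
    by apply/(hS _ U1).2; rewrite P1 mxE mxE a'i mulr0 add0r.
  by rewrite /= f0 // Ez f0 ?subrr ?scaler0 //; exact: nbhs_singleton.
transitivity (a 0 i *: 'd (f \o Psi) (Phi z) 'e_i + 'd (f \o Psi) (Phi z) a').
  by rewrite -linearP -Ea.
apply: etrans (congr1 (fun t => _ + t) Za) _.
by rewrite addr0 mulrC.
Qed.

Lemma inward_near w : dS z -> 0 < 'D_w defining z ->
  \forall t \near (0 : R), 0 < t -> (S `\` dS) (t *: w + z).
Proof.
have [_ _ _ hS] := hs.
move=> dz Dw; have dd : differentiable defining z by exact: Cn_diff defining_Cn1 Uz.
have N1 := derive_gt0_near dd Dw.
have N2 := @nbhs_line R _ z w _ (open_nbhs_nbhs (conj oU Uz)).
apply: filterS2 N1 N2 => t P1 Ut t0; have := P1 t0.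
have -> : defining z = 0 by apply/(hS _ Uz).2.
move=> D0; split; first by apply/(hS _ Ut).1; exact: ltW.
by move=> /(hS _ Ut).2 E; move: D0; rewrite /defining E ltxx.
Qed.

Lemma outward_near w : dS z -> 'D_w defining z < 0 ->
  \forall t \near (0 : R), 0 < t -> ~ S (t *: w + z).
Proof.
have [_ _ _ hS] := hs.
move=> dz Dw; have dd : differentiable defining z by exact: Cn_diff defining_Cn1 Uz.
have N1 : \forall t \near (0 : R), 0 < t -> (- defining) z < (- defining) (t *: w + z).
  apply: derive_gt0_near; first exact: differentiableN.
  by rewrite deriveN ?oppr_gt0 //; exact: diff_derivable.
have N2 := @nbhs_line R _ z w _ (open_nbhs_nbhs (conj oU Uz)).
apply: filterS2 N1 N2 => t P1 Ut t0; have := P1 t0.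
rewrite !fctE (_ : defining z = 0); last by apply/(hS _ Uz).2.
by rewrite oppr0 oppr_gt0 => D0 /(hS _ Ut).1; rewrite leNgt [Phi _ _ _ < _]D0.
Qed.

End Straightening.

(** * The closure of a cone domain fibrewise *)

Section Sphere.
Variables (R : realType) (n : nat).
Local Notation V := 'rV[R]_n.

(** The norm of row vectors is the sup norm; the sphere serves only as a compact set of
    representatives of the rays. *)
Definition sphere : set V := [set v | `|v| = 1].

Definition normalize (v : V) : V := `|v|^-1 *: v.

Lemma sphere_closed : closed sphere.
Proof.
have -> : sphere = (fun v : V => `|v|) @^-1` [set 1] by [].
by apply: preimage_closed => [v _|]; [exact: norm_continuous|exact: closed_eq].
Qed.

Lemma sphere_compact : compact sphere.
Proof.
apply: bounded_closed_compact; last exact: sphere_closed.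
exists 1; split; first exact: num_real.
by move=> M M1 v /= ->; exact: ltW.
Qed.

Lemma normalize_sphere v : v != 0 -> sphere (normalize v).
Proof.
move=> v0; rewrite /sphere /= normrZ normfV normr_id mulVf //.
by rewrite normr_eq0.
Qed.

Lemma normalize_continuous v : v != 0 -> {for v, continuous normalize}.
Proof.
move=> v0; have c1 : (fun w : V => `|w|^-1) @ v --> `|v|^-1.
  have nv : `|v| != 0 by rewrite normr_eq0.
  have cn : (fun w : V => `|w|) @ v --> `|v| by exact: norm_continuous.
  exact: (cvgV nv cn).
have c2 : (fun w : V => w) @ v --> v by exact: cvg_id.
exact: (cvgZ c1 c2).
Qed.

Lemma open_normalize (O : set V) : open O ->
  open [set v | v != 0 /\ O (normalize v)].
Proof.
move=> oO; rewrite openE => v [v0 Ov].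
have N1 : nbhs v (normalize @^-1` O).
  by apply: normalize_continuous => //; exact: open_nbhs_nbhs.
have N2 : nbhs v [set w : V | w != 0].
  apply: open_nbhs_nbhs; split => //; have -> : [set w : V | w != 0] = ~` [set 0].
    by apply/seteqP; split => w /= => [/eqP|?]//; exact/eqP.
  by apply: closed_openC;
    exact: accessible_closed_set1 (hausdorff_accessible (@norm_hausdorff _ V)) _.
by apply: filterS2 N1 N2 => w.
Qed.

End Sphere.

Section FiberClosure.
Variables (R : realType) (n : nat) (k : option nat) (M : manifold R n (omap S k)).
Local Notation E := ('rV[R]_n * 'rV[R]_n)%type.
Variables (A : set (tangent M)) (L : tangent M -> R).
Hypotheses (hk : reg_ge2 k) (hL : Lorentz_Finsler k A L).
Implicit Types (c : chart M) (p : M) (z : E).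
Let cA := LF_domain hL.

Lemma cone_straightening c z : tcod c z -> tclosure A (tparam c z) ->
  exists U Phi Psi i,
  @straightening R E (n + n) (tcod c `&` tparam c @^-1` tclosure A)
    (tcod c `&` tparam c @^-1` cone_structure A) U Phi Psi i k /\ U z.
Proof.
move=> cz Az; have [U [Phi [Psi [i [[oU Uz] ? ? ?]]]]] :=
  cone_boundary cA (conj cz Az : (tcod c `&` tparam c @^-1` tclosure A) z).
by exists U, Phi, Psi, i.
Qed.

Lemma nbhs_pair_right (x v : 'rV[R]_n) (N : set E) :
  nbhs (x, v) N -> \forall b \near v, N (x, b).
Proof. by move=> /(@pair_right_continuous R n x v). Qed.

(** At a boundary vector some direction [w] of the fibre points into the cone domain, by
    transversality. By continuity [w] still does so at the boundary vectors [b] near [v], which are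
    therefore limits of the vectors [b + t w] of the fibre. *)
Lemma near_fiber_closure p v : fiber_closure A p v ->
  \forall b \near v, tclosure A (p, b) -> fiber_closure A p b.
Proof.
move=> Kv; have [Av|nAv] := pselect (fiber A p v).
  have : nbhs v (fiber A p).
    by apply: open_nbhs_nbhs; split => //; exact: fiber_open cA _.
  apply: filterS => b Ab [_ b0]; split; first exact: subset_closure.
  by move=> E0; apply: b0.
have cz := tcod_chart_at p; have Ez := tparam_chart_at p.
set c := chart_at p in cz Ez; set x := coord c p in cz Ez.
have Tv : tclosure A (tparam c (x, v)) by rewrite Ez; exact: fiber_closure_tclosure Kv.
have [U [Phi [Psi [i [hs Uz]]]]] := cone_straightening (cz v) Tv.
have [UF [F [hF /(Ck2 hk) cF]]] := LF_chart_extension hL (cz v) Tv.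
have dSz : (tcod c `&` tparam c @^-1` cone_structure A) (x, v).
  by split; [exact: cz|rewrite /= Ez; split => //; rewrite -Ez].
(* [F] and the defining function have proportional differentials at a boundary point, so a non-zero
   derivative of [F] makes that of the defining function non-zero; its sign is corrected by
   replacing [w] with [- w]. *)
have [w Dw] : exists w, 0 < 'D_(0, w) (defining Phi i) (x, v).
  have [w Dw] : exists w, 'D_(0, w) F (x, v) != 0.
    have := chart_extension_regular hL (cz v) hF cF; rewrite Ez; exact.
  have {}Dw : 'D_(0, w) (defining Phi i) (x, v) != 0.
    case: (hF) => oUF UFz FL.
    have := boundary_derive hk hs Uz (0, w) dSz (Cn_diff cF UFz)
      (open_nbhs_nbhs (conj oUF UFz)).
    move=> H; apply: contra_neq Dw => D0; rewrite H ?D0 ?mulr0 //.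
    move=> y Uy [cy Cy]; rewrite FL //; first exact: LF_eq0 hL _ Cy.
    by case: Cy.
  have dd := Cn_diff (defining_Cn1 hk hs) Uz.
  have [D0|D0|D0] := ltgtP 0 ('D_(0, w) (defining Phi i) (x, v)).
  - by exists w.
  - exists (- w); rewrite (_ : (0, - w) = - (0, w)); last first.
      by apply: injective_projections; rewrite /= ?oppr0.
    by rewrite (deriveE _ dd) linearN -(deriveE _ dd) oppr_gt0.
  - by rewrite -D0 eqxx in Dw.
have cD : {for (x, v), continuous ('D_(0, w) (defining Phi i))}.
  exact: Cn_continuous (Cn_derive (0, w) (defining_Cn1 hk hs)) Uz.
have N1 : \forall y \near (x, v), 0 < 'D_(0, w) (defining Phi i) y.
  exact: continuous_gt_near cD Dw.
have N2 : nbhs (x, v) U by apply: open_nbhs_nbhs; split => //; case: hs.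
apply: filterS2 (nbhs_pair_right N1) (nbhs_pair_right N2) => b Db Ub Tb.
split; last by case: Tb => _ b0 E0; apply: b0.
have [Ab|nAb] := pselect (A (p, b)); first exact: subset_closure.
have dSb : (tcod c `&` tparam c @^-1` cone_structure A) (x, b).
  by split; [exact: cz|rewrite /= Ez].
move=> N Nb; have N3 := @nbhs_line R _ b w _ Nb.
have N4 := inward_near hk hs Ub dSb Db.
have [t [t0 [Nt At]]] : exists t : R, 0 < t /\ (N (t *: w + b) /\ A (p, t *: w + b)).
  near (0 : R)^'+ => t; exists t.
  have t0 : 0 < t by [].
  split => //; split; first by near: t; apply: cvg_within; exact: N3.
  have [] : ((tcod c `&` tparam c @^-1` tclosure A) `\`
      (tcod c `&` tparam c @^-1` cone_structure A)) (t *: (0, w) + (x, b)).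
    have : 0 < t by []. near: t; apply: cvg_within; exact: N4.
  have -> : t *: (0, w) + (x, b) = (x, t *: w + b).
    by apply: injective_projections; rewrite /= ?scaler0 ?add0r.
  move=> [_ /= Tt] nC; rewrite -Ez; apply: tclosureE Tt _ => C.
  by apply: nC; split => //; exact: cz.
by exists (t *: w + b).
Unshelve. all: by end_near. Qed.

Lemma chart_fiber_connected c x : (coord c @` dom c) x ->
  connected [set v | A (tparam c (x, v))].
Proof.
move=> cx; rewrite (_ : [set v | _] = vchartV c x @` fiber A (param c x)).
  apply: connected_continuous_connected; first exact: (cone_connected cA).
  exact/continuous_subspaceT/vchartV_continuous.
apply/seteqP; split => v /=.
  by rewrite tparamE /= => Av; exists (vchart c x v) => //; rewrite vchartK.
by move=> [w Aw <-]; rewrite tparamE /= vchartVK.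
Qed.

Lemma normalize_fiber p v : fiber A p v -> fiber A p (normalize v).
Proof.
move=> Av; apply: (cone_conic cA) => //; rewrite invr_gt0 normr_gt0.
apply/eqP => v0; have : (A `&` @zero_section R n _ M) (p, v) by [].
by rewrite (cone_neq0 cA).
Qed.

(* Otherwise the cone of the limiting vectors that do not come from the fibre at
   [p] is closed and at positive distance from the cone of [fiber A p]; then the
   fibres at points close to [p], which accumulate on both, are disconnected. *)
Lemma tclosure_fiber p v : tclosure A (p, v) -> fiber_closure A p v.
Proof.
move=> Tv; apply: contrapT => nKv; have v0 : v != 0 by case: Tv => _ /eqP.
pose K := @sphere R n `&` fiber_closure A p.
pose B := @sphere R n `&` [set b | tclosure A (p, b) /\ ~ fiber_closure A p b].
have sphere0 b : @sphere R n b -> b <> 0.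
  by rewrite /sphere /= => b1 b0; move: b1; rewrite b0 normr0 => /eqP; rewrite eq_sym oner_eq0.
have clK : closed K.
  rewrite (_ : K = @sphere R n `&` closure (fiber A p)).
    by apply: closedI; [exact: sphere_closed|exact: closed_closure].
  apply/seteqP; split => [b [Sb []]|b [Sb cb]]//; split => //; split => //.
  exact: sphere0.
(* A limit of vectors of [B] that lay in the closure of the fibre would, by [near_fiber_closure],
   have no vectors of [B] near it. *)
have clB : closed B.
  move=> b clb; have Sb : @sphere R n b.
    by apply: (@sphere_closed R n); apply: closureS clb => y [].
  have Tb : tclosure A (p, b).
    split; last exact: sphere0.
    apply: (@closed_closure (tangent M) A (p, b)).
    move=> N /fiber_inclusion_continuous /clb [y [[_ [[cy _] _]] Ny]].
    by exists (p, y).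
  split => //; split => // Kb.
  have [y [[_ [Ty nKy]] /(_ Ty) Ky]] := clb _ (near_fiber_closure Kb).
  exact: nKy.
have KB0 : K `&` B = set0.
  by apply/seteqP; split => // b [[_ Kb] [_ [_ nKb]]].
have [G1 [G2 [oG1 oG2 KG1 BG2 G12]]] :=
  (@normal_openP R _).1 (@pseudometric_normal R 'rV[R]_n) _ _ clK clB KB0.
pose T := @sphere R n `\` (G1 `|` G2).
have cptT : compact T.
  apply: (subclosed_compact _ (@sphere_compact R n)); last by move=> b [].
  by rewrite /T setDE; apply: closedI; [exact: sphere_closed|exact/open_closedC/openU].
have cz := tcod_chart_at p; have Ez := tparam_chart_at p.
set c := chart_at p in cz Ez; set x0 := coord c p in cz Ez.
pose A' := tcod c `&` tparam c @^-1` A.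
have clA' b : closure A (p, b) <-> closure A' (x0, b).
  by rewrite -Ez; exact: closure_tparam.
(* [T] is compact and none of its vectors, placed over [x0], is in the closure of [A']; hence one
   neighbourhood of [x0] works for all of [T]. *)
have near_T : \forall x \near x0, T `<=` [set b | ~ A' (x, b)].
  have covT := (compact_near_coveringP T).1 cptT.
  apply: (covT _ (nbhs x0) (fun x b => ~ A' (x, b)) (nbhs_filter x0)) => b [Sb nO].
  have : ~ closure A' (x0, b).
    move=> /clA' cb; apply: nO; have [Kb|nKb] := pselect (fiber_closure A p b).
      by left; exact: KG1.
    by right; apply: BG2; split => //; split => //; split => //; exact: sphere0.
  move=> /existsNP[N] /not_implyP[+ /nonemptyPn AN].
  case=> -[N1 N2] /= [N1x N2b] N12; exists (N2, N1) => //= -[b' x'] /= [N2b' N1x'] A'x.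
  have : (A' `&` N) (x', b') by split => //; exact: (N12 (x', b')).
  by rewrite AN.
have [a Aa] := cone_nonempty cA p.
have K_of b : fiber A p b -> b != 0 /\ K (normalize b).
  move=> Ab; have b0 : b != 0.
    apply/eqP => b0; have : (A `&` @zero_section R n _ M) (p, b) by [].
    by rewrite (cone_neq0 cA).
  split => //; split; first exact: normalize_sphere.
  split; last exact/sphere0/normalize_sphere.
  by apply: subset_closure; exact: normalize_fiber.
have B_v : B (normalize v).
  split; first exact: normalize_sphere.
  have t0 : 0 < `|v|^-1 by rewrite invr_gt0 normr_gt0.
  have Tnv := tclosure_conic cA t0 Tv.
  split; first exact: Tnv.
  have tv : 0 < `|v| by rewrite normr_gt0.
  move=> /(fiber_closure_conic cA tv).
  by rewrite /normalize scalerA divff ?scale1r // normr_eq0.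
pose W (O : set 'rV[R]_n) := [set b | b != 0 /\ O (normalize b)].
have nbhs_a : \forall x \near x0, A' (x, a).
  have oA' : open A' := (cone_open cA : tangent_open A) c.
  have : nbhs (x0, a) A'.
    by apply: open_nbhs_nbhs; split => //; split; [exact: cz|rewrite /= Ez].
  case=> -[N1 N2] /= [N1x N2a] N12; apply: filterS N1x => x N1x.
  by apply: N12; split => //; exact: nbhs_singleton.
have nW2 : nbhs (x0, v) [set y : E |
    [/\ T `<=` [set b | ~ A' (y.1, b)], A' (y.1, a) & W G2 y.2]].
  have [Q [nQ hQ]] : exists Q, nbhs x0 Q /\
      forall x, Q x -> T `<=` [set b | ~ A' (x, b)] /\ A' (x, a).
    by eexists; split; [exact: (filterI near_T nbhs_a)|].
  have N1 : nbhs (x0, v) ((fst : E -> _) @^-1` Q) by exact: cvg_fst.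
  have N2 : nbhs (x0, v) ((snd : E -> _) @^-1` W G2).
    apply: cvg_snd; apply: open_nbhs_nbhs; split; first exact: open_normalize.
    by split => //; exact: BG2.
  by apply: filterS2 N1 N2 => y /hQ[].
(* A single fibre over some [x] near [x0] contains both [v1], on the side of [G2], and the fixed
   vector [a], on the side of [G1], while its unit vectors avoid [T]. *)
have [[x v1] [[cx Axv] [/= xT [_ Axa] [v10 O2v1]]]] := (clA' v).1 Tv.1 _ nW2.
set D := [set b | A (tparam c (x, b))].
have W12 b : W G1 b -> W G2 b -> False.
  by move=> [_ b1] [_ b2]; have : (G1 `&` G2) (normalize b) by []; rewrite G12.
have Dne0 b : D b -> b != 0.
  move=> Db; apply/eqP => b0; move: Db; rewrite /D /= b0 tparamE /= linear0 => A0.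
  by have : (A `&` @zero_section R n _ M) (param c x, 0) by []; rewrite (cone_neq0 cA).
have D12 b : D b -> W G1 b \/ W G2 b.
  move=> Db; have b0 := Dne0 _ Db.
  have Dn : D (normalize b).
    move: Db; rewrite /D /= !tparamE /= linearZ => Ab.
    by apply: (cone_conic cA) => //; rewrite invr_gt0 normr_gt0.
  have [nT|nT] := pselect (T (normalize b)); first by case: (xT _ nT); split.
  have [G1b|nG1] := pselect (G1 (normalize b)); first by left.
  have [G2b|nG2] := pselect (G2 (normalize b)); first by right.
  by case: nT; split; [exact: normalize_sphere|case].
have W1a : W G1 a by have [a0 Ka] := K_of _ Aa; split => //; exact: KG1.
have DW1 : D `&` W G1 = D.
  apply: (chart_fiber_connected cx).
  - by exists a; split => //; exact: Axa.2.
  - by exists (W G1) => //; exact: open_normalize.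
  - exists (~` W G2); first exact/open_closedC/open_normalize.
    apply/seteqP; split => b [Db Wb]; split => //; first by move=> W2b; exact: W12 Wb W2b.
    by case: (D12 _ Db).
have : (D `&` W G1) v1 by rewrite DW1.
by move=> [_ W1v1]; apply: W12 W1v1 _.
Qed.

End FiberClosure.

(** * Real analysis on lines *)

Section Convex.
Variables (R : realType) (V : normedModType R).

Lemma line_continuous (a b : V) : continuous (fun s : R => a + s *: b).
Proof.
move=> s; have c1 : (fun _ : R => a) @ s --> a by exact: cst_continuous.
have c2 : (fun t : R => t *: b) @ s --> s *: b by exact: scalel_continuous.
exact: (cvgD c1 c2).
Qed.

Lemma affine_segment_connected (x y : V) :
  connected ((fun s : R => x + s *: (y - x)) @` `[0, 1]).
Proof.
apply: connected_continuous_connected.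
  by apply/connected_intervalP; exact: interval_is_interval.
exact/continuous_subspaceT/line_continuous.
Qed.

Lemma convex_connected (H : set V) :
  (forall x y (s : R), H x -> H y -> 0 <= s <= 1 -> H (x + s *: (y - x))) ->
  connected H.
Proof.
move=> cH; have [->|/set0P[x Hx]] := eqVneq H set0; first exact: connected0.
rewrite (_ : H = \bigcup_(y in H) ((fun s : R => x + s *: (y - x)) @` `[0, 1])).
  apply: bigcup_connected; last by move=> y _; exact: affine_segment_connected.
  exists x => y Hy; exists 0; last by rewrite scale0r addr0.
  by rewrite /= in_itv /= lexx ler01.
apply/seteqP; split => [y Hy|z [y Hy [s]]].
  exists y => //; exists 1; last by rewrite scale1r addrC subrK.
  by rewrite /= in_itv /= lexx ler01.
by rewrite /= in_itv /= => s01 <-; exact: cH.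
Qed.

(** [G] and [F] have the same trace on [D], which is thus open and closed in [D]. With [F] the
    closure of [G], the hypothesis says that [D] avoids the frontier of [G]. *)
Lemma clopen_sub (D G F : set V) : connected D -> open G -> D `&` G !=set0 ->
  closed F -> D `&` F `<=` G -> G `<=` F -> D `<=` G.
Proof.
move=> cD oG DG0 cF DFG GF; suff <- : D `&` G = D by move=> x [].
apply: cD => //; first by exists G.
exists F => //; apply/seteqP; split => x [Dx Gx]; split => //; first exact: GF.
exact: DFG.
Qed.

Lemma is_derive_line (W : normedModType R) (F : V -> W) (q w : V) (s : R) :
  differentiable F (s *: q + w) ->
  is_derive s 1 (fun t => F (t *: q + w)) ('D_q F (s *: q + w)).
Proof.
move=> dF; have dl : differentiable (fun t : R => t *: q + w) s by exact: ex_diff.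
have dc := differentiable_comp dl dF.
apply: DeriveDef; first exact: diff_derivable.
rewrite (deriveE _ dc) (deriveE _ dF) (diff_comp dl dF) /=.
have Eq : 'd (fun t : R => t *: q + w) s 1 = q.
  rewrite -(deriveE _ dl); apply: (@derive_quotient _ _ _ _ _ _ (fun=> q)); last exact: cvg_cst.
  near=> h => h0; rewrite opprD addrACA subrr addr0 -scalerBl addrK scalerA.
  by rewrite [_ *: 1]mulr1 mulVf // scale1r.
by rewrite Eq.
Unshelve. all: by end_near.
Qed.

End Convex.

Section RealLine.
Variable R : realType.

Lemma is_derive_MVT_on (f df : R -> R) (a b : R) : a < b ->
  (forall x : R, a <= x <= b -> is_derive x 1 f (df x)) ->
  exists2 c, a < c < b & f b - f a = df c * (b - a).
Proof.
move=> ab fd.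
have H1 x : x \in `]a, b[%R -> is_derive x 1 f (df x).
  by rewrite in_itv /= => /andP[ax xb]; apply: fd; rewrite !ltW.
have H2 : {within `[a, b], continuous f}.
  apply: continuous_in_subspaceT => x; rewrite inE /= in_itv /= => /fd [dx _].
  by apply: differentiable_continuous; apply/derivable1_diffP.
by have [c + E] := MVT ab H1 H2; rewrite in_itv /=; exists c.
Qed.

Lemma is_derive_MVT (f df : R -> R) (a b : R) : a < b ->
  (forall x : R, is_derive x 1 f (df x)) ->
  exists2 c, a < c < b & f b - f a = df c * (b - a).
Proof. by move=> ab fd; apply: is_derive_MVT_on ab _ => x _; exact: fd. Qed.

(** [r] decreases, so it stays negative after [s], while the derivative of [1 / r] exceeds [1/2].
    Starting from [1 / r s], the reciprocal would no longer be negative at time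
    [T = s - 2 / r s]. *)
Lemma riccati_lt0 (r r' : R -> R) (s : R) :
  (forall t : R, is_derive t 1 r (r' t)) -> (forall t, r' t < - (r t ^+ 2 / 2)) ->
  r s < 0 -> False.
Proof.
move=> rd rlt rs.
have r'0 t : r' t < 0.
  by apply: lt_le_trans (rlt t) _; rewrite oppr_le0 divr_ge0 // sqr_ge0.
have r0 t : s <= t -> r t < 0.
  rewrite le_eqVlt => /orP[/eqP <-//|st].
  have [c _ E] := is_derive_MVT st rd.
  have : r t - r s < 0 by rewrite E nmulr_rlt0 // subr_gt0.
  by rewrite subr_lt0 => /lt_trans; apply.
pose T := s - 2 * (r s)^-1.
have sT : s < T by rewrite /T -subr_gt0 addrAC subrr add0r -mulrN pmulr_rgt0 // oppr_gt0 invr_lt0.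
have kd (t : R) : s <= t <= T -> is_derive t 1 (fun t => (r t)^-1) (- (r t) ^- 2 * r' t).
  move=> /andP[st _]; have rt : r t != 0 by rewrite lt_eqF // r0.
  have [dr drE] := rd t; apply: DeriveDef; first exact: derivableV.
  by rewrite deriveV // drE.
have [c /andP[sc cT] E] := is_derive_MVT_on sT kd.
have rc : r c < 0 by apply: r0; exact: ltW.
have k2 : 2^-1 < - (r c) ^- 2 * r' c.
  rewrite mulNr -mulrN; have r2 : 0 < r c ^+ 2 by rewrite exprn_even_gt0 //= lt_eqF.
  rewrite -(ltr_pM2l r2) mulrA divff ?mul1r; last by rewrite gt_eqF.
  by rewrite ltrNr; exact: rlt.
have : (r T)^-1 < 0 by rewrite invr_lt0 r0 // ltW.
apply/negP; rewrite -leNgt.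
have -> : (r T)^-1 = (r s)^-1 + (- r c ^- 2 * r' c) * (T - s) by rewrite -E addrC subrK.
have Ts : 0 < T - s by rewrite subr_gt0.
apply: (@le_trans _ _ ((r s)^-1 + 2^-1 * (T - s))).
  by rewrite /T addrAC subrr add0r mulrN mulrA mulVf // mul1r subrr.
by rewrite lerD2l ler_pM2r // ltW.
Qed.

(** A positive value becomes a negative one under the time reversal [t |-> - r (- t)], which
    preserves the inequality; if [r] vanishes identically, the strict inequality fails. *)
Lemma riccati (r r' : R -> R) :
  (forall t : R, is_derive t 1 r (r' t)) -> (forall t, r' t < - (r t ^+ 2 / 2)) -> False.
Proof.
move=> rd rlt.
have [[s rs]|/forallNP r0] := pselect (exists s, r s < 0); first exact: riccati_lt0 rd rlt rs.
have [[s rs]|/forallNP r1] := pselect (exists s, 0 < r s).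
  apply: (@riccati_lt0 (fun t => - r (- t)) (fun t => r' (- t)) (- s)).
  - move=> t; have [dr drE] := rd (- t).
    have dN : is_derive t 1 (fun t : R => - t) (- 1) by exact: is_deriveNid.
    have dr' := (derivable1_diffP _ _).1 dr.
    have dN' := (derivable1_diffP _ _).1 (@ex_derive _ _ _ _ _ _ _ dN).
    have dc := differentiable_comp dN' dr'.
    apply: DeriveDef; first by apply: derivableN; exact: diff_derivable.
    rewrite deriveN; last exact: diff_derivable.
    have E1 : 'd (r \o (fun t : R => - t)) t 1 = 'd r (- t) ('d (fun t : R => - t) t 1).
      by have := diff_comp dN' dr'; move/(congr1 (fun h : _ -> _ => h 1)).
    have E2 : 'd (fun t : R => - t) t 1 = - 1 :=
      etrans (esym (deriveE (1 : R^o) dN')) (@derive_val _ _ _ _ _ _ _ dN).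
    have E3 : 'd r (- t) (- 1) = - r' (- t).
      apply: etrans (linearN _ _) _; congr (- _).
      exact: etrans (esym (deriveE (1 : R^o) dr')) drE.
    rewrite -[RHS]opprK; congr (- _); apply: etrans (deriveE (1 : R^o) dc) _.
    apply: etrans E1 _; apply: etrans (congr1 _ E2) _; exact: E3.
  - by move=> t; rewrite sqrrN; exact: rlt.
  - by rewrite opprK oppr_lt0.
have rE t : r t = 0.
  apply/eqP; rewrite eq_le !leNgt; apply/andP; split; apply/negP; [exact: r1|exact: r0].
have [c _] := is_derive_MVT (@ltr01 R) rd; rewrite !rE subrr subr0 mulr1 => E.
by have := rlt c; rewrite -E rE expr0n /= mul0r oppr0 ltxx.
Qed.

End RealLine.

(** * The cone structure determines the cone domain *)

Section Algebra.
Variables (R : realType) (n : nat) (b : 'rV[R]_n -> 'rV[R]_n -> R).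
Hypothesis bl : forall a u u' w, b (a *: u + u') w = a * b u w + b u' w.
Hypothesis br : forall a u u' w, b w (a *: u + u') = a * b w u + b w u'.

(** [W] is a hyperplane that misses the null line of [q], so [u = w + a q] with [w] in [W], and the
    products with [q] drop out: [b u u = b w w]. Orthogonality is asked on both sides because [b] is
    not assumed symmetric. *)
Lemma index_radical (W : {vspace 'rV[R]_n}) q u : (0 < n)%N ->
  negative_definite_on b W -> \dim W = n.-1 -> q != 0 ->
  b q q = 0 -> b q u = 0 -> b u q = 0 -> (forall a, u <> a *: q) -> b u u < 0.
Proof.
move=> n0 nW dW q0 bqq bqu buq uq.
have qW : q \notin W.
  by apply/negP => qW; have := nW q qW q0; rewrite bqq ltxx.
have Wq : (W :&: <[q]> = 0)%VS.
  apply/eqP; rewrite -subv0; apply/subvP => x; rewrite memv_cap => /andP[xW /vlineP[a xE]].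
  rewrite memv0; have [a0|a0] := eqVneq a 0; first by rewrite xE a0 scale0r.
  by move: xW; rewrite xE rpredZeq (negbTE a0) (negbTE qW).
have full : (W + <[q]> = fullv)%VS.
  apply/eqP; rewrite eqEdim subvf /= dimv_disjoint_sum // dW dim_vline q0 dimvf.
  by rewrite /dim /= mul1n addn1 prednK.
have : u \in (W + <[q]>)%VS by rewrite full memvf.
case/memv_addP => w wW [_ /vlineP[a ->] uE].
have w0 : w != 0.
  by apply/eqP => w0; apply: (uq a); rewrite uE w0 add0r.
have lastE : b w q = 0.
  have : b (a *: q + w) q = 0 by rewrite addrC -uE.
  by rewrite bl bqq mulr0 add0r.
have -> : b u u = b w w.
  have E1 : b u u = b w u.
    by rewrite {1}uE addrC bl bqu mulr0 add0r.
  by rewrite E1 uE addrC br lastE mulr0 add0r.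
exact: nW.
Qed.

Lemma not_in_line (q : 'rV[R]_n) : (1 < n)%N -> exists u, forall a, u <> a *: q.
Proof.
move=> n1; apply: contrapT => /forallNP H.
have : (fullv <= <[q]>)%VS.
  apply/subvP => u _; apply/vlineP; have /existsNP[a /contrapT ua] := H u.
  by exists a.
move/dimvS; rewrite dimvf dim_vline /dim /= mul1n => nq.
by move: (leq_trans n1 nq); case: (q != 0).
Qed.

End Algebra.

Section Local.
Variable R : realType.

Lemma Cn_local (V W : normedModType R) k (D : set V) (f : V -> W) :
  (forall x, D x -> exists2 G, open G /\ G x & Cn k G f) -> Cn k D f.
Proof.
elim: k f => [|k IH] f H.
  by move=> x /H[G [_ Gx] cf]; exact: cf.
split=> [x /H[G [_ Gx] [df _]]|v]; first exact: df.
by apply: IH => x /H[G oG [_ Df]]; exists G => //; exact: Df.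
Qed.

Lemma near0_interval (P : R -> Prop) : (\forall t \near (0 : R), P t) ->
  exists2 e, 0 < e & forall t, `|t| < e -> P t.
Proof.
move=> /nbhs_ballP[e e0 He]; exists e => // t te; apply: He.
by rewrite /ball /= sub0r normrN.
Qed.

(** The derivative along [u] vanishes at [q] and is negative just after it; the mean value theorem
    then makes [f] negative. *)
Lemma second_order_lt0 (V : normedModType R) (f : V -> R) (U : set V) (q u : V) :
  open U -> U q -> Cn 2 U f -> f q = 0 -> 'D_u f q = 0 -> 'D_u ('D_u f) q < 0 ->
  \forall t \near (0 : R), 0 < t -> f (t *: u + q) < 0.
Proof.
move=> oU Uq cf fq Dq DDq.
have dD := Cn_diff (Cn_derive u cf) Uq.
have N1 : \forall t \near (0 : R), 0 < t -> (- 'D_u f) q < (- 'D_u f) (t *: u + q).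
  apply: derive_gt0_near; first exact: differentiableN.
  by rewrite deriveN ?oppr_gt0 //; exact: diff_derivable.
have N2 := @nbhs_line R _ q u _ (open_nbhs_nbhs (conj oU Uq)).
have [e e0 He] := near0_interval (filterI N1 N2).
have Ne : \forall t \near (0 : R), `|t| < e by exact: nbhs0_lt.
apply: filterS Ne => t te t0.
have fd (s : R) : 0 <= s <= t ->
    is_derive s 1 (fun s => f (s *: u + q)) ('D_u f (s *: u + q)).
  move=> /andP[s0 st]; apply: is_derive_line; apply: (Cn_diff cf).
  apply: (He s _).2; apply: le_lt_trans te.
  by rewrite !ger0_norm // (le_trans s0).
have [c /andP[c0 ct] E] := is_derive_MVT_on t0 fd.
move: E; rewrite scale0r add0r fq !subr0 => ->.
rewrite nmulr_rlt0 //; have := (He c _).1 c0.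
rewrite !fctE Dq oppr0 oppr_gt0; apply; apply: lt_trans te.
by rewrite !gtr0_norm.
Qed.

End Local.

Section ConeEquality.
Variables (R : realType) (n : nat) (k : option nat) (M : manifold R n (omap S k)).
Local Notation V := 'rV[R]_n.
Variables (A : set (tangent M)) (L : tangent M -> R).
Hypotheses (hk : reg_ge2 k) (hL : Lorentz_Finsler k A L).
Let cA := LF_domain hL.
Variable (p : M).
Let D := fiber A p.
Let C := [set v | cone_structure A (p, v)].

Lemma fiber_neq0 v : D v -> v <> 0.
Proof.
move=> Dv v0; have : (A `&` @zero_section R n _ M) (p, v) by [].
by rewrite (cone_neq0 cA).
Qed.

Lemma closure_fiberE v : closure D v -> v <> 0 -> D v \/ C v.
Proof.
move=> cv v0; have Tv : tclosure A (p, v) by apply: fiber_closure_tclosure.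
have [Dv|nD] := pselect (D v); [by left|by right].
Qed.

Lemma cone_closure v : C v -> fiber_closure A p v.
Proof. by move=> [Tv _]; exact: (tclosure_fiber hk hL Tv). Qed.

Lemma fiber_boundaryE v : (fiber_closure A p `\` fiber A p) v <-> C v.
Proof.
split=> [[Kv nD]|Cv]; first by split; [exact: fiber_closure_tclosure|].
by split; [exact: cone_closure|case: Cv].
Qed.

Lemma cone_conicE v (t : R) : 0 < t -> C v -> C (t *: v).
Proof.
move=> t0 Cv; apply/fiber_boundaryE; split.
  exact: (fiber_closure_conic cA t0 (cone_closure Cv)).
move=> Dtv; case: (Cv) => _; apply.
have -> : v = t^-1 *: (t *: v) by rewrite scalerA mulVf ?scale1r // gt_eqF.
by apply: (cone_conic cA) => //; rewrite invr_gt0.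
Qed.

Lemma L_Cn2 : Cn 2 D (fun v => L (p, v)).
Proof.
apply: Cn_local => v Dv; have Tv : tclosure A (p, v) by exact: (sub_tclosure cA).
have [U [f [oU Uv cf fL]]] := LF_fiber_extension hk hL Tv.
have oD : open D by exact: (fiber_open cA).
exists (D `&` U); first by split => //; exact: openI.
apply: (@Cn_eq _ _ _ _ _ f); [exact: openI| |by apply: Cn_sub cf => y []].
by move=> y /set_mem[Dy Uy]; apply: fL => //; exact: (sub_tclosure cA).
Qed.

Lemma L_fiber_extension v : D v -> fiber_extension A L p v D (fun v => L (p, v)).
Proof. by move=> Dv; split => //; [exact: (fiber_open cA)|exact: L_Cn2]. Qed.

(* Along an affine line contained in the cone of a Lorentz-Finsler metric,
   the square root of L would be a positive strictly concave function on R;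
   the proof uses the logarithmic derivative of L instead. *)
Lemma no_line q w : (1 < n)%N -> (forall x, exists a c, x = a *: q + c *: w) ->
  ~ (forall s : R, D (s *: q + w)).
Proof.
move=> n1 qw Dl; pose g v := L (p, v).
have oD : open D by exact: (fiber_open cA).
have cg : Cn 2 D g := L_Cn2.
pose phi s := g (s *: q + w); pose phi1 (s : R) : R := 'D_q g (s *: q + w).
pose phi2 (s : R) : R := 'D_q ('D_q g) (s *: q + w).
have phi0 s : 0 < phi s by exact: (LF_gt0 hL (Dl s)).
have d1 (s : R) : is_derive s 1 phi (phi1 s).
  by apply: is_derive_line; exact: Cn_diff cg (Dl s).
have d2 (s : R) : is_derive s 1 phi1 (phi2 s).
  by apply: is_derive_line; exact: Cn_diff (Cn_derive q cg) (Dl s).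
(* On [x] and [q], twice the fundamental tensor at [x] has the entries [2 phi], [phi1], [phi2]. It
   is negative on some vector, the plane being the whole fibre, and [2 phi > 0]; hence its
   determinant is negative. *)
have disc s : 2 * phi s * phi2 s < phi1 s ^+ 2.
  set x := s *: q + w; have Dx : D x := Dl s.
  have fe := L_fiber_extension Dx; have cDx : closure D x by exact: subset_closure.
  have [W nW dW] := (LF_index hL (conj cDx (fiber_neq0 Dx) : fiber_closure A p x)).1.
  have [e eW e0] : exists2 e, e \in W & e != 0.
    exists (vpick W); first exact: memv_pick.
    by rewrite vpick0 -dimv_eq0 dW; case: (n) n1 => [|[|]].
  have [B [BE Bl Br]] : exists B : V -> V -> R,
      [/\ forall u v, 'D_u ('D_v g) x = B u v,
          forall a u u' v, B (a *: u + u') v = a * B u v + B u' v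
        & forall a u u' v, B v (a *: u + u') = a * B v u + B v u'].
    exists (fun u v => 'D_u ('D_v g) x); split => // a u u' v.
      exact: (derive2_linl cg u u' v a Dx).
    exact: (derive2_linr oD cg u u' v a Dx).
  have := nW e eW e0; rewrite (metric_tensorE hL cDx fe) BE.
  have [a [c eE]] : exists a c, e = c *: q + (a *: x + 0).
    have [a [c ->]] := qw e; exists c, (a - c * s).
    by rewrite /x addr0 scalerDr scalerA addrA -scalerDl subrK.
  have E1 : B x x = 2 * phi s.
    by rewrite -BE (fiber_Euler2l hL cDx fe) (fiber_Euler1 hL cDx fe).
  have E2 : B x q = phi1 s by rewrite -BE (fiber_Euler2l hL cDx fe).
  have E3 : B q x = phi1 s by rewrite -BE (fiber_Euler2r hL cDx fe).
  have E4 : B q q = phi2 s by rewrite -BE.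
  have B0l v : B 0 v = 0.
    by have := Bl 1 0 0 v; rewrite scale1r addr0 mul1r => /eqP; rewrite -subr_eq subrr => /eqP.
  have B0r v : B v 0 = 0.
    by have := Br 1 0 0 v; rewrite scale1r addr0 mul1r => /eqP; rewrite -subr_eq subrr => /eqP.
  have -> : B e e = c ^+ 2 * phi2 s + 2 * c * a * phi1 s + 2 * a ^+ 2 * phi s.
    have key y : e = c *: q + (a *: y + 0) -> B y y = 2 * phi s -> B y q = phi1 s ->
        B q y = phi1 s -> B e e = c ^+ 2 * phi2 s + 2 * c * a * phi1 s + 2 * a ^+ 2 * phi s.
      by move=> -> F1 F2 F3; rewrite !Br !Bl !B0l !B0r F1 F2 F3 E4; ring.
    exact: key eE E1 E2 E3.
  rewrite pmulr_llt0 ?invr_gt0 // => neg.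
  have P := phi0 s.
  (* Completing the square: with [b] the value at [e], [2 phi b = (2 a phi + c phi1)^2 + c^2 (2 phi
     phi2 - phi1^2)]. *)
  have sq : 0 <= (2 * a * phi s + c * phi1 s) ^+ 2 by exact: sqr_ge0.
  have c2 : c ^+ 2 * (2 * phi s * phi2 s - phi1 s ^+ 2) < 0 by nra.
  rewrite -subr_lt0; move: c2; have : 0 <= c ^+ 2 by exact: sqr_ge0.
  rewrite le_eqVlt => /orP[/eqP <-|c0]; first by rewrite mul0r ltxx.
  by rewrite pmulr_rlt0.
(* For the logarithmic derivative [phi1 / phi], the inequality [2 phi phi2 < phi1^2] is exactly the
   Riccati inequality with constant 1/2. *)
apply: (@riccati R (fun s => phi1 s / phi s)
  (fun s => (phi2 s * phi s - phi1 s ^+ 2) / phi s ^+ 2)) => s.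
  have p0 : phi s != 0 by rewrite gt_eqF.
  have dV : is_derive s 1 (fun s => (phi s)^-1) (- (phi s) ^- 2 * phi1 s).
    by have [f1 f1E] := d1 s; apply: DeriveDef; [exact: derivableV|rewrite deriveV // f1E].
  apply: (is_derive_eq (is_deriveM (d2 s) dV)).
  by rewrite /GRing.scale /=; field.
have P2 : 0 < phi s ^+ 2 by rewrite exprn_gt0.
have -> : - ((phi1 s / phi s) ^+ 2 / 2) = - (phi1 s ^+ 2 / 2) / phi s ^+ 2.
  by field; rewrite gt_eqF.
rewrite ltr_pM2r ?invr_gt0 //; have := disc s; set y := phi1 s ^+ 2.
set z := phi s; set t := phi2 s; lra.
Qed.

End ConeEquality.

(** * Planar fibres, and the second derivative along the boundary *)

Section Sector.
Variables (R : realType) (n : nat) (k : option nat) (M : manifold R n (omap S k)).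
Local Notation V := 'rV[R]_n.
Variables (A : set (tangent M)) (L : tangent M -> R).
Hypotheses (hk : reg_ge2 k) (hL : Lorentz_Finsler k A L) (n1 : (1 < n)%N).
Let cA := LF_domain hL.
Variable (p : M).
Let D := fiber A p.
Let C := [set v | cone_structure A (p, v)].

(* In dimension 2, the fibre of a cone domain lies on one side of the line
   through a boundary ray and has its other boundary ray on that side: otherwise
   it would contain an affine line. *)
Lemma sector (q w : V) (alpha beta : V -> R) :
  continuous alpha -> continuous beta ->
  (forall x, x = alpha x *: q + beta x *: w) ->
  (forall a c, alpha (a *: q + c *: w) = a) ->
  (forall a c, beta (a *: q + c *: w) = c) ->
  C q -> (exists2 t0, 0 < t0 & forall t, 0 < t <= t0 -> D (t *: w + q)) ->
  (forall x, D x -> 0 < beta x) /\ exists s, C (s *: q + w).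
Proof.
move=> ca cb xE aE bE Cq [t0 t00 Dt].
have oD : open D by exact: (fiber_open cA).
have Dconic x (t : R) : 0 < t -> D x -> D (t *: x) by exact: (cone_conic cA).
(* [s q + w] is [s] times [q + s^-1 w], and [s^-1 <= t0]. *)
have Dlarge s : t0^-1 <= s -> D (s *: q + w).
  move=> ts; have s0 : 0 < s by apply: lt_le_trans ts; rewrite invr_gt0.
  have : D (s *: (s^-1 *: w + q)).
    by apply: (Dconic _ _ s0); apply: Dt; rewrite invr_gt0 s0 /= invf_ple.
  by rewrite scalerDr scalerA divff ?gt_eqF // scale1r addrC.
pose X := [set s : R | ~ D (s *: q + w)].
have X0 : X !=set0.
  apply/set0P/negP => /eqP X0; apply: (no_line hk hL n1 (p := p) (q := q) (w := w)) => [x|s].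
    by exists (alpha x), (beta x).
  by apply: contrapT => nD; have : X s by []; rewrite X0.
have Xub : has_ubound X.
  exists t0^-1 => s; rewrite leNgt => nD; apply/negP => ts; apply: nD.
  exact/Dlarge/ltW.
have supX : has_sup X by [].
(* [X] is non-empty because [D] contains no affine line, and bounded above by [Dlarge]. The vector
   [s0 q + w] will span the second boundary ray. *)
pose s0 := sup X.
have lc (s : R) : {for s, continuous (fun t : R => t *: q + w)}.
  have := @line_continuous R V w q s; rewrite /prop_for /continuous_at addrC.
  by under eq_fun do rewrite addrC.
have above s : s0 < s -> D (s *: q + w).
  move=> ss; apply: contrapT => nD; move: ss; apply/negP; rewrite -leNgt.
  exact: ub_le_sup.
have nD0 : ~ D (s0 *: q + w).
  move=> D0; have : nbhs s0 ((fun t : R => t *: q + w) @^-1` D).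
    by apply: lc; exact: open_nbhs_nbhs.
  move=> /nbhs_ballP[e e0 He].
  have [s Xs se] := sup_adherent e0 supX.
  have ss0 : s <= s0 by exact: ub_le_sup.
  apply: (Xs); apply: He; rewrite /ball /= ger0_norm ?subr_ge0 //.
  by rewrite ltrBlDr addrC -ltrBlDr.
have w0 : s0 *: q + w <> 0.
  move=> E0; have := bE s0 1; rewrite scale1r E0.
  by have := bE 0 0; rewrite !scale0r addr0 => -> /eqP; rewrite eq_sym oner_eq0.
have Cs0 : C (s0 *: q + w).
  have [//|//] : D (s0 *: q + w) \/ C (s0 *: q + w).
  apply: closure_fiberE w0 => N /lc /nbhs_ballP[e e0 He].
  have e2 : 0 < e / 2 by rewrite divr_gt0.
  exists ((s0 + e / 2) *: q + w); split; first by apply: above; rewrite ltrDl.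
  apply: He; rewrite /ball /= opprD addrA subrr add0r normrN gtr0_norm //.
  by rewrite ltr_pdivrMr // ltr_pMr // ltr1n.
(* The right-hand side is the open sector between the rays of [q] and of [s0 q + w]. Its frontier
   consists of these rays, contained in the cone structure, and the origin, so that the connected
   [D] cannot cross it. *)
have DS : D `<=` [set x | 0 < beta x /\ s0 * beta x < alpha x].
  have cg : continuous (fun x => alpha x - s0 * beta x).
    move=> x; have c2 : (fun _ : V => s0) @ x --> s0 by exact: (@cst_continuous _ _ s0).
    exact: (cvgB (ca x) (cvgM c2 (cb x))).
  have oB : open [set x | 0 < beta x].
    by apply: open_comp (@open_gt R 0) => x _; exact: cb.
  have oG : open [set x | 0 < alpha x - s0 * beta x].
    by apply: open_comp (@open_gt R 0) => x _; exact: cg.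
  have clB : closed [set x | 0 <= beta x].
    by apply: preimage_closed (@closed_ge R 0) => x _; exact: cb.
  have clG : closed [set x | 0 <= alpha x - s0 * beta x].
    by apply: preimage_closed (@closed_ge R 0) => x _; exact: cg.
  have H : D `<=` [set x | 0 < beta x] `&` [set x | 0 < alpha x - s0 * beta x].
    apply: (@clopen_sub R V D _ ([set x | 0 <= beta x] `&` [set x | 0 <= alpha x - s0 * beta x])).
    - exact: (cone_connected cA).
    - exact: openI.
    - exists ((s0 + 1) *: q + w); split; first by apply: above; lra.
      have -> : (s0 + 1) *: q + w = (s0 + 1) *: q + 1 *: w by rewrite scale1r.
      by split; rewrite /= ?aE bE //; lra.
    - exact: closedI.
    - move=> x [Dx [/= b0 g0]]; have [Eb|nb] := eqVneq (beta x) 0.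
        have a0 : 0 <= alpha x by move: g0; rewrite Eb mulr0 subr0.
        have xq : x = alpha x *: q by rewrite {1}(xE x) Eb scale0r addr0.
        have [Ea|na] := eqVneq (alpha x) 0.
          by have := fiber_neq0 hL Dx; rewrite xq Ea scale0r.
        have : C x by rewrite xq; apply: (cone_conicE hk hL) => //; rewrite lt_neqAle eq_sym na.
        by case.
      have bx : 0 < beta x by rewrite lt_neqAle eq_sym nb.
      split => //=; rewrite lt_neqAle g0 andbT; apply/eqP => E0.
      have Ex : x = beta x *: (s0 *: q + w).
        by rewrite scalerDr scalerA mulrC -[X in X *: q](subrK (alpha x))
          -opprB -E0 oppr0 add0r -xE.
      have : C x by rewrite Ex; exact: (cone_conicE hk hL).
      by case.
    - by move=> x [/= b0 g0]; split; exact: ltW.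
  by move=> x /H[/= b0 g0]; split => //; rewrite -subr_gt0.
by split; [move=> x /DS[]|exists s0].
Qed.

(** [q] is a null vector of the metric tensor, and ['D_u f q = 0] makes [u] orthogonal to it; with
    index [n - 1], the tensor is negative on any such [u] that is not radial. *)
Lemma hessian_tangent (q u : V) (U : set V) (f : V -> R) : C q ->
  fiber_extension A L p q U f -> 'D_u f q = 0 -> (forall a, u <> a *: q) ->
  'D_u ('D_u f) q < 0.
Proof.
move=> Cq fe Duf uq; have [cq q0] := cone_closure hk hL Cq.
have [oU Uq cf fL] := fe.
have [W nW dW] := (LF_index hL (conj cq q0 : fiber_closure A p q)).1.
have half0 : 0 < 2^-1 :> R by rewrite invr_gt0.
rewrite -(pmulr_llt0 _ half0) -(metric_tensorE hL cq fe).
have fq : f q = 0 by rewrite fL ?(LF_eq0 hL) //; case: Cq.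
apply: (@index_radical _ _ _ _ _ W q) => //.
- move=> a v v' v2; rewrite !(metric_tensorE hL cq fe).
  by rewrite (derive2_linl cf v v' v2 a Uq) mulrDl mulrA.
- move=> a v v' v2; rewrite !(metric_tensorE hL cq fe).
  by rewrite (derive2_linr oU cf v v' v2 a Uq) mulrDl mulrA.
- exact: ltnW.
- exact/eqP.
- by rewrite (metric_tensor_radial hL cq fe) (fiber_Euler1 hL cq fe) fq mulr0 mul0r.
- by rewrite (metric_tensor_radial hL cq fe) Duf mul0r.
- by rewrite (metric_tensorE hL cq fe) (fiber_Euler2r hL cq fe) Duf mul0r.
Qed.

End Sector.

Lemma convex_lt (R : realDomainType) (s x y e : R) :
  0 <= s -> s <= 1 -> x < e -> y < e -> (1 - s) * x + s * y < e.
Proof.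
move=> s0 s1 xe ye; pose m := Num.max x y.
have me : m < e by rewrite gt_max xe ye.
apply: le_lt_trans me; have xm : x <= m by rewrite le_max lexx.
have ym : y <= m by rewrite le_max lexx orbT.
by nra.
Qed.

(** * Disjoint fibres with a common boundary *)

Section SameCone.
Variables (R : realType) (n : nat) (k : option nat) (M : manifold R n (omap S k)).
Local Notation V := 'rV[R]_n.
Hypotheses (hk : reg_ge2 k) (n1 : (1 < n)%N).

(** The first fibre is connected and avoids the frontier of the second one, which apart from the
    origin is the common cone structure. *)
Lemma fiber_sub_of_meet (A1 A2 : set (tangent M)) (L1 L2 : tangent M -> R) (p : M) :
  Lorentz_Finsler k A1 L1 -> Lorentz_Finsler k A2 L2 ->
  cone_structure A1 = cone_structure A2 ->
  fiber A1 p `&` fiber A2 p !=set0 -> fiber A1 p `<=` fiber A2 p.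
Proof.
move=> h1 h2 hC h12.
apply: (@clopen_sub R V _ _ (closure (fiber A2 p))) => //.
- exact: (cone_connected (LF_domain h1)).
- exact: (fiber_open (LF_domain h2)).
- exact: closed_closure.
- move=> x [x1 x2]; have [//|] := closure_fiberE x2 (fiber_neq0 h1 x1).
  by rewrite -hC => -[].
- exact: subset_closure.
Qed.

Variables (A1 A2 : set (tangent M)) (L1 L2 : tangent M -> R).
Hypotheses (h1 : Lorentz_Finsler k A1 L1) (h2 : Lorentz_Finsler k A2 L2).
Hypothesis hC : cone_structure A1 = cone_structure A2.
Variable p : M.
Hypothesis h12 : fiber A1 p `&` fiber A2 p = set0.
Let C := [set v | cone_structure A1 (p, v)].

Let C2 v : C v -> cone_structure A2 (p, v).
Proof. by rewrite /C hC. Qed.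

Let disjoint x : fiber A1 p x -> fiber A2 p x -> False.
Proof. by move=> x1 x2; have : (fiber A1 p `&` fiber A2 p) x by []; rewrite h12. Qed.

(** Without boundary vectors, a fibre could be left only through the origin. Since [2 <= n], the
    second fibre, being open, has a vector off the line of [a1]; the segment from [a1] to it avoids
    the origin and would stay in the first fibre. *)
Lemma cone_inhabited : exists q, C q.
Proof.
apply: contrapT => /forallNP nC.
have [a1 Da1] := cone_nonempty (LF_domain h1) p.
have [a2 Da2] := cone_nonempty (LF_domain h2) p.
have [b Db bl] : exists2 b, fiber A2 p b & forall a, b <> a *: a1.
  have [[b0 b0E]|nl] := pselect (exists a, a2 = a *: a1); last first.
    by exists a2 => // a ea; apply: nl; exists a.
  have [u ul] := not_in_line a1 n1.
  have N2 := @nbhs_line R V a2 u _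
    (open_nbhs_nbhs (conj (@fiber_open _ _ _ _ _ (LF_domain h2) p) Da2)).
  have [e e0 He] := near0_interval N2.
  have e2 : 0 < e / 2 by rewrite divr_gt0.
  exists (e / 2 *: u + a2).
    by apply: He; rewrite gtr0_norm // ltr_pdivrMr // ltr_pMr // ltr1n.
  move=> a ea; apply: (ul ((e / 2)^-1 * (a - b0))).
  rewrite -scalerA scalerBl -ea -b0E addrK scalerA mulVf ?scale1r //.
  by rewrite gt_eqF.
have seg : (fun s : R => a1 + s *: (b - a1)) @` `[0, 1] `<=` fiber A1 p.
  apply: (@clopen_sub R V _ _ (closure (fiber A1 p))).
  - exact: affine_segment_connected.
  - exact: (fiber_open (LF_domain h1)).
  - exists a1; split => //; exists 0; last by rewrite scale0r addr0.
    by rewrite /= in_itv /= lexx ler01.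
  - exact: closed_closure.
  - move=> x [[s _ sx] cx]; have x0 : x <> 0.
      move=> x0; have E : s *: b = (s - 1) *: a1.
        have E1 : s *: (b - a1) = - a1 by apply/eqP; rewrite -addr_eq0 addrC sx x0.
        by rewrite -[b in LHS](subrK a1) scalerDr E1 scalerBl scale1r addrC.
      have [s0|s0] := eqVneq s 0.
        have := fiber_neq0 h1 Da1; apply.
        by move: E; rewrite s0 scale0r sub0r scaleN1r => /eqP; rewrite eq_sym oppr_eq0 => /eqP.
      apply: (bl (s^-1 * (s - 1))).
      by rewrite -scalerA -E scalerA mulVf // scale1r.
    by have [//|Cx] := closure_fiberE cx x0; case: (nC x).
  - exact: subset_closure.
apply: (disjoint _ Db); apply: seg; exists 1; last by rewrite scale1r addrC subrK.
by rewrite /= in_itv /= lexx ler01.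
Qed.

Variable q : V.
Hypothesis Cq : C q.
Variables (U : set V) (Phi : V -> 'rV[R]_n) (Psi : 'rV[R]_n -> V) (i : 'I_n).
Hypothesis hs : straightening (fiber_closure A1 p) (fiber_closure A1 p `\` fiber A1 p)
  U Phi Psi i k.
Hypothesis Uq : U q.

Let q0 : q != 0.
Proof. by apply/eqP; have [] := cone_closure hk h1 Cq. Qed.

Let dSq : (fiber_closure A1 p `\` fiber A1 p) q.
Proof. exact/(fiber_boundaryE hk h1). Qed.

(* The two cone domains lie on both sides of the common cone structure. *)
Lemma outside_near : \forall x \near q, defining Phi i x < 0 -> fiber A2 p x.
Proof.
have [oU [oPU PhiK] _ hS] := hs.
have cPhi0 : Cn 0 U Phi by case: hs => _ _ [c _] _; apply: Ck_Cn c; case: (k).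
have cPsi0 : Cn 0 (Phi @` U) Psi by case: hs => _ _ [_ c] _; apply: Ck_Cn c; case: (k).
have cPhi : {for q, continuous Phi} := Cn_continuous cPhi0 Uq.
have cPsi y : (Phi @` U) y -> {for y, continuous Psi} by exact: Cn_continuous cPsi0.
have Psiq : Psi (Phi q) = q by rewrite PhiK ?inE.
have nPU : nbhs (Phi q) (Phi @` U) by exact: open_nbhs_nbhs.
have n0 : nbhs (Phi q) (fun y => 0 < `|Psi y|).
  have cn : {for Phi q, continuous (fun y => `|Psi y|)}.
    apply: (@continuous_comp _ _ _ Psi (fun v : V => `|v|)); first exact: cPsi.
    exact: norm_continuous.
  by apply: (continuous_gt_near cn); rewrite Psiq normr_gt0.
have [e e0 He] : exists2 e, 0 < e & forall y, ball (Phi q) e y -> (Phi @` U) y /\ 0 < `|Psi y|.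
  have [e e0 He] := (nbhs_ballP _ _).1 (filterI nPU n0).
  by exists e => // y /He[].
(* The exterior side of the boundary near [q] is the image of a half-ball, hence connected, and it
   avoids the cone structure and the origin. It meets the second fibre, which accumulates at [q] and
   is disjoint from the closure of the first. *)
pose half := [set y | ball (Phi q) e y /\ y 0 i < 0].
have ch : connected half.
  apply: convex_connected => x y s [bx x0] [by0 y0] /andP[s0 s1]; split.
    move: bx by0; rewrite -!ball_normE /= => bx by0.
    have -> : Phi q - (x + s *: (y - x)) = (1 - s) *: (Phi q - x) + s *: (Phi q - y).
      by apply/rowP => j; rewrite !mxE; ring.
    apply: le_lt_trans (ler_normD _ _) _; rewrite !normrZ ger0_norm ?subr_ge0 // ger0_norm //.
    exact: convex_lt.
  rewrite !mxE [X in X < _](_ : _ = (1 - s) * x 0 i + s * y 0 i); last by ring.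
  exact: convex_lt.
have [PN0 hN] : (forall y, half y -> (Phi @` U) y) /\ connected (Psi @` half).
  split; first by move=> y [/He[]].
  apply: connected_continuous_connected ch _.
  by apply: continuous_in_subspaceT => y /set_mem[/He[Py _] _]; exact: cPsi.
have nq : \forall x \near q, U x /\ ball (Phi q) e (Phi x).
  have N1 : nbhs q U by exact: open_nbhs_nbhs.
  have N2 : nbhs q (Phi @^-1` ball (Phi q) e).
    by apply: cPhi; exact: nbhsx_ballx.
  by apply: filterS2 N1 N2.
have half_mem x : U x -> ball (Phi q) e (Phi x) -> defining Phi i x < 0 -> (Psi @` half) x.
  by move=> Ux bx dx; exists (Phi x); rewrite ?PhiK ?inE.
have sub : Psi @` half `<=` fiber A2 p.
  apply: (@clopen_sub R V _ _ (closure (fiber A2 p))) => //.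
  - exact: (fiber_open (LF_domain h2)).
  - have [cq2 _] := cone_closure hk h2 (C2 Cq).
    have [a [Da [Ua ba]]] := cq2 _ nq.
    exists a; split => //; apply: half_mem => //.
    rewrite ltNge; apply/negP => a0.
    have [ca a00] : fiber_closure A1 p a by apply/(hS _ Ua).1.
    have [|Ca] := closure_fiberE ca a00; first by move/disjoint; apply.
    by have [_] := C2 Ca.
  - exact: closed_closure.
  - move=> x [[y [by0 yi] <-] cx].
    have [[u Uu uy] Py] := He _ by0.
    have [|//|] := closure_fiberE cx.
      by move=> E0; rewrite E0 normr0 ltxx in Py.
    rewrite -hC => Cx; have : (fiber_closure A1 p `\` fiber A1 p) (Psi y).
      exact/(fiber_boundaryE hk h1).
    by rewrite -uy PhiK ?inE // => /(hS _ Uu).2; rewrite uy => E; rewrite E ltxx in yi.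
  - exact: subset_closure.
by apply: filterS nq => x [Ux bx] dx; apply: sub; exact: half_mem.
Qed.

Let phi := defining Phi i.

Let dphi : differentiable phi q. Proof. exact: Cn_diff (defining_Cn1 hk hs) Uq. Qed.

Let phiq : phi q = 0.
Proof. by have [_ _ _ hS] := hs; apply/(hS _ Uq).2. Qed.

(** The boundary is conic, so it contains the radial line near [q]. *)
Lemma derive_defining_radial : 'D_q phi q = 0.
Proof.
have [oU _ _ hS] := hs.
apply: (@derive_quotient _ _ _ _ _ _ (fun h => 0)); last exact: cvg_cst.
have N1 := @nbhs_line R V q q _ (open_nbhs_nbhs (conj oU Uq)).
have N2 : \forall h \near (0 : R), `|h| < 1 by exact: nbhs0_lt.
apply: filterS2 N1 N2 => h Uh; rewrite ltr_norml => /andP[h1' _] h0.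
have E : h *: q + q = (h + 1) *: q by rewrite scalerDl scale1r.
have Ch : C (h *: q + q).
  by rewrite E; apply: (cone_conicE hk h1) Cq; rewrite -ltrBlDr sub0r.
have dh : (fiber_closure A1 p `\` fiber A1 p) (h *: q + q) by exact/(fiber_boundaryE hk h1).
by rewrite phiq subr0 [phi _]((hS _ Uh).2.1 dh) scaler0.
Qed.

Lemma fiber_boundary_derive (A : set (tangent M)) (L : tangent M -> R)
    (G : set V) (f : V -> R) u :
  Lorentz_Finsler k A L -> cone_structure A = cone_structure A1 ->
  fiber_extension A L p q G f ->
  'D_u f q = 'D_(inner_normal Phi Psi i q) f q * 'D_u phi q.
Proof.
move=> hL hCA [oG Gq cf fL].
apply: (boundary_derive hk hs Uq u dSq (Cn_diff cf Gq) (open_nbhs_nbhs (conj oG Gq))).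
move=> x Gx /(fiber_boundaryE hk h1); rewrite -hCA => Cx.
by rewrite fL ?(LF_eq0 hL) //; case: Cx.
Qed.

Lemma tangent_case u : 'D_u phi q = 0 -> (forall a, u <> a *: q) -> False.
Proof.
move=> Du uq; have [oU _ _ hS] := hs.
have T1 : tclosure A1 (p, q) by case: Cq.
have T2 : tclosure A2 (p, q) by case: (C2 Cq).
have [U1 [f1 fe1]] := LF_fiber_extension hk h1 T1.
have [U2 [f2 fe2]] := LF_fiber_extension hk h2 T2.
have D1 : 'D_u f1 q = 0 by rewrite (fiber_boundary_derive u h1 _ fe1) // Du mulr0.
have D2 : 'D_u f2 q = 0 by rewrite (fiber_boundary_derive u h2 _ fe2) // Du mulr0.
have H1 := hessian_tangent hk h1 n1 Cq fe1 D1 uq.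
have H2 := hessian_tangent hk h2 n1 (C2 Cq) fe2 D2 uq.
have [oU1 U1q cf1 fL1] := fe1; have [oU2 U2q cf2 fL2] := fe2.
have f1q : f1 q = 0 by rewrite fL1 // (LF_eq0 h1).
have f2q : f2 q = 0 by rewrite fL2 // (LF_eq0 h2) //; exact: C2.
have N1 := second_order_lt0 oU1 U1q cf1 f1q D1 H1.
have N2 := second_order_lt0 oU2 U2q cf2 f2q D2 H2.
have N3 := @nbhs_line R V q u _ (open_nbhs_nbhs (conj oU Uq)).
have N4 := @nbhs_line R V q u _ (open_nbhs_nbhs (conj oU1 U1q)).
have N5 := @nbhs_line R V q u _ (open_nbhs_nbhs (conj oU2 U2q)).
have N6 := @nbhs_line R V q u _ outside_near.
have [e e0 He] := near0_interval
  (filterI (filterI N1 N2) (filterI (filterI N3 N4) (filterI N5 N6))).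
have e2 : 0 < e / 2 by rewrite divr_gt0.
have [|[P1 P2] [[P3 P4] [P5 P6]]] := He (e / 2).
  by rewrite gtr0_norm // ltr_pdivrMr // ltr_pMr // ltr1n.
set x := _ + q in P1 P2 P3 P4 P5 P6.
have nx : ~ fiber_closure A1 p x.
  move=> cx; have Tx := fiber_closure_tclosure cx.
  by have := P1 e2; rewrite (fL1 _ P4 Tx) ltNge (L_ge0 h1 Tx).
(* Off the closure of the first fibre means on the exterior side, which [outside_near] fills with
   vectors of the second fibre; but there [L2] is positive. *)
have phix : phi x < 0.
  by rewrite ltNge; apply/negP => px; apply: nx; apply/(hS _ P3).1.
have x2 := P6 phix; have := P2 e2.
rewrite fL2 //; last exact: (sub_tclosure (LF_domain h2)).
by rewrite ltNge (ltW (LF_gt0 h2 x2)).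
Qed.

(** Here [q] and the inner normal [w] span the fibre. [sector] puts the first fibre in [0 < beta];
    applied to the second fibre with [- w], it gives a common boundary vector with [beta = -1]. This
    vector would have to be a limit of the first fibre. *)
Lemma line_case : (forall u, 'D_u phi q = 0 -> exists a, u = a *: q) -> False.
Proof.
move=> line; have [oU _ _ hS] := hs.
pose w := inner_normal Phi Psi i q.
have Dw : 'D_w phi q = 1 by exact: (derive_inner_normal hk hs Uq).
pose beta x := 'D_x phi q.
have betaD a b x y : beta (a *: x + b *: y) = a * beta x + b * beta y.
  by rewrite /beta !(deriveE _ dphi) linearD !linearZ.
have bE a c : beta (a *: q + c *: w) = c.
  by rewrite betaD /beta derive_defining_radial Dw mulr0 add0r mulr1.
have cb : continuous beta.
  have -> : beta = 'd phi q by apply/funext => x; rewrite /beta deriveE.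
  exact: diff_continuous.
have [j qj] : exists j, q 0 j != 0.
  apply: contrapT => /forallNP nj; move: q0; apply/negP; rewrite negbK; apply/eqP/rowP => j.
  by rewrite mxE; apply/eqP/negPn/negP/nj.
(* The coordinate along [q], read off an entry [j] at which [q] does not vanish. *)
pose alpha (x : V) := (x 0 j - beta x * w 0 j) / q 0 j.
have ca : continuous alpha.
  move=> x; have c1 : (fun y : V => y 0 j : R) @ x --> (x 0 j : R) by exact: coord_continuous.
  have c2 : (fun _ : V => w 0 j) @ x --> w 0 j by exact: (@cst_continuous _ _ (w 0 j)).
  have c3 : (fun _ : V => (q 0 j)^-1) @ x --> (q 0 j)^-1.
    exact: (@cst_continuous _ _ (q 0 j)^-1).
  exact: (cvgM (cvgB c1 (cvgM (cb x) c2)) c3).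
have aE a c : alpha (a *: q + c *: w) = a.
  by rewrite /alpha bE !mxE addrK mulfK.
have xE x : x = alpha x *: q + beta x *: w.
  have [a aq] : exists a, x - beta x *: w = a *: q.
    apply: line; have := betaD 1 (- beta x) x w.
    have bw : beta w = 1 := Dw.
    by rewrite scale1r scaleNr mul1r bw mulr1 subrr.
  have -> : alpha x = a.
    rewrite -{1}[x](subrK (beta x *: w)) aq; exact: aE.
  by rewrite -aq subrK.
have S1 : (forall x, fiber A1 p x -> 0 < beta x) /\ exists s, C (s *: q + w).
  apply: (sector hk h1 n1 ca cb xE aE bE Cq).
  have Dw0 : 0 < 'D_w phi q by rewrite Dw.
  have [e e0 He] := near0_interval (inward_near hk hs Uq dSq Dw0).
  have e2 : 0 < e / 2 by rewrite divr_gt0.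
  exists (e / 2) => // t /andP[t0 te].
  have [|cx nx] := He t _ t0.
    by rewrite gtr0_norm //; apply: le_lt_trans te _; rewrite ltr_pdivrMr // ltr_pMr // ltr1n.
  by apply: contrapT => nDx; apply: nx.
have [s Cs] : exists s, C (s *: q + (- w)).
  suff [_] : (forall x, fiber A2 p x -> 0 < - beta x) /\
      exists s, cone_structure A2 (p, s *: q + (- w)).
    by case=> s Cs; exists s; rewrite /C hC.
  apply: (@sector _ _ _ _ _ _ hk h2 n1 p q (- w) alpha (fun x => - beta x)) => //.
  - by move=> x; exact: cvgN (cb x).
  - by move=> x; rewrite scalerN scaleNr opprK -xE.
  - by move=> a c; rewrite scalerN -scaleNr aE.
  - by move=> a c; rewrite scalerN -scaleNr bE opprK.
  - exact: C2.
  have DN : 'D_(- w) phi q < 0 by rewrite (deriveE _ dphi) linearN -(deriveE _ dphi) Dw oppr_lt0.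
  have N1 := outward_near hk hs Uq dSq DN.
  have N2 := @nbhs_line R V q (- w) _ (open_nbhs_nbhs (conj oU Uq)).
  have N3 := @nbhs_line R V q (- w) _ outside_near.
  have [e e0 He] := near0_interval (filterI N1 (filterI N2 N3)).
  have e2 : 0 < e / 2 by rewrite divr_gt0.
  exists (e / 2) => // t /andP[t0 te].
  have [|P1 [P2 P3]] := He t.
    by rewrite gtr0_norm //; apply: le_lt_trans te _; rewrite ltr_pdivrMr // ltr_pMr // ltr1n.
  apply: P3; rewrite ltNge; apply/negP => px; apply: (P1 t0).
  exact/(hS _ P2).1.
have [cs _] := cone_closure hk h1 Cs.
have : 0 <= beta (s *: q - w).
  have clB : closed [set x | 0 <= beta x].
    by apply: preimage_closed (@closed_ge R 0) => x _; exact: cb.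
  by apply: clB; apply: closureS cs => x /S1.1 /ltW.
by rewrite -scaleN1r bE oppr_ge0 leNgt ltr01.
Qed.

End SameCone.

Section ConesEqual.
Variables (R : realType) (n : nat) (k : option nat) (M : manifold R n (omap S k)).
Hypotheses (hk : reg_ge2 k) (n1 : (1 < n)%N).
Variables (A1 A2 : set (tangent M)) (L1 L2 : tangent M -> R).
Hypotheses (h1 : Lorentz_Finsler k A1 L1) (h2 : Lorentz_Finsler k A2 L2).
Hypothesis hC : cone_structure A1 = cone_structure A2.

Lemma fibers_meet p : fiber A1 p `&` fiber A2 p !=set0.
Proof.
apply/set0P/negP => /eqP h12.
have [q Cq] := cone_inhabited n1 h1 h2 h12.
have [U [Phi [Psi [i [[oU Uq] a b c]]]]] := LF_fiber_boundary h1 (cone_closure hk h1 Cq).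
have hs : straightening (fiber_closure A1 p) (fiber_closure A1 p `\` fiber A1 p)
  U Phi Psi i k by [].
have [[u [Du uq]]|nu] := pselect (exists u, 'D_u (defining Phi i) q = 0 /\ forall a, u <> a *: q).
  exact: (tangent_case hk n1 h1 h2 hC h12 Cq hs Uq Du uq).
apply: (line_case hk n1 h1 h2 hC h12 Cq hs Uq) => u Du.
by apply: contrapT => /forallNP na; apply: nu; exists u.
Qed.

Lemma cone_domains_eq : A1 = A2.
Proof.
apply/seteqP; split => -[p v] Av.
  by apply: (fiber_sub_of_meet h1 h2 hC (fibers_meet p)).
apply: (fiber_sub_of_meet h2 h1 (esym hC) _) Av.
by rewrite setIC; exact: fibers_meet.
Qed.

End ConesEqual.

(** * Hadamard division *)

Section UnitIntegral.
Variable R : realType.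
Implicit Types f g F : R -> R.

Definition unit_int f : R := \int[lebesgue_measure]_(s in `[0%R, 1%R]) f s.

Definition unit_continuous f : Prop := forall s, 0 <= s <= 1 -> {for s, continuous f}.

Lemma unit_integrable f : unit_continuous f ->
  lebesgue_measure.-integrable `[0%R, 1%R] (EFin \o f).
Proof.
move=> cf; apply: continuous_compact_integrable; first exact: segment_compact.
by apply: continuous_in_subspaceT => s; rewrite inE /= in_itv /=; exact: cf.
Qed.

Lemma unit_intP a f g : unit_continuous f -> unit_continuous g ->
  unit_int (fun s => a * f s + g s) = a * unit_int f + unit_int g.
Proof.
move=> cf cg.
have caf : unit_continuous (fun s => a * f s).
  move=> s /cf cs; have c2 : (fun _ : R => a) @ s --> a by exact: (@cst_continuous _ _ a).
  exact: (cvgM c2 cs).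
rewrite /unit_int RintegralD //; [|exact: unit_integrable|exact: unit_integrable].
by rewrite RintegralZl //; exact: unit_integrable.
Qed.

Lemma unit_int_cst a : unit_int (fun=> a) = a.
Proof.
rewrite /unit_int Rintegral_cst //.
rewrite [X in fine X](_ : _ = 1%E) ?mulr1 //.
apply: etrans (lebesgue_measure_itv _) _.
by rewrite /= lte_fin ltr01 oppr0 adde0.
Qed.

Lemma eq_unit_int f g : (forall s, 0 <= s <= 1 -> f s = g s) -> unit_int f = unit_int g.
Proof.
move=> fg; apply: eq_Rintegral => s; rewrite inE /= in_itv /=; exact: fg.
Qed.

Lemma unit_int_le f a : unit_continuous f ->
  (forall s, 0 <= s <= 1 -> `|f s| <= a) -> `|unit_int f| <= a.
Proof.
move=> cf fa; have fi := unit_integrable cf.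
have ca : lebesgue_measure.-integrable `[0%R, 1%R] (EFin \o (fun=> a : R)).
  by apply: unit_integrable => s _; exact: cst_continuous.
apply: le_trans (le_normr_Rintegral _ fi) _ => //.
rewrite -[leRHS]unit_int_cst; apply: le_Rintegral => //.
exact: integrable_norm.
Qed.

Lemma unit_int_FTC F f : unit_continuous f ->
  (forall s : R, 0 <= s <= 1 -> is_derive s 1 F (f s)) -> unit_int f = F 1 - F 0.
Proof.
move=> cf dF.
have cF (s : R) : 0 <= s <= 1 -> F @ s --> F s.
  move=> /dF[d _]; apply: differentiable_continuous; exact/derivable1_diffP.
have e0 : 0 <= (0 : R) <= 1 by rewrite lexx ler01.
have e1 : 0 <= (1 : R) <= 1 by rewrite lexx ler01.
rewrite /unit_int /Rintegral (@continuous_FTC2 R f F 0 1) //.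
- by apply: continuous_in_subspaceT => s; rewrite inE /= in_itv /=; exact: cf.
- split.
  + move=> s; rewrite in_itv /= => /andP[s0 s1].
    by have [] := dF s; rewrite ?ltW.
  + by apply: cvg_at_right_filter; exact: cF.
  + by apply: cvg_at_left_filter; exact: cF.
- move=> s; rewrite in_itv /= => /andP[s0 s1].
  have s01 : 0 <= s <= 1 by rewrite !ltW.
  by rewrite derive1E; case: (dF s s01).
Qed.

End UnitIntegral.

Section Hadamard.
Variables (R : realType) (m : nat) (i : 'I_m).
Local Notation V := 'rV[R]_m.

Lemma entry_le_norm (h : V) j : `|h 0 j| <= `|h|.
Proof.
rewrite -[leRHS]/(mx_norm h) mx_normrE.
exact: (le_bigmax _ (fun ij : 'I_1 * 'I_m => `|h ij.1 ij.2|) (0, j)).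
Qed.

Definition axis (y : V) : V := y 0 i *: 'e_i.

(** Multiplies the i-th entry by [s]. The affine form makes the derivative along [squeeze s v] split
    into those along [v] and along [axis v]. *)
Definition squeeze (s : R) (y : V) : V := y + (s - 1) *: axis y.

Lemma squeezeE s y j : squeeze s y 0 j = if j == i then s * y 0 j else y 0 j.
Proof.
rewrite /squeeze /axis !mxE eqxx /=; case: eqP => [->|_] /=; first by ring.
by rewrite mulr0 mulr0 addr0.
Qed.

Lemma squeeze1 y : squeeze 1 y = y.
Proof. by rewrite /squeeze subrr scale0r addr0. Qed.

Lemma squeeze0 y : squeeze 0 y 0 i = 0.
Proof. by rewrite squeezeE eqxx mul0r. Qed.

Lemma squeezeP s a y z : squeeze s (a *: y + z) = a *: squeeze s y + squeeze s z.
Proof.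
apply/rowP => j; transitivity (a * squeeze s y 0 j + squeeze s z 0 j); last by rewrite !mxE.
by rewrite !squeezeE !mxE; case: ifP => _; ring.
Qed.

Lemma squeeze_entry_le s y j : 0 <= s <= 1 -> `|squeeze s y 0 j| <= `|y|.
Proof.
move=> /andP[s0 s1]; rewrite squeezeE; case: ifP => _; last exact: entry_le_norm.
rewrite normrM ger0_norm //; apply: le_trans (entry_le_norm y j).
by rewrite ler_piMl.
Qed.

Lemma squeeze_continuous : continuous (fun sy : R * V => squeeze sy.1 sy.2).
Proof.
move=> sy.
have c1 : {for sy, continuous (snd : R * V -> V)} by exact: cvg_snd.
have c2 : {for sy, continuous (fun z : R * V => z.1 - 1)}.
  have d1 : {for sy, continuous (fst : R * V -> R)} by exact: cvg_fst.
  have d2 : {for sy, continuous (fun _ : R * V => 1 : R)} by exact: cst_continuous.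
  exact: (cvgB d1 d2).
have c3 : {for sy, continuous (fun z : R * V => axis z.2)}.
  have d1 : {for sy, continuous ((@entry R m i) \o (snd : R * V -> V))}.
    exact: (@continuous_comp _ _ _ (snd : R * V -> V) (@entry R m i) sy c1
      (@entry_continuous R m i sy.2)).
  have d2 : {for sy, continuous (fun _ : R * V => 'e_i : V)} by exact: cst_continuous.
  exact: (cvgZ d1 d2).
exact: (cvgD c1 (cvgZ c2 c3)).
Qed.

Variable B : set V.
Hypotheses (oB : open B) (starB : forall (s : R) y, 0 <= s <= 1 -> B y -> B (squeeze s y)).

(** The weight makes the family stable under differentiation: a derivative in [y] brings out the
    factor [s - 1], which the induction on the order absorbs into [w]. *)
Definition averaging (w : R -> R) (G : V -> R) (y : V) : R :=
  unit_int (fun s => w s * G (squeeze s y)).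

Lemma squeeze_left_continuous y : continuous (fun s : R => squeeze s y).
Proof.
move=> s; have c1 : {for s, continuous (fun t : R => (t, y) : R * V)}.
  have d1 : {for s, continuous (fun t : R => t)} by exact: cvg_id.
  have d2 : {for s, continuous (fun _ : R => y)} by exact: cst_continuous.
  exact: (cvg_pair d1 d2).
exact: (@continuous_comp _ _ _ (fun t : R => (t, y) : R * V)
  (fun sy : R * V => squeeze sy.1 sy.2) s c1 (@squeeze_continuous (s, y))).
Qed.

Lemma integrand_continuous (w : R -> R) (G : V -> R) (y : V) : continuous w -> Cn 0 B G -> B y ->
  unit_continuous (fun s => w s * G (squeeze s y)).
Proof.
move=> cw cG By s s01.
have c1 : {for s, continuous (fun t : R => G (squeeze t y))}.
  apply: (@continuous_comp _ _ _ (fun t : R => squeeze t y) G).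
    exact: squeeze_left_continuous.
  by apply: (Cn_continuous cG); exact: starB.
exact: (cvgM (cw s) c1).
Qed.

(** By compactness of [0, 1], one neighbourhood of [y] serves all [s]. *)
Lemma near_uniform (h : R * V -> R) (y : V) (e : R) : 0 < e ->
  (forall s : R, 0 <= s <= 1 -> {for (s, y), continuous h}) ->
  \forall z \near y, forall s : R, 0 <= s <= 1 -> `|h (s, z) - h (s, y)| <= e.
Proof.
move=> e0 ch; have e2 : 0 < e / 2 by rewrite divr_gt0.
have cov := (compact_near_coveringP _).1 (@segment_compact R 0 1).
have H : \forall z \near y, `[(0 : R), 1]%classic `<=` [set s | `|h (s, z) - h (s, y)| <= e].
  apply: (cov _ (nbhs y) (fun z s => `|h (s, z) - h (s, y)| <= e) (nbhs_filter y)) => s.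
  rewrite /= in_itv /= => /ch cs.
  have Nb : nbhs (s, y) (h @^-1` ball (h (s, y)) (e / 2)) by apply: cs; exact: nbhsx_ballx.
  case: Nb => -[N1 N2] /= [N1s N2y] N12.
  exists (N1, N2) => //= -[s' z] /= [N1s' N2z].
  have H1 : ball (h (s, y)) (e / 2) (h (s', z)) by exact: (N12 (s', z)).
  have H2 : ball (h (s, y)) (e / 2) (h (s', y)).
    by apply: (N12 (s', y)); split => //; exact: nbhs_singleton.
  move: H1 H2; rewrite /ball /= => H1 H2.
  have -> : h (s', z) - h (s', y) = (h (s, y) - h (s', y)) - (h (s, y) - h (s', z)) by ring.
  by apply: le_trans (ler_normB _ _) _; rewrite (splitr e) lerD // ltW.
by apply: filterS H => z Hz s s01; apply: Hz; rewrite /= in_itv.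
Qed.

Lemma joint_continuous (G : V -> R) (y : V) (s : R) : Cn 0 B G -> B y -> 0 <= s <= 1 ->
  {for (s, y), continuous (fun sy : R * V => G (squeeze sy.1 sy.2))}.
Proof.
move=> cG By s01.
apply: (@continuous_comp _ _ _ (fun sy : R * V => squeeze sy.1 sy.2) G).
  exact: squeeze_continuous.
by apply: (Cn_continuous cG); exact: starB.
Qed.

Lemma averaging_continuous (w : R -> R) (G : V -> R) :
  continuous w -> Cn 0 B G -> Cn 0 B (averaging w G).
Proof.
move=> cw cG y By.
have FF := nbhs_filter y.
apply/cvgrPdist_le => e e0.
have NB : nbhs y B by exact: open_nbhs_nbhs.
pose h (sy : R * V) := w sy.1 * G (squeeze sy.1 sy.2).
have ch (s : R) : 0 <= s <= 1 -> {for (s, y), continuous h}.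
  move=> s01; have c1 : {for (s, y), continuous (w \o (fst : R * V -> R))}.
    by apply: continuous_comp; [exact: cvg_fst|exact: cw].
  exact: (cvgM c1 (joint_continuous cG By s01)).
apply: filterS2 NB (near_uniform e0 ch) => z Bz Hz.
have -> : averaging w G y - averaging w G z =
    unit_int (fun s => -1 * h (s, z) + h (s, y)).
  rewrite unit_intP; [|exact: integrand_continuous|exact: integrand_continuous].
  by rewrite mulN1r addrC.
apply: unit_int_le.
  move=> s s01.
  have c1 := integrand_continuous cw cG Bz s01.
  have c2 := integrand_continuous cw cG By s01.
  have c3 : (fun _ : R => -1 : R) @ s --> (-1 : R) by exact: (@cst_continuous _ _ (-1 : R)).
  exact: (cvgD (cvgM c3 c1) c2).
by move=> s s01; rewrite mulN1r addrC distrC; exact: Hz.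
Qed.

Lemma rowvec_linear_continuous (f : {linear V -> R}) : continuous f.
Proof.
have [_ hl] := @frame_rowvec R m.
have -> : f = (fun h => \sum_j h 0 j * f 'e_j) :> (V -> R).
  by apply/funext => h; rewrite {1}(hl h) linear_sum; apply: eq_bigr => j _; rewrite linearZ.
move=> h; apply: continuous_sum => j.
have c1 : {for h, continuous (fun x : V => x 0 j : R)} by exact: coord_continuous.
have c2 : {for h, continuous (fun _ : V => f 'e_j)} by exact: cst_continuous.
exact: (cvgM c1 c2).
Qed.

Lemma directional_continuous (w : R -> R) (G : V -> R) (y h : V) :
  continuous w -> Cn 1 B G -> B y ->
  unit_continuous (fun s => w s * 'D_(squeeze s h) G (squeeze s y)).
Proof.
move=> cw cG By s s01.
have c1 : {for s, continuous (fun t : R => (squeeze t y, squeeze t h) : V * V)}.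
  exact: (cvg_pair (@squeeze_left_continuous y s) (@squeeze_left_continuous h s)).
have c2 := @derive_pair_continuous R _ _ G B (squeeze s y, squeeze s h) oB cG (starB s01 By).
have c3 := @continuous_comp _ _ _ (fun t : R => (squeeze t y, squeeze t h) : V * V)
  (fun z => 'D_(z.2) G z.1) s c1 c2.
exact: (cvgM (cw s) c3).
Qed.

(** Differentiation under the integral sign. For each [s], the mean value theorem turns the error
    into a combination of increments of partial derivatives of [G], which [near_uniform] bounds
    uniformly in [s]. *)
Lemma averaging_differentiable (w : R -> R) (G : V -> R) (y : V) :
  continuous w -> Cn 1 B G -> B y ->
  differentiable (averaging w G) y /\
  forall v, 'D_v (averaging w G) y =
    unit_int (fun s => w s * 'D_(squeeze s v) G (squeeze s y)).
Proof.
move=> cw cG By.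
pose df0 (h : V) := unit_int (fun s => w s * 'D_(squeeze s h) G (squeeze s y)).
have dG (s : R) : 0 <= s <= 1 -> differentiable G (squeeze s y).
  by move=> s01; apply: (Cn_diff cG); exact: starB.
have lin : linear df0.
  move=> a u v; rewrite /df0 -unit_intP;
      [|exact: directional_continuous|exact: directional_continuous].
  apply: eq_unit_int => s s01; rewrite squeezeP !(deriveE _ (dG s s01)) linearP /=.
  by rewrite mulrDr mulrCA.
pose df : {linear V -> R} := HB.pack df0 (GRing.isLinear.Build _ _ _ _ _ lin).
have cdf : continuous df by exact: rowvec_linear_continuous.
suff H : forall e, 0 < e -> \forall h \near (0 : V),
    `|averaging w G (h + y) - averaging w G y - df h| <= e * `|h|.
  have [D E] := differentiable_approx cdf H; split => // v.
  by rewrite (deriveE _ D) E.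
(* Each of the [m] partial derivatives contributes at most [e'] times the norm of [h]; the
   denominator [m + 1] is visibly positive. *)
move=> e e0; pose e' := e / (m.+1)%:R.
have e'0 : 0 < e' by rewrite divr_gt0.
pose hj j (sz : R * V) := w sz.1 * 'D_('e_j) G (squeeze sz.1 sz.2).
have chj j (s : R) : 0 <= s <= 1 -> {for (s, y), continuous (hj j)}.
  move=> s01; have c1 : {for (s, y), continuous (w \o (fst : R * V -> R))}.
    by apply: continuous_comp; [exact: cvg_fst|exact: cw].
  exact: (cvgM c1 (joint_continuous (Cn_derive 'e_j cG) By s01)).
have N1 : \forall z \near y, forall j (s : R), 0 <= s <= 1 ->
    `|hj j (s, z) - hj j (s, y)| <= e'.
  have N j := near_uniform e'0 (chj j).
  exact: (@filter_forall V 'I_m (fun j => [set z | forall s : R, 0 <= s <= 1 ->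
    `|hj j (s, z) - hj j (s, y)| <= e']) (nbhs y) (nbhs_filter y) N).
have NB : nbhs y B by exact: open_nbhs_nbhs.
have [d d0 Hd] := (nbhs_ballP _ _).1 (filterI N1 NB).
have N0 : \forall h \near (0 : V), `|h| < d by exact: nbhs0_lt.
apply: filterS N0 => h hd.
have Hball (t : R) : 0 <= t <= 1 -> ball y d (t *: h + y).
  move=> /andP[t0 t1]; rewrite -ball_normE /= opprD addrCA subrr addr0 normrN normrZ.
  by apply: le_lt_trans hd; rewrite ger0_norm // ler_piMl.
have Bt (t : R) : 0 <= t <= 1 -> B (t *: h + y) by move=> /Hball /Hd[].
have t1 : 0 <= (1 : R) <= 1 by rewrite lexx ler01.
have Bhy : B (h + y) by have := Bt 1 t1; rewrite scale1r.
pose f (s : R) := w s * G (squeeze s (h + y)) - w s * G (squeeze s y)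
  - w s * 'D_(squeeze s h) G (squeeze s y).
have cN1 : unit_continuous (fun s => w s * G (squeeze s (h + y))).
  exact: (integrand_continuous cw (Cn_pred cG) Bhy).
have cN2 := integrand_continuous cw (Cn_pred cG) By.
have cN3 := @directional_continuous w G y h cw cG By.
have cN4 : unit_continuous (fun s => -1 * (w s * G (squeeze s y)) + w s * G (squeeze s (h + y))).
  move=> s s01; have c3 : (fun _ : R => -1 : R) @ s --> (-1 : R).
    exact: (@cst_continuous _ _ (-1 : R)).
  exact: (cvgD (cvgM c3 (cN2 s s01)) (cN1 s s01)).
have cf : unit_continuous f.
  by move=> s s01; exact: (cvgB (cvgB (cN1 s s01) (cN2 s s01)) (cN3 s s01)).
have -> : averaging w G (h + y) - averaging w G y - df h = unit_int f.
  transitivity (-1 * df h + unit_int (fun s => -1 * (w s * G (squeeze s y)) +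
      w s * G (squeeze s (h + y)))).
    rewrite unit_intP // -/(averaging w G (h + y)) -/(averaging w G y).
    by set a1 := averaging _ _ _; set a2 := averaging _ _ _; set a3 := df h; ring.
  rewrite -unit_intP //; apply: eq_unit_int => s _; rewrite /f; ring.
apply: unit_int_le => // s s01.
have dl (t : R) : 0 <= t <= 1 -> is_derive t 1
    (fun t => G (t *: squeeze s h + squeeze s y))
    ('D_(squeeze s h) G (t *: squeeze s h + squeeze s y)).
  move=> t01; apply: is_derive_line; rewrite -squeezeP.
  by apply: (Cn_diff cG); apply: starB => //; exact: Bt.
have [c /andP[c0 c1] E] := is_derive_MVT_on (@ltr01 R) dl.
have c01 : 0 <= c <= 1 by rewrite !ltW.
move: E; rewrite scale1r scale0r add0r subr0 mulr1 -!squeezeP => E.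
have Esh : squeeze s h + squeeze s y = squeeze s (h + y).
  by have := squeezeP s 1 h y; rewrite !scale1r.
rewrite Esh in E.
have dc : differentiable G (squeeze s (c *: h + y)).
  by apply: (Cn_diff cG); apply: starB => //; exact: Bt.
have [_ hl] := @frame_rowvec R m.
have sumD x : differentiable G x ->
    'D_(squeeze s h) G x = \sum_j squeeze s h 0 j * 'D_('e_j) G x.
  move=> dx; rewrite (deriveE _ dx) [LHS](congr1 ('d G x) (hl _)) linear_sum.
  by apply: eq_bigr => j _; rewrite linearZ (deriveE _ dx).
have -> : f s = \sum_j squeeze s h 0 j * (hj j (s, c *: h + y) - hj j (s, y)).
  rewrite /f -mulrBr E -mulrBr (sumD _ dc) (sumD _ (dG s s01)) -sumrB mulr_sumr.
  by apply: eq_bigr => j _; rewrite /hj /=; ring.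
apply: le_trans (ler_norm_sum _ _ _) _.
apply: (@le_trans _ _ (\sum_(j < m) e' * `|h|)).
  apply: ler_sum => j _; rewrite normrM mulrC ler_pM //; last exact: squeeze_entry_le.
  by apply: (Hd _ (Hball _ c01)).1.
rewrite sumr_const card_ord -mulr_natr mulrAC ler_wpM2r // /e'.
rewrite mulrAC ler_pdivrMr ?ltr0n //.
by apply: ler_wpM2l; [exact: ltW|rewrite ler_nat].
Qed.

Lemma derive_averaging (w : R -> R) (G : V -> R) (y v : V) :
  continuous w -> Cn 1 B G -> B y ->
  'D_v (averaging w G) y = averaging w ('D_v G) y +
    averaging (fun s => w s * (s - 1)) ('D_(axis v) G) y.
Proof.
move=> cw cG By; rewrite (averaging_differentiable cw cG By).2.
have cw' : continuous (fun s => w s * (s - 1)).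
  move=> s; have c1 : {for s, continuous (fun t : R => t)} by exact: cvg_id.
  have c2 : {for s, continuous (fun _ : R => 1 : R)} by exact: cst_continuous.
  exact: (cvgM (cw s) (cvgB c1 c2)).
rewrite /averaging -[X in X + _]mul1r -unit_intP;
  [|exact: (integrand_continuous cw (Cn_derive v cG) By)
   |exact: (integrand_continuous cw' (Cn_derive (axis v) cG) By)].
apply: eq_unit_int => s s01; have d := Cn_diff cG (starB s01 By).
have E : 'd G (squeeze s y) (squeeze s v) =
    'd G (squeeze s y) v + (s - 1) * 'd G (squeeze s y) (axis v).
  by apply: etrans (linearD _ _ _) _; congr (_ + _); exact: linearZ.
by rewrite !(deriveE _ d) E; ring.
Qed.

Lemma Cn_averaging k (w : R -> R) (G : V -> R) :
  continuous w -> Cn k B G -> Cn k B (averaging w G).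
Proof.
elim: k w G => [|k IH] w G cw cG; first exact: averaging_continuous.
have cG1 : Cn 1 B G by exact: Cn_le cG.
have cw' : continuous (fun s => w s * (s - 1)).
  move=> s; have c1 : {for s, continuous (fun t : R => t)} by exact: cvg_id.
  have c2 : {for s, continuous (fun _ : R => 1 : R)} by exact: cst_continuous.
  exact: (cvgM (cw s) (cvgB c1 c2)).
split => [y By|v]; first exact: (averaging_differentiable cw cG1 By).1.
have c1 := IH w ('D_v G) cw (Cn_derive v cG).
have c2 := IH _ ('D_(axis v) G) cw' (Cn_derive (axis v) cG).
apply: (Cn_eq oB _ (CnD oB c1 c2)) => y /set_mem By.
by rewrite derive_averaging.
Qed.

Lemma averaging_fixed (G : V -> R) (y : V) : y 0 i = 0 -> averaging (fun=> 1) G y = G y.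
Proof.
move=> y0; rewrite /averaging -[RHS]unit_int_cst; apply: eq_unit_int => s _.
by rewrite /squeeze /axis y0 scale0r scaler0 addr0 mul1r.
Qed.

(** The derivative of [s |-> G (squeeze s y)] is integrated from [squeeze 0 y], on the hyperplane
    where [G] vanishes, to [y]; the chain rule brings out the factor [y 0 i]. *)
Lemma hadamard (G : V -> R) (y : V) : Cn 1 B G ->
  (forall z, B z -> z 0 i = 0 -> G z = 0) -> B y ->
  G y = y 0 i * averaging (fun=> 1) ('D_('e_i) G) y.
Proof.
move=> cG G0 By.
have s0 : 0 <= (0 : R) <= 1 by rewrite lexx ler01.
have c1 : continuous (fun _ : R => 1 : R) by exact: cst_continuous.
have cI := integrand_continuous c1 (Cn_derive 'e_i cG) By.
(* The summand 0 gives the integrand the shape required by [unit_intP]. *)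
transitivity (unit_int (fun s => y 0 i * (1 * 'D_('e_i) G (squeeze s y)) + 0)); last first.
  rewrite unit_intP // ?unit_int_cst ?addr0 // => s _; exact: cst_continuous.
have dF (s : R) : 0 <= s <= 1 -> is_derive s 1 (fun s => G (squeeze s y))
    (y 0 i * (1 * 'D_('e_i) G (squeeze s y)) + 0).
  move=> s01; have d := Cn_diff cG (starB s01 By).
  have E t : squeeze t y = t *: axis y + (y - axis y).
    by rewrite /squeeze scalerBl scale1r addrCA.
  have EF : (fun t => G (squeeze t y)) = (fun t => G (t *: axis y + (y - axis y))).
    by apply/funext => t; rewrite E.
  have dE : 'D_(axis y) G (squeeze s y) = y 0 i * (1 * 'D_('e_i) G (squeeze s y)) + 0.
    rewrite addr0 mul1r !(deriveE _ d); exact: linearZ.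
  by rewrite EF -dE E; apply: is_derive_line; rewrite -E.
rewrite (unit_int_FTC _ dF).
  by rewrite squeeze1 (G0 (squeeze 0 y)) ?subr0 ?squeeze0 //; exact: starB.
move=> s s01; have c2 : {for s, continuous (fun _ : R => y 0 i)} by exact: cst_continuous.
have c3 : {for s, continuous (fun _ : R => 0 : R)} by exact: cst_continuous.
exact: (cvgD (cvgM c2 (cI s s01)) c3).
Qed.

End Hadamard.

(** * The anisotropic factor *)

Section SqueezeNorm.
Variables (R : realType) (m : nat) (i : 'I_m).

Lemma squeeze_norm_le (s : R) (y : 'rV[R]_m) : 0 <= s <= 1 -> `|squeeze i s y| <= `|y|.
Proof.
move=> s01; rewrite -[leLHS]/(mx_norm (squeeze i s y)) mx_normrE.
apply: bigmax_le => // -[j0 j] _ /=; rewrite ord1; exact: squeeze_entry_le.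
Qed.

Lemma squeeze_ball (b y : 'rV[R]_m) (e s : R) : b 0 i = 0 -> 0 <= s <= 1 ->
  ball b e y -> ball b e (squeeze i s y).
Proof.
move=> bi s01; rewrite -!ball_normE /= => bye.
have -> : b - squeeze i s y = squeeze i s (b - y).
  have -> : b - y = -1 *: y + b by rewrite scaleN1r addrC.
  by rewrite squeezeP scaleN1r addrC {3}/squeeze /axis bi scale0r scaler0 addr0.
exact: le_lt_trans (squeeze_norm_le _ s01) bye.
Qed.

End SqueezeNorm.

(** Reduces finite and infinite classes alike to one finite order at a time, with the loss of one
    derivative expressed by [reg_le j.+1 k]. *)
Lemma Ck_predn (R : realType) (V W : normedModType R) (k : option nat) (U : set V) (f : V -> W) :
  reg_ge2 k ->
  (forall j, reg_le j.+1 k -> Cn j U f) ->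
  Ck (omap predn k) U f.
Proof. by case: k => [[|l]|] //= _ H; [exact: H|move=> j; exact: H]. Qed.

Section Factor.
Variables (R : realType) (n : nat) (k : option nat) (M : manifold R n (omap S k)).
Local Notation E := ('rV[R]_n * 'rV[R]_n)%type.
Local Notation V2 := 'rV[R]_(n + n).
Hypothesis (hk : reg_ge2 k).
Implicit Types (c : chart M) (p : M) (z : E).

Let frameE : exists e (l : 'I_(n + n) -> {linear E -> R}), frame e l.
Proof. exact: frame_pair (@frame_rowvec R n) (@frame_rowvec R n). Qed.

Section NormalDerivative.
Variables (A : set (tangent M)) (L : tangent M -> R).
Hypothesis (hL : Lorentz_Finsler k A L).
Variables (c : chart M) (z : E) (U : set E) (Phi : E -> V2) (Psi : V2 -> E) (i : 'I_(n + n)).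
Hypothesis (cz : tcod c z).
Hypothesis hs : straightening (tcod c `&` tparam c @^-1` tclosure A)
  (tcod c `&` tparam c @^-1` cone_structure A) U Phi Psi i k.
Hypotheses (Uz : U z) (Cz : cone_structure A (tparam c z)).
Variables (UF : set E) (F : E -> R).
Hypotheses (hF : chart_extension A L c z UF F) (cF : Ck k UF F).

Let cF2 : Cn 2 UF F. Proof. exact: (Ck2 hk cF). Qed.

Lemma chart_boundary_derive u :
  'D_u F z = 'D_(inner_normal Phi Psi i z) F z * 'D_u (defining Phi i) z.
Proof.
have [oUF UFz FL] := hF.
apply: (boundary_derive hk hs Uz u (conj cz Cz) (Cn_diff cF2 UFz)
  (open_nbhs_nbhs (conj oUF UFz))).
move=> y Uy [cy Cy]; rewrite FL //; last by case: Cy.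
exact: (LF_eq0 hL Cy).
Qed.

Lemma normal_derive_neq0 : 'D_(inner_normal Phi Psi i z) F z != 0.
Proof.
have Tz : tclosure A ((tparam c z).1, (tparam c z).2) by case: Cz.
have [w Dw] := chart_extension_regular hL cz hF cF2 (tclosure_fiber hk hL Tz).
by apply: contra_neq Dw => D0; rewrite chart_boundary_derive D0 mul0r.
Qed.

Let PsiPhi : Psi (Phi z) = z.
Proof. by have [_ [_ PhiK] _ _] := hs; rewrite PhiK ?inE. Qed.

Let oPU : open (Phi @` U). Proof. by have [_ [oPU _] _ _] := hs. Qed.

Let PUz : (Phi @` U) (Phi z). Proof. by exists z. Qed.

Let dPsi : differentiable Psi (Phi z).
Proof.
have [_ _ [_ cPsi] _] := hs.
have c1 : Cn 1 (Phi @` U) Psi by apply: Ck_Cn cPsi; case: (k) hk => [[|j]|].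
exact: (Cn_diff c1 PUz).
Qed.

Let dF : differentiable F (Psi (Phi z)).
Proof. by rewrite PsiPhi; have [_ UFz _] := hF; exact: Cn_diff cF2 UFz. Qed.

Lemma derive_straightened :
  'D_('e_i) (F \o Psi) (Phi z) = 'D_(inner_normal Phi Psi i z) F z.
Proof.
have dc := differentiable_comp dPsi dF.
have E1 : 'd (F \o Psi) (Phi z) 'e_i = 'd F (Psi (Phi z)) ('d Psi (Phi z) 'e_i).
  by have := diff_comp dPsi dF; move/(congr1 (fun h : _ -> _ => h 'e_i)).
apply: etrans (deriveE _ dc) _; apply: etrans E1 _.
rewrite -(deriveE _ dPsi) -(deriveE _ dF) PsiPhi.
by [].
Qed.

Let Phizi : Phi z 0 i = 0.
Proof. by have [_ _ _ hS] := hs; apply/(hS _ Uz).2; split. Qed.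

Let line_entry (t : R) : (t *: 'e_i + Phi z) 0 i = t.
Proof. by rewrite !mxE Phizi !eqxx mulr1 addr0. Qed.

Lemma line_straightened : \forall t \near (0 : R), 0 < t ->
  [/\ UF (Psi (t *: 'e_i + Phi z)), tcod c (Psi (t *: 'e_i + Phi z))
    & A (tparam c (Psi (t *: 'e_i + Phi z)))].
Proof.
have [oU _ _ hS] := hs; have [oUF UFz FL] := hF.
have N1 := @nbhs_line R _ (Phi z) 'e_i _ (open_nbhs_nbhs (conj oPU PUz)).
have nUF : nbhs (Phi z) (Psi @^-1` UF).
  by apply: (differentiable_continuous dPsi); rewrite PsiPhi; exact: open_nbhs_nbhs.
have N2 := @nbhs_line R _ (Phi z) 'e_i _ nUF.
apply: filterS2 N1 N2 => t P1 P2 t0.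
have [Uy Py] := PsiP hs P1.
have [] : ((tcod c `&` tparam c @^-1` tclosure A) (Psi (t *: 'e_i + Phi z))).
  by apply/(hS _ Uy).1; rewrite Py line_entry ltW.
move=> cy Ty; split => //; apply: (tclosureE Ty) => Cy.
have : Phi (Psi (t *: 'e_i + Phi z)) 0 i = 0 by apply/(hS _ Uy).2; split.
by rewrite Py line_entry => E0; rewrite E0 ltxx in t0.
Qed.

(** The derivative is non-zero by transversality; were it negative, the metric would be negative at
    vectors of [A] just inside the boundary. *)
Lemma normal_derive_gt0 : 0 < 'D_(inner_normal Phi Psi i z) F z.
Proof.
rewrite lt_neqAle eq_sym normal_derive_neq0 /= leNgt; apply/negP.
rewrite -derive_straightened => Dlt.
have dc := differentiable_comp dPsi dF.
have N1 : \forall t \near (0 : R), 0 < t ->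
    (- (F \o Psi)) (Phi z) < (- (F \o Psi)) (t *: 'e_i + Phi z).
  apply: derive_gt0_near; first exact: differentiableN.
  by rewrite deriveN ?oppr_gt0 //; exact: diff_derivable.
have [e e0 He] := near0_interval (filterI N1 line_straightened).
have e2 : 0 < e / 2 by rewrite divr_gt0.
have [|P1 P2] := He (e / 2).
  by rewrite gtr0_norm // ltr_pdivrMr // ltr_pMr // ltr1n.
have [UFy cy Ay] := P2 e2; have := P1 e2; have [_ UFz FL] := hF.
have Ty := sub_tclosure (LF_domain hL) Ay.
have Tz : tclosure A (tparam c z) by case: Cz.
have Fz : F z = 0 by rewrite (FL _ UFz cz Tz); exact: (LF_eq0 hL Cz).
rewrite !fctE /= PsiPhi ltrN2 Fz (FL _ UFy cy Ty) ltNge.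
by rewrite (ltW (LF_gt0 hL Ay)).
Qed.

Lemma near_straightened : exists2 e, 0 < e &
  forall y, ball (Phi z) e y -> (Phi @` U) y /\ UF (Psi y).
Proof.
have [oUF UFz _] := hF.
have nUF : nbhs (Phi z) (Psi @^-1` UF).
  by apply: (differentiable_continuous dPsi); rewrite PsiPhi; exact: open_nbhs_nbhs.
have [e e0 He] := (nbhs_ballP _ _).1 (filterI (open_nbhs_nbhs (conj oPU PUz)) nUF).
by exists e.
Qed.

(* Hadamard's lemma, in straightened coordinates. *)
Lemma divisible : exists2 e, 0 < e & exists H : V2 -> R,
  [/\ forall j, reg_le j.+1 k -> Cn j (ball (Phi z) e) H,
      0 < H (Phi z)
    & forall y, U y -> ball (Phi z) e (Phi y) -> tcod c y -> tclosure A (tparam c y) ->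
      L (tparam c y) = Phi y 0 i * H (Phi y)].
Proof.
have [_ [_ PhiK] [_ cPsi] hS] := hs; have [_ _ FL] := hF.
have [e e0 He] := near_straightened.
have oB : open (ball (Phi z) e) by exact: ball_open.
have starB (s : R) y : 0 <= s <= 1 -> ball (Phi z) e y -> ball (Phi z) e (squeeze i s y).
  by move=> s01; exact: squeeze_ball.
have [e2 [l2 hl2]] := frameE.
have cG j : reg_le j k -> Cn j (ball (Phi z) e) (F \o Psi).
  move=> jk; have cFj : Cn j UF F := Ck_Cn jk cF.
  have cPj : Cn j (Phi @` U) Psi := Ck_Cn jk cPsi.
  apply: (Cn_comp hl2 oB _ _ cFj); first by move=> y /He[].
  by apply: Cn_sub cPj => y /He[].
have k1 : reg_le 1 k by case: (k) hk => [[|l]|].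
exists e => //; exists (averaging i (fun=> 1) ('D_('e_i) (F \o Psi))).
have c1 : continuous (fun _ : R => 1 : R) by exact: cst_continuous.
split.
- by move=> j jk; apply: Cn_averaging => //; apply: Cn_derive; exact: cG.
- by rewrite averaging_fixed // derive_straightened; exact: normal_derive_gt0.
have z0 x : ball (Phi z) e x -> x 0 i = 0 -> (F \o Psi) x = 0.
  move=> Bx xi; have [Px UFx] := He _ Bx; have [Ux PPx] := PsiP hs Px.
  have [cx Cx] : (tcod c `&` tparam c @^-1` cone_structure A) (Psi x).
    by apply/(hS _ Ux).2; rewrite PPx.
  have Tx : tclosure A (tparam c (Psi x)) by case: Cx.
  by rewrite /= (FL _ UFx cx Tx); exact: (LF_eq0 hL Cx).
move=> y Uy By cy Ty; have Psiy : Psi (Phi y) = y by rewrite PhiK ?inE.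
have [_ UFy] := He _ By; rewrite Psiy in UFy.
have := hadamard starB (cG 1 k1) z0 By.
by rewrite /= Psiy (FL _ UFy cy Ty).
Qed.

End NormalDerivative.

Variables (A : set (tangent M)) (L1 L2 : tangent M -> R).
Hypotheses (h1 : Lorentz_Finsler k A L1) (h2 : Lorentz_Finsler k A L2).
Let cA := LF_domain h1.

(** The quotient is prescribed on [A] only, since it reads 0/0 on the cone structure, where
    continuity determines [H]; positivity is required up to the boundary. *)
Definition factor_extension c z (U : set E) (H : E -> R) : Prop :=
  [/\ open U, U z, Ck (omap predn k) U H
    & forall y, U y -> tcod c y -> tclosure A (tparam c y) ->
      0 < H y /\ (A (tparam c y) -> H y = L2 (tparam c y) / L1 (tparam c y))].

Lemma interior_factor c z : tcod c z -> A (tparam c z) ->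
  exists U H, factor_extension c z U H.
Proof.
move=> cz Az; have Tz := sub_tclosure cA Az.
have [U1 [F1 [[oU1 U1z FL1] cF1]]] := LF_chart_extension h1 cz Tz.
have [U2 [F2 [[oU2 U2z FL2] cF2]]] := LF_chart_extension h2 cz Tz.
pose A' := tcod c `&` tparam c @^-1` A.
have oA' : open A' := (cone_open cA : tangent_open A) c.
pose U := (U1 `&` U2) `&` A'.
have oU : open U by apply: openI => //; exact: openI.
have F1E y : U y -> F1 y = L1 (tparam c y).
  by move=> [[U1y _] [cy Ay]]; apply: FL1 => //; exact: (sub_tclosure cA).
have F2E y : U y -> F2 y = L2 (tparam c y).
  by move=> [[_ U2y] [cy Ay]]; apply: FL2 => //; exact: (sub_tclosure cA).
exists U, (F2 * (fun y => (F1 y)^-1)); split => //.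
  apply: Ck_predn => // j kj.
  have jk : reg_le j k by case: (k) kj => // l; exact: ltnW.
  have c1 : Cn j U1 F1 := Ck_Cn jk cF1; have c2 : Cn j U2 F2 := Ck_Cn jk cF2.
  apply: CnM => //; first by apply: Cn_sub c2 => y [[]].
  apply: CnV => //; last by apply: Cn_sub c1 => y [[]].
  by move=> y Uy; rewrite F1E // gt_eqF // (LF_gt0 h1) //; case: Uy => _ [].
move=> y Uy cy Ty; have [_ [_ Ay]] := Uy.
rewrite !fctE F1E // F2E //; split => //.
by rewrite divr_gt0 // ?(LF_gt0 h1) // (LF_gt0 h2).
Qed.

Lemma boundary_factor c z : tcod c z -> cone_structure A (tparam c z) ->
  exists U H, factor_extension c z U H.
Proof.
move=> cz Cz; have Tz : tclosure A (tparam c z) by case: Cz.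
have [U1 [F1 [hF1 cF1]]] := LF_chart_extension h1 cz Tz.
have [U2 [F2 [hF2 cF2]]] := LF_chart_extension h2 cz Tz.
have [U0 [Phi [Psi [i [hs U0z]]]]] := cone_straightening h1 cz Tz.
(* Both metrics are divided in the same straightening, so that the common factor [Phi y 0 i] cancels
   in the quotient. *)
have [e1 e10 [H1 [cH1 H1z H1E]]] := divisible h1 cz hs U0z Cz hF1 cF1.
have [e2 e20 [H2 [cH2 H2z H2E]]] := divisible h2 cz hs U0z Cz hF2 cF2.
have [oU0 _ [cPhi _] hS] := hs.
have k1 : reg_le 1 k by case: (k) hk => [[|l]|].
pose W := [set y | [/\ ball (Phi z) e1 y, ball (Phi z) e2 y, 0 < H1 y & 0 < H2 y]].
have oW : open W.
  rewrite openE => y [b1 b2 y1 y2].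
  have N1 : nbhs y (ball (Phi z) e1) by apply: open_nbhs_nbhs; split => //; exact: ball_open.
  have N2 : nbhs y (ball (Phi z) e2) by apply: open_nbhs_nbhs; split => //; exact: ball_open.
  have N3 := continuous_gt_near (Cn_continuous (cH1 0 k1) b1) y1.
  have N4 := continuous_gt_near (Cn_continuous (cH2 0 k1) b2) y2.
  by apply: filterS (filterI (filterI N1 N2) (filterI N3 N4)) => x [[? ?] [? ?]]; split.
have Wz : W (Phi z) by split => //; exact: ballxx.
pose U := U0 `&` Phi @^-1` W.
have cPhi0 : Cn 0 U0 Phi by apply: Ck_Cn cPhi; case: (k).
have oU : open U.
  rewrite openE => y [U0y Wy].
  have N0 : nbhs y U0 by exact: open_nbhs_nbhs.
  have N1 : nbhs y (Phi @^-1` W) :=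
    (Cn_continuous cPhi0 U0y) W (open_nbhs_nbhs (conj oW Wy)).
  exact: (filterI N0 N1).
have cH j : reg_le j.+1 k -> Cn j W (H2 * (fun y => (H1 y)^-1)).
  move=> jk; have c1 := cH1 j jk; have c2 := cH2 j jk.
  apply: CnM => //; first by apply: Cn_sub c2 => y [].
  apply: CnV => //; last by apply: Cn_sub c1 => y [].
  by move=> y [_ _ y1 _]; rewrite gt_eqF.
have cHPhi j : reg_le j.+1 k -> Cn j U ((H2 * (fun y => (H1 y)^-1)) \o Phi).
  move=> jk; have jk' : reg_le j k by case: (k) jk => // l; exact: ltnW.
  have cP : Cn j U0 Phi := Ck_Cn jk' cPhi.
  apply: (Cn_comp (@frame_rowvec R (n + n)) oU _ _ (cH j jk)) => [y []//|].
  by apply: Cn_sub cP => y [].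
exists U, ((H2 * (fun y => (H1 y)^-1)) \o Phi); split => //; first exact: Ck_predn.
move=> y [U0y [b1 b2 y1 y2]] cy Ty; rewrite /= !fctE; split; first by rewrite divr_gt0.
move=> Ay; have n0 : Phi y 0 i != 0.
  apply/eqP => /(hS _ U0y).2 [_ [_ nA]]; exact: nA.
by rewrite (H1E y) // (H2E y) //; field; rewrite n0 gt_eqF.
Qed.

End Factor.

(** * The global factor and its values on the cone structure *)

Section Equivalence.
Variables (R : realType) (n : nat) (k : option nat) (M : manifold R n (omap S k)).
Local Notation E := ('rV[R]_n * 'rV[R]_n)%type.
Hypothesis (hk : reg_ge2 k).

(** Inside the common closure, each cone domain is the locus where its metric does not vanish, and a
    positive factor preserves this locus. *)
Lemma factor_cone_domains_eq (A1 A2 : set (tangent M)) (L1 L2 mu : tangent M -> R) :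
  Lorentz_Finsler k A1 L1 -> Lorentz_Finsler k A2 L2 ->
  anisotropic_factor k A1 L1 A2 L2 mu -> A1 = A2.
Proof.
move=> h1 h2 [cE _ mu0 L2E].
apply/seteqP; split => v Av.
  have T1 := sub_tclosure (LF_domain h1) Av.
  apply: tclosureE; first by rewrite -cE.
  move=> Cv; have := L2E v T1; rewrite (LF_eq0 h2 Cv) => /eqP.
  by rewrite eq_sym mulf_eq0 !gt_eqF ?mu0 ?(LF_gt0 h1).
have T2 := sub_tclosure (LF_domain h2) Av; have T1 : tclosure A1 v by rewrite cE.
apply: tclosureE T1 _ => Cv; have := L2E v; rewrite cE (LF_eq0 h1 Cv) mulr0 => /(_ T2) L20.
by have := LF_gt0 h2 Av; rewrite L20 ltxx.
Qed.

Variables (A : set (tangent M)) (L1 L2 : tangent M -> R).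
Hypotheses (h1 : Lorentz_Finsler k A L1) (h2 : Lorentz_Finsler k A L2).

(** The limit of the quotient is independent of charts and extensions, so the local quotients need
    no gluing: by [factorE] each of them computes it. *)
Definition factor (v : tangent M) : R :=
  lim ((fun q => L2 q / L1 q) @ within A (nbhs v)).

Lemma factorE c z U H : factor_extension A L1 L2 c z U H ->
  forall y, U y -> tcod c y -> tclosure A (tparam c y) -> factor (tparam c y) = H y.
Proof.
move=> [oU Uz cH HL] y Uy cy Ty.
have PF : ProperFilter (within A (nbhs (tparam c y))).
  by apply: within_nbhs_proper; case: Ty.
have cH0 : Cn 0 U H by apply: Ck_Cn cH; case: (k).
apply/cvg_lim => // N HN.
have N1 : nbhs y (H @^-1` N) := (Cn_continuous cH0 Uy) N HN.
have UN : nbhs y (U `&` H @^-1` N) by apply: filterI N1; exact: open_nbhs_nbhs.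
have N2 := tparam_nbhs cy UN.
change (nbhs (tparam c y) (fun q => A q -> N (L2 q / L1 q))).
apply: filterS N2.
move=> _ [x [cx [Ux Nx]] <-] Ax.
by rewrite -(HL x Ux cx (sub_tclosure (LF_domain h1) Ax)).2.
Qed.

Lemma factor_extensionP c z : tcod c z -> tclosure A (tparam c z) ->
  exists U H, factor_extension A L1 L2 c z U H.
Proof.
move=> cz Tz; have [Az|nA] := pselect (A (tparam c z)); first exact: interior_factor.
by apply: boundary_factor.
Qed.

Lemma anisotropic_factor_exists : anisotropic_factor k A L1 A L2 factor.
Proof.
have at_v v : tclosure A v ->
    0 < factor v /\ (A v -> factor v = L2 v / L1 v).
  case: v => p v Tv; have cz := tcod_chart_at p v; have Ez := tparam_chart_at p v.
  rewrite -Ez in Tv *; have [U [H hUH]] := factor_extensionP cz Tv.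
  by have [_ Uz _ HL] := hUH; rewrite (factorE hUH) //; exact: HL.
split => //.
- move=> c z cz Tz; have [U [H hUH]] := factor_extensionP cz Tz.
  have [oU Uz cH _] := hUH; exists U, H; split => // y Uy cy Ty.
  by rewrite (factorE hUH).
- by move=> v /at_v[].
move=> v Tv; have [Cv|nC] := pselect (cone_structure A v).
  by rewrite (LF_eq0 h1 Cv) (LF_eq0 h2 Cv) mulr0.
have Av := tclosureE Tv nC.
by rewrite (at_v v Tv).2 // divfK // gt_eqF // (LF_gt0 h1).
Qed.

(* Both metrics vanish on the cone structure, so their differentials there are
   multiples of that of a defining function; the factors of proportionality are
   the derivatives along an inner normal, whose ratio is the limit of L2 / L1. *)
Lemma factor_formula (mu : tangent M -> R) : anisotropic_factor k A L1 A L2 mu ->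
  forall (v : tangent M) (w : 'rV[R]_n), cone_structure A v ->
  metric_tensor A L1 v v.2 w != 0 ->
  metric_tensor A L2 v v.2 w != 0 /\
  mu v = metric_tensor A L2 v v.2 w / metric_tensor A L1 v v.2 w.
Proof.
move=> [_ cmu mu0 L2E] [p v] w /= Cv.
have Kv := cone_closure hk h1 Cv; have [cv v0] := Kv.
have cz := tcod_chart_at p v; have Ez := tparam_chart_at p v.
set c := chart_at p in cz Ez; set z := (coord c p, v) in cz Ez.
have Cz : cone_structure A (tparam c z) by rewrite Ez.
have Tz : tclosure A (tparam c z) by case: Cz.
have [U1 [F1 [hF1 cF1]]] := LF_chart_extension h1 cz Tz.
have [U2 [F2 [hF2 cF2]]] := LF_chart_extension h2 cz Tz.
have [Um [m [oUm Umz cm mE]]] := cmu c z cz Tz.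
have [U0 [Phi [Psi [i [hs U0z]]]]] := cone_straightening h1 cz Tz.
pose lam1 := 'D_(inner_normal Phi Psi i z) F1 z.
pose lam2 := 'D_(inner_normal Phi Psi i z) F2 z.
have lam1_gt0 : 0 < lam1 := normal_derive_gt0 hk h1 cz hs U0z Cz hF1 cF1.
have lam2_gt0 : 0 < lam2 := normal_derive_gt0 hk h2 cz hs U0z Cz hF2 cF2.
have metric (L : tangent M -> R) (hL : Lorentz_Finsler k A L) (U : set E) (F : E -> R) :
    chart_extension A L c z U F -> Ck k U F ->
    metric_tensor A L (p, v) v w = 'D_(inner_normal Phi Psi i z) F z *
      'D_(0, vchartV c z.1 w) (defining Phi i) z / 2.
  move=> hF cF; have [U' [f [fe Df]]] := restrict_fiber_extension cz hF (Ck2 hk cF).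
  rewrite Ez /= in fe; rewrite (metric_tensor_radial hL cv fe).
  have [_ U'v _ _] := fe.
  rewrite Df // -(chart_boundary_derive hk hL cz hs U0z Cz hF cF); congr ('D_ _ F _ / 2).
  by rewrite -[v in vchartV _ _ v]/((p, v).2) -Ez tparamE /= vchartK.
rewrite (metric _ h1 _ _ hF1 cF1) (metric _ h2 _ _ hF2 cF2) -/lam1 -/lam2.
set d := 'D_(0, _) _ _ => d0.
have dn0 : d != 0 by apply: contra_neq d0 => ->; rewrite mulr0 mul0r.
split; first by rewrite mulf_neq0 ?invr_eq0 // mulf_neq0 // gt_eqF.
(* Both tensors contain the same factor [d / 2], so the ratio is [lam2 / lam1]. *)
suff E : lam2 = mu (p, v) * lam1.
  by rewrite E; field; rewrite dn0 gt_eqF.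
have <- : m z = mu (p, v) by rewrite mE // Ez.
have [oU0 [oPU PhiK] [_ cPsi] _] := hs.
have PUz : (Phi @` U0) (Phi z) by exists z.
have Psiz : Psi (Phi z) = z by rewrite PhiK ?inE.
have cPsi1 : Cn 1 (Phi @` U0) Psi by apply: Ck_Cn cPsi; case: (k) hk => [[|j]|].
have dPsi : differentiable Psi (Phi z) := Cn_diff cPsi1 PUz.
(* Quotients along the inward line through [z]. Only [t > 0] is used, as the relation [L2 = mu L1]
   controls the extensions only on that side; since [F1] and [F2] vanish at [z], continuity of [m]
   is enough to pass to the limit. *)
pose q (F : E -> R) (t : R) : R :=
  t^-1 *: (((F \o Psi) \o shift (Phi z)) (t *: 'e_i) - (F \o Psi) (Phi z)).
have qlim (L : tangent M -> R) (hL : Lorentz_Finsler k A L) (U : set E) (F : E -> R) :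
    chart_extension A L c z U F -> Ck k U F ->
    q F @ (0 : R)^'+ --> 'D_(inner_normal Phi Psi i z) F z.
  move=> hF cF; rewrite -(derive_straightened hk hs U0z hF cF).
  have [_ UFz _] := hF.
  have dF : differentiable F (Psi (Phi z)) by rewrite Psiz; exact: (Cn_diff (Ck2 hk cF) UFz).
  have dq : derivable (F \o Psi) (Phi z) 'e_i.
    by apply: diff_derivable; exact: differentiable_comp.
  apply: cvg_trans _ (dq : q F @ (0 : R)^' --> _).
  by apply: cvg_app; apply: within_subset => t /= /gt_eqF ->.
have Fz (L : tangent M -> R) (hL : Lorentz_Finsler k A L) (U : set E) (F : E -> R) :
    chart_extension A L c z U F -> F z = 0.
  by move=> [_ UFz FL]; rewrite (FL _ UFz cz Tz); exact: (LF_eq0 hL Cz).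
have cm0 : Cn 0 Um m by apply: Ck_Cn cm; case: (k).
pose path (t : R) := Psi (t *: 'e_i + Phi z).
have cpath : path @ (0 : R) --> z.
  move=> N Nz; have NP : nbhs (Phi z) (Psi @^-1` N).
    by apply: (differentiable_continuous dPsi); rewrite Psiz.
  exact: (@nbhs_line R _ (Phi z) 'e_i _ NP).
have cmpath : (m \o path) @ (0 : R)^'+ --> m z.
  apply: cvg_at_right_filter => N Nm.
  exact: (cpath _ (Cn_continuous cm0 Umz Nm)).
have c1 : (fun t => m (path t) * q F1 t) @ (0 : R)^'+ --> m z * lam1.
  exact: (cvgM cmpath (qlim _ h1 _ _ hF1 cF1)).
have c2 := qlim _ h2 _ _ hF2 cF2.
suff EQ : {near (0 : R)^'+, (fun t => m (path t) * q F1 t) =1 q F2}.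
  have c3 : q F2 @ (0 : R)^'+ --> m z * lam1.
    by apply: cvg_trans c1; exact: (near_eq_cvg EQ).
  exact: (cvg_unique _ c2 c3).
have N1 := line_straightened hk cz hs U0z Cz hF1.
have N2 := line_straightened hk cz hs U0z Cz hF2.
have N3 : \forall t \near (0 : R), Um (path t).
  by apply: cpath; exact: open_nbhs_nbhs.
rewrite near_withinE; apply: filterS (filterI (filterI N1 N2) N3) => t [[P1 P2] P3] t0.
have [U1t ct At] := P1 t0; have [U2t _ _] := P2 t0.
have Tt := sub_tclosure (LF_domain h1) At.
have [_ _ FL1] := hF1; have [_ _ FL2] := hF2.
rewrite /q /= Psiz (Fz _ h1 _ _ hF1) (Fz _ h2 _ _ hF2) !subr0.
rewrite (FL1 _ U1t ct Tt) (FL2 _ U2t ct Tt) (L2E _ Tt) -mE //.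
by rewrite /GRing.scale /= mulrCA.
Qed.

End Equivalence.

(* TM is a C^k manifold when M is C^{k+1}. *)
Theorem theorem3p11 (R : realType) (n : nat) (k : option nat)
    (M : manifold R n (omap S k)) (A1 A2 : set (tangent M))
    (L1 L2 : tangent M -> R)
    (hn : (2 <= n)%N) (hk : reg_ge2 k)
    (hL1 : Lorentz_Finsler k A1 L1) (hL2 : Lorentz_Finsler k A2 L2) :
  (anisotropically_equivalent k A1 L1 A2 L2 <->
     cone_structure A1 = cone_structure A2) /\
  (forall mu : tangent M -> R, anisotropic_factor k A1 L1 A2 L2 mu ->
     forall (v : tangent M) (w : 'rV[R]_n), cone_structure A1 v ->
     metric_tensor A1 L1 v v.2 w != 0 ->
     metric_tensor A2 L2 v v.2 w != 0 /\
     mu v = metric_tensor A2 L2 v v.2 w / metric_tensor A1 L1 v v.2 w).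
Proof.
split; first split.
- by move=> [mu hmu]; rewrite (factor_cone_domains_eq hL1 hL2 hmu).
- move=> /(cone_domains_eq hk hn hL1 hL2) EA; subst A2.
  by exists (factor A1 L1 L2); exact: anisotropic_factor_exists.
move=> mu hmu; have EA := factor_cone_domains_eq hL1 hL2 hmu; subst A2.
exact: factor_formula.
Qed.
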